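(* Let $\Psi$ be either an admissible wavelet (wavelet case) or an admissible window (time-frequency case). The spectrum of a bounded Toeplitz localization operator $T_\alpha^\Psi$ acting on $W_\Psi(L_2(\mathbb{R}))$ with a measurable symbol $a(r,s)=\alpha(r)$ on $G=G_1\times G_2$ coincides with its essential spectrum, and is given by $$\mathrm{sp}\,T_\alpha^\Psi=\mathrm{clos}\,\{\gamma_\alpha^\Psi(\xi);\ \xi\in G_2\},\qquad\text{where}\quad \gamma_\alpha^\Psi(\xi)=\int_{G_1}\alpha(r)\,|\ell_\Psi(r,\xi)|^2\,\mathrm{d}\zeta_1(r).$$ Moreover, for a real-valued function $a(r,s)=\alpha(r)$ we have $$\mathrm{sp}\,T_\alpha^\Psi=\Big[\inf_{\xi\in G_2}\gamma_\alpha^\Psi(\xi),\ \sup_{\xi\in G_2}\gamma_\alpha^\Psi(\xi)\Big].$$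
   Context: The Fourier transform on $L_2(\mathbb{R})$ is $\hat f(\xi)=\int_{\mathbb{R}}f(x)\mathrm{e}^{-2\pi\mathrm{i}x\xi}\,\mathrm{d}x$. Two cases are treated in parallel. Wavelet case: $\Psi=\psi\in L_2(\mathbb{R})$ is a real-valued admissible wavelet, i.e. $\int_{\mathbb{R}_+}|\hat\psi(t\xi)|^2\frac{\mathrm{d}t}{t}=1$ for almost every $\xi\in\mathbb{R}$; $G=G_1\times G_2$ with $G_1=\mathbb{R}_+$, $G_2=\mathbb{R}$, $\mathrm{d}\zeta_1=u^{-2}\mathrm{d}u$, $\mathrm{d}\zeta_2=\mathrm{d}v$, $\mathrm{d}\zeta=u^{-2}\mathrm{d}u\,\mathrm{d}v$; for $\zeta=(u,v)\in G$, $\Psi_\zeta(x)=u^{-1/2}\psi((x-v)/u)$; and $\ell_\psi(u,\omega)=\sqrt{u}\,\overline{\hat\psi(u\omega)}$. Time-frequency case: $\Psi=\phi\in L_2(\mathbb{R})$ is an admissible window, i.e. $\|\phi\|_{L_2(\mathbb{R})}=1$; $G=G_1\times G_2$ with $G_1=G_2=\mathbb{R}$, $\mathrm{d}\zeta_1=\mathrm{d}q$, $\mathrm{d}\zeta_2=\mathrm{d}p$, $\mathrm{d}\zeta=\mathrm{d}q\,\mathrm{d}p$; for $\zeta=(q,p)\in G$, $\Psi_\zeta(x)=\mathrm{e}^{2\pi\mathrm{i}px}\phi(x-q)$; and $\ell_\phi(q,\omega)=\overline{\phi(\omega-q)}$. In both cases $(W_\Psi f)(\zeta)=\langle f,\Psi_\zeta\rangle$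 for $f\in L_2(\mathbb{R})$; $W_\Psi: L_2(\mathbb{R})\to L_2(G,\mathrm{d}\zeta)$ is an isometry with range $W_\Psi(L_2(\mathbb{R}))$, and $P_\Psi$ is the orthogonal projection of $L_2(G,\mathrm{d}\zeta)$ onto this range. The Toeplitz localization operator with symbol $a$ (introduced for bounded $a$; the same notation is used for measurable, possibly unbounded, symbols) is $T_a^\Psi: F\in W_\Psi(L_2(\mathbb{R}))\mapsto P_\Psi(aF)\in W_\Psi(L_2(\mathbb{R}))$; for $a(r,s)=\alpha(r)$ it is written $T_\alpha^\Psi$. $\mathrm{sp}$ denotes the spectrum and $\mathrm{clos}$ the closure.
   Formalization: In the wavelet case ξ ranges over G_2 without 0, since γ(0) depends on the value of ψ̂ at one point and including it makes the claim false (α=1); T_α^Ψ is read as defined on all of W_Ψ(L_2(R)), i.e. αF lies in L_2(G) for every F there. *)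

(* Defs.v *)
(* Elements of L_2 are represented by functions; two functions denote the same
   element when they agree almost everywhere.  All functions take values in
   R[i]; measurability and integration are meant componentwise, and measurable
   sets of the line are the Borel sets. *)
From HB Require Import structures.
From mathcomp Require Import all_boot all_order all_algebra.
From mathcomp Require Import complex.
From mathcomp Require Import all_classical all_reals all_analysis.
From mathcomp Require Import measurable_realfun.

Set Implicit Arguments.
Unset Strict Implicit.
Unset Printing Implicit Defensive.

Import Order.TTheory GRing.Theory Num.Theory numFieldNormedType.Exports.

Local Open Scope classical_set_scope.
Local Open Scope ring_scope.
Local Open Scope complex_scope.

Notation normc := ComplexField.Normc.normc.

Section L2.
Context d (T : measurableType d) (R : realType).
Variables (mu : {measure set T -> \bar R}) (D : set T).
Implicit Types f g : T -> R[i].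

Definition cmeasurable f :=
  measurable_fun D (fun x => complex.Re (f x)) /\
  measurable_fun D (fun x => complex.Im (f x)).

Definition cintegral f : R[i] :=
  Rintegral mu D (fun x => complex.Re (f x)) +i*
  Rintegral mu D (fun x => complex.Im (f x)).

Definition l2norm f : \bar R :=
  sqrte (\int[mu]_(x in D) (normc (f x) ^+ 2)%:E)%E.

Definition L2 : set (T -> R[i]) :=
  [set f | cmeasurable f /\ (l2norm f < +oo)%E].

Definition inner f g : R[i] := cintegral (fun x => f x * conjc (g x)).

End L2.

(* Operators on a subspace S of L_2(D, mu).  Linearity together with
   boundedness makes a bounded operator compatible with a.e. equality. *)
Section operators.
Context d (T : measurableType d) (R : realType).
Variables (mu : {measure set T -> \bar R}) (D : set T).
Variable S : set (T -> R[i]).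
Implicit Types A B : (T -> R[i]) -> (T -> R[i]).

Definition bounded_operator A :=
  [/\ forall F, S F -> S (A F),
      forall (c : R[i]) F H, S F -> S H ->
        A (fun x => c * F x + H x) = (fun x => c * A F x + A H x)
          %[ae mu in D] &
      exists M : R, forall F, S F ->
        (l2norm mu D (A F) <= M%:E * l2norm mu D F)%E].

Definition invertible A :=
  exists B, bounded_operator B /\
    forall F, S F -> B (A F) = F %[ae mu in D] /\ A (B F) = F %[ae mu in D].

Definition finite_dim_kernel A :=
  exists (n : nat) (e : 'I_n -> T -> R[i]), (forall i, S (e i)) /\
    forall F, S F -> A F = (fun=> 0) %[ae mu in D] ->
      exists c : 'I_n -> R[i],
        F = (fun x => \sum_(i < n) c i * e i x) %[ae mu in D].

Definition closed_range A :=
  forall H, S H ->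
    (forall eps : R, 0 < eps ->
      exists2 F, S F & (l2norm mu D (fun x => A F x - H x)%R < eps%:E)%E) ->
    exists2 F, S F & A F = H %[ae mu in D].

Definition finite_codim_range A :=
  exists (n : nat) (e : 'I_n -> T -> R[i]), (forall i, S (e i)) /\
    forall H, S H -> exists2 F, S F & exists c : 'I_n -> R[i],
      H = (fun x => A F x + \sum_(i < n) c i * e i x) %[ae mu in D].

Definition fredholm A :=
  [/\ finite_dim_kernel A, closed_range A & finite_codim_range A].

Definition shift A (lambda : R[i]) := fun F x => A F x - lambda * F x.

Definition spectrum A : set R[i] :=
  [set lambda | ~ invertible (shift A lambda)].

Definition ess_spectrum A : set R[i] :=
  [set lambda | ~ fredholm (shift A lambda)].

(* A representative of the orthogonal projection of H onto S. *)
Definition ortho_proj (H : T -> R[i]) : T -> R[i] :=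
  xget (fun=> 0) [set K | S K /\
    forall L, S L -> inner mu D (fun x => H x - K x) L = 0].

End operators.

Section fourier.
Context (R : realType).
Local Notation leb := (@lebesgue_measure R).
Implicit Types f g : R -> R[i].

Definition expi (t : R) : R[i] := cos t +i* sin t.

Definition fourier_trunc f (n : nat) (xi : R) : R[i] :=
  cintegral leb `[- n%:R, n%:R] (fun x => f x * expi (- (2 * pi * x * xi))).

(* The Fourier transform on L_2 is the L_2-limit of the truncated integrals. *)
Definition is_fourier f g :=
  L2 leb setT g /\
  (fun n => l2norm leb setT (fun xi => g xi - fourier_trunc f n xi)) @ \oo
    --> 0%E.

Definition fourier f : R -> R[i] := xget (fun=> 0) [set g | is_fourier f g].

End fourier.

Section affine_measure.
Context (R : realType).
Local Notation leb := (@lebesgue_measure R).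

Definition affine_measure (A : set (measurableTypeR R)) : \bar R :=
  (\int[leb]_(u in A `&` `]0%R, +oo[) (u ^- 2)%:E)%E.

Let w : R -> \bar R := (fun u : R => (u ^- 2)%:E) \_ `]0%R, +oo[.

Let affineE A : measurable A -> affine_measure A = (\int[leb]_(u in A) w u)%E.
Proof. by move=> mA; rewrite /affine_measure integral_mkcondr. Qed.

Let w_ge0 u : (0 <= w u)%E.
Proof.
rewrite /w patchE; case: ifPn => // _.
by rewrite lee_fin invr_ge0 exprn_even_ge0.
Qed.

Let measurable_w : measurable_fun (setT : set (measurableTypeR R)) w.
Proof.
apply/(measurable_restrictT _ _).1 => //.
apply/measurable_EFinP; apply: open_continuous_measurable_fun.
  exact: interval_open.
move=> u; rewrite inE /= in_itv /= andbT => u0.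
apply: cvgV; last exact: exprn_continuous.
by rewrite expf_neq0// gt_eqF.
Qed.

Let affine0 : affine_measure set0 = 0%E.
Proof. by rewrite /affine_measure set0I integral_set0. Qed.

Let affine_ge0 A : (0 <= affine_measure A)%E.
Proof.
apply: integral_ge0 => u _.
by rewrite lee_fin invr_ge0 exprn_even_ge0.
Qed.

Let affine_sigma : semi_sigma_additive affine_measure.
Proof.
move=> F mF tF mUF; rewrite affineE//.
under eq_fun do under eq_bigr do rewrite affineE//.
rewrite ge0_integral_bigcup//.
  by apply: is_cvg_ereal_nneg_natsum_cond => // n _ _; exact: integral_ge0.
exact: measurable_funTS.
Qed.

HB.instance Definition _ := isMeasure.Build _ _ _ affine_measure
  affine0 affine_ge0 affine_sigma.

End affine_measure.

Variant setting := Wavelet | TimeFrequency.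

Section toeplitz.
Context (R : realType) (c : setting).
Local Notation leb := (@lebesgue_measure R).
Implicit Types (Psi f alpha : R -> R[i]) (F : R * R -> R[i]).

Definition G1 : set R := if c is Wavelet then `]0, +oo[ else setT.

Definition G : set (R * R) := G1 `*` setT.

Definition zeta1 : {measure set (measurableTypeR R) -> \bar R} :=
  if c is Wavelet then @affine_measure R else leb.

Definition zeta := (zeta1 \x leb)%E.

Definition admissible Psi : Prop :=
  match c with
  | Wavelet =>
      [/\ L2 leb setT Psi,
          \forall x \ae leb, complex.Im (Psi x) = 0 &
          \forall xi \ae leb,
            (\int[leb]_(t in `]0%R, +oo[)
               (normc (fourier Psi (t * xi)) ^+ 2 / t)%:E = 1)%E]
  | TimeFrequency => L2 leb setT Psi /\ l2norm leb setT Psi = 1%E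
  end.

Definition atom Psi (z : R * R) (x : R) : R[i] :=
  match c with
  | Wavelet => ((Num.sqrt z.1)^-1)%:C * Psi ((x - z.2) / z.1)
  | TimeFrequency => expi (2 * pi * z.2 * x) * Psi (x - z.1)
  end.

Definition ell Psi (r omega : R) : R[i] :=
  match c with
  | Wavelet => (Num.sqrt r)%:C * conjc (fourier Psi (r * omega))
  | TimeFrequency => conjc (Psi (omega - r))
  end.

Definition transform Psi f (z : R * R) : R[i] :=
  inner leb setT f (atom Psi z).

(* All representatives of the elements of W_Psi(L_2). *)
Definition transform_range Psi : set (R * R -> R[i]) :=
  [set F | L2 zeta G F /\
    exists2 f, L2 leb setT f & F = transform Psi f %[ae zeta in G]].

Definition mul_symbol alpha F (z : R * R) : R[i] := alpha z.1 * F z.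

Definition toeplitz Psi alpha F : R * R -> R[i] :=
  ortho_proj zeta G (transform_range Psi) (mul_symbol alpha F).

(* P_Psi acts on L_2(G), so F |-> P_Psi (a F) is a map on the whole of
   W_Psi(L_2) only if multiplication by the symbol sends W_Psi(L_2) to
   L_2(G); this is automatic for bounded symbols. *)
Definition bounded_toeplitz Psi alpha :=
  (forall F, transform_range Psi F -> L2 zeta G (mul_symbol alpha F)) /\
  bounded_operator zeta G (transform_range Psi) (toeplitz Psi alpha).

Definition toeplitz_spectrum Psi alpha : set R[i] :=
  spectrum zeta G (transform_range Psi) (toeplitz Psi alpha).

Definition toeplitz_ess_spectrum Psi alpha : set R[i] :=
  ess_spectrum zeta G (transform_range Psi) (toeplitz Psi alpha).

Definition gamma Psi alpha (xi : R) : R[i] :=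
  cintegral zeta1 G1 (fun r => alpha r * (normc (ell Psi r xi) ^+ 2)%:C).

(* In the wavelet case gamma at 0 would involve the value at the single point 0
   of the L_2-class of the Fourier transform of psi, hence is not well defined;
   at every other point of G_2 = R, gamma does not depend on the chosen
   representative. *)
Definition frequencies : set R := if c is Wavelet then [set~ 0] else setT.

End toeplitz.

(* Main.v *)
(* In the second variable of G, W_Psi f is a Fourier transform: up to replacing
   f by its Fourier transform in the wavelet case, W_Psi f (r, s) is the
   integral of k(w) ell(r, w) e^(+-2 pi i s w) dw.  Write U for the map k |-> W_Psi f.
   By Plancherel in s, Fubini, and the admissibility condition
   int |ell(r, w)|^2 dzeta_1(r) = 1, U is an isometry and
   <alpha U k, U h> = int gamma(w) k(w) conj(h(w)) dw, so that T_alpha is unitarily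
   equivalent to the multiplication by gamma on L_2(R).

   Boundedness of gamma at every frequency comes from the hypothesis that
   alpha U k is in L_2(G) for all k, which bounds
   int |alpha(r)|^2 |ell(r, w)|^2 dzeta_1(r) for almost every w, hence for every w
   because w |-> |ell(., w)|^2 is continuous into L_1; the same continuity makes
   gamma continuous.  If lambda is in the closure of the values of gamma, the
   sets |gamma - lambda| < 2^-m are open and nonempty, hence contain disjoint
   sets of positive measure, on which one builds arbitrarily many functions that
   are independent modulo the range of gamma - lambda: T_alpha - lambda is not
   Fredholm.  In the real case gamma has a connected image since it is
   continuous, and even in the wavelet case. *)
Require Import Defs.
From HB Require Import structures.
From mathcomp Require Import all_boot all_order all_algebra.
From mathcomp Require Import complex.
From mathcomp Require Import all_classical all_reals all_analysis.
From mathcomp Require Import measurable_realfun.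
From mathcomp Require Import ring lra.

Set Implicit Arguments.
Unset Strict Implicit.
Unset Printing Implicit Defensive.

Import Order.TTheory GRing.Theory Num.Theory numFieldNormedType.Exports.

Local Open Scope classical_set_scope.
Local Open Scope ring_scope.
Local Open Scope complex_scope.

(** Both cases are instances of one model with parameters: a measure [m1] on G_1, a kernel [l], a
    number [s] with s^2 = (2 pi)^2 and an open set [freq] with null complement. The time-frequency
    case takes k = f and s = -2 pi; the wavelet case takes for k the Fourier transform of f, and s =
    2 pi. Two obstacles shape the proof. Elements of L_2 are given by representatives, and the
    projection and the Fourier transform are chosen ones: operator identities hold almost everywhere
    only, and linearity of the Fourier transform is replaced by norms and inner products. Moreover
    alpha may be unbounded while gamma is evaluated at each single frequency: estimates on gamma
    rest on |alpha| <= N + |alpha|^2 / N, where the second term is controlled by the integral of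
    |alpha|^2 against the squared kernel. Plancherel itself is derived from Abel summation, whose
    damping factor has an explicit Fourier transform. *)

Local Notation cRe := complex.Re.
Local Notation cIm := complex.Im.

(** * Complex-valued functions and L_2 *)

Section normc_theory.
Context (R : realType).
Implicit Types (z w : R[i]) (x t : R).

Lemma cReD z w : cRe (z + w) = cRe z + cRe w.
Proof. by case: z w => [a b] [c d]. Qed.

Lemma cImD z w : cIm (z + w) = cIm z + cIm w.
Proof. by case: z w => [a b] [c d]. Qed.

Lemma cReN z : cRe (- z) = - cRe z. Proof. by case: z. Qed.

Lemma cImN z : cIm (- z) = - cIm z. Proof. by case: z. Qed.

Lemma cReM z w : cRe (z * w) = cRe z * cRe w - cIm z * cIm w.
Proof. by case: z w => [a b] [c d]. Qed.

Lemma cImM z w : cIm (z * w) = cRe z * cIm w + cIm z * cRe w.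
Proof. by case: z w => [a b] [c d]. Qed.

Lemma cReJ z : cRe (conjc z) = cRe z. Proof. by case: z. Qed.

Lemma cImJ z : cIm (conjc z) = - cIm z. Proof. by case: z. Qed.

Lemma conjcM z w : conjc (z * w) = conjc z * conjc w. Proof. exact: rmorphM. Qed.

Lemma complex_eqP z w : cRe z = cRe w -> cIm z = cIm w -> z = w.
Proof. by case: z w => [a b] [c d] /= -> ->. Qed.

Lemma normc_ge0 z : 0 <= normc z.
Proof. by case: z => a b; exact: sqrtr_ge0. Qed.

Lemma normc_sqr z : normc z ^+ 2 = cRe z ^+ 2 + cIm z ^+ 2.
Proof. by case: z => a b /=; rewrite sqr_sqrtr// addr_ge0// sqr_ge0. Qed.

Lemma normc_conj z : normc (conjc z) = normc z.
Proof. by case: z => a b /=; rewrite sqrrN. Qed.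

Lemma normcR x : normc x%:C = `|x|.
Proof. by rewrite /= expr0n/= addr0 sqrtr_sqr. Qed.

Lemma cRe_le z : `|cRe z| <= normc z.
Proof.
rewrite -(@ler_pXn2r _ 2)// ?nnegrE ?normc_ge0//.
by rewrite normc_sqr real_normK ?num_real// lerDl sqr_ge0.
Qed.

Lemma cIm_le z : `|cIm z| <= normc z.
Proof.
rewrite -(@ler_pXn2r _ 2)// ?nnegrE ?normc_ge0//.
by rewrite normc_sqr real_normK ?num_real// lerDr sqr_ge0.
Qed.

Lemma normc_le_ReIm z : normc z <= `|cRe z| + `|cIm z|.
Proof.
rewrite -(@ler_pXn2r _ 2)// ?nnegrE ?normc_ge0// ?addr_ge0//.
rewrite normc_sqr sqrrD !real_normK ?num_real//.
by rewrite addrAC lerDl mulrn_wge0// mulr_ge0.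
Qed.

Lemma mulcJ z : z * conjc z = (normc z ^+ 2)%:C.
Proof.
apply: complex_eqP; rewrite ?cReM ?cImM ?cReJ ?cImJ/= ?normc_sqr; ring.
Qed.

Lemma normc_eq0 z : (normc z == 0) = (z == 0).
Proof.
apply/eqP/eqP => [/ComplexField.Normc.eq0_normc//|->].
exact: ComplexField.Normc.normc0.
Qed.

Lemma normcB z w : normc (z - w) = normc (w - z).
Proof. by rewrite -normcN opprB. Qed.

Lemma normc_sqrD_le z w :
  normc (z + w) ^+ 2 <= 2 * normc z ^+ 2 + 2 * normc w ^+ 2.
Proof.
have := sqr_ge0 (cRe z - cRe w); have := sqr_ge0 (cIm z - cIm w).
rewrite !normc_sqr cReD cImD; nra.
Qed.

Lemma expiD t x : expi (t + x) = expi t * expi x.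
Proof.
apply: complex_eqP; rewrite ?cReM ?cImM/=; first exact: cosD.
by rewrite sinD addrC.
Qed.

Lemma expiN t : expi (- t) = conjc (expi t).
Proof. by rewrite /expi/= cosN sinN. Qed.

Lemma normc_expi t : normc (expi t) = 1.
Proof. by rewrite /= cos2Dsin2 sqrtr1. Qed.

End normc_theory.

Notation normcM := ComplexField.Normc.normcM.
Notation normc0 := ComplexField.Normc.normc0.
Notation normc1 := ComplexField.Normc.normc1.

Section cmeasurable_theory.
Context d (T : measurableType d) (R : realType) (D : set T).
Implicit Types (f g : T -> R[i]).

Lemma cmeasurableD f g : cmeasurable D f -> cmeasurable D g ->
  cmeasurable D (fun x => f x + g x).
Proof.
move=> [f1 f2] [g1 g2]; split.
  by under eq_fun do rewrite cReD; exact: measurable_funD.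
by under eq_fun do rewrite cImD; exact: measurable_funD.
Qed.

Lemma cmeasurableM f g : cmeasurable D f -> cmeasurable D g ->
  cmeasurable D (fun x => f x * g x).
Proof.
move=> [f1 f2] [g1 g2]; split.
  under eq_fun do rewrite cReM.
  by apply: measurable_funB; exact: measurable_funM.
under eq_fun do rewrite cImM.
by apply: measurable_funD; exact: measurable_funM.
Qed.

Lemma cmeasurable_cst (z : R[i]) : cmeasurable D (fun=> z).
Proof. by split; exact: measurable_cst. Qed.

Lemma cmeasurableZ z f : cmeasurable D f -> cmeasurable D (fun x => z * f x).
Proof. by move=> ?; apply: cmeasurableM => //; exact: cmeasurable_cst. Qed.

Lemma cmeasurableN f : cmeasurable D f -> cmeasurable D (fun x => - f x).
Proof.
move=> [f1 f2]; split.
  by under eq_fun do rewrite cReN; exact: measurable_funN.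
by under eq_fun do rewrite cImN; exact: measurable_funN.
Qed.

Lemma cmeasurableB f g : cmeasurable D f -> cmeasurable D g ->
  cmeasurable D (fun x => f x - g x).
Proof. by move=> mf mg; apply: cmeasurableD => //; exact: cmeasurableN. Qed.

Lemma cmeasurableJ f : cmeasurable D f -> cmeasurable D (fun x => conjc (f x)).
Proof.
move=> [f1 f2]; split.
  by under eq_fun do rewrite cReJ.
by under eq_fun do rewrite cImJ; exact: measurable_funN.
Qed.

Lemma cmeasurableR (f : T -> R) : measurable_fun D f ->
  cmeasurable D (fun x => (f x)%:C).
Proof. by move=> mf; split => //=; exact: measurable_cst. Qed.

Lemma cmeasurable_expi (f : T -> R) : measurable_fun D f ->
  cmeasurable D (fun x => expi (f x)).
Proof.
move=> mf; split => /=; apply: measurableT_comp => //;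
  apply: continuous_measurable_fun; [exact: continuous_cos|exact: continuous_sin].
Qed.

Lemma measurable_normc_sqr f : cmeasurable D f ->
  measurable_fun D (fun x => normc (f x) ^+ 2).
Proof.
move=> [f1 f2]; under eq_fun do rewrite normc_sqr.
by apply: measurable_funD; exact: measurable_funX.
Qed.

Lemma measurable_normc f : cmeasurable D f ->
  measurable_fun D (fun x => normc (f x)).
Proof.
move=> mf; rewrite (_ : (fun _ => _) =
    (fun x => Num.sqrt (normc (f x) ^+ 2))); last first.
  by apply/funext => x; rewrite sqrtr_sqr ger0_norm ?normc_ge0.
apply: measurableT_comp; last exact: measurable_normc_sqr.
by apply: continuous_measurable_fun; exact: sqrt_continuous.
Qed.

End cmeasurable_theory.

Lemma cmeasurable_comp d d' (T : measurableType d) (T' : measurableType d')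
    (R : realType) (D : set T) (f : T' -> R[i]) (g : T -> T') :
  cmeasurable setT f -> measurable_fun D g -> cmeasurable D (fun x => f (g x)).
Proof.
by move=> [f1 f2] mg; split;
  [exact: (measurableT_comp f1 mg)|exact: (measurableT_comp f2 mg)].
Qed.

Section ae_lemmas.
Context d (T : measurableType d) (R : realType) (mu : {measure set T -> \bar R}).
Implicit Types P Q : T -> Prop.

Lemma ae_impl P Q : (forall x, P x -> Q x) ->
  (\forall x \ae mu, P x) -> \forall x \ae mu, Q x.
Proof. by move=> PQ; exact: filterS. Qed.

Lemma ae_impl2 P P' Q : (forall x, P x -> P' x -> Q x) ->
  (\forall x \ae mu, P x) -> (\forall x \ae mu, P' x) -> \forall x \ae mu, Q x.
Proof. by move=> PQ; exact: filterS2. Qed.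

Lemma ae_impl3 P P' P'' Q : (forall x, P x -> P' x -> P'' x -> Q x) ->
  (\forall x \ae mu, P x) -> (\forall x \ae mu, P' x) -> (\forall x \ae mu, P'' x) ->
  \forall x \ae mu, Q x.
Proof. by move=> PQ; exact: filterS3. Qed.

End ae_lemmas.

Section cintegral_theory.
Context d (T : measurableType d) (R : realType).
Variables (mu : {measure set T -> \bar R}) (D : set T).
Hypothesis mD : measurable D.
Implicit Types (f g : T -> R[i]).

(** Stated through the modulus, so that one real majorant controls both components in domination and
    Fubini arguments. *)
Definition cintegrable f :=
  cmeasurable D f /\ (\int[mu]_(x in D) (normc (f x))%:E < +oo)%E.

Lemma cintegrable_normc f : cintegrable f ->
  mu.-integrable D (fun x => (normc (f x))%:E).
Proof.
move=> [mf foo]; apply/integrableP; split.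
  by apply/measurable_EFinP; exact: measurable_normc.
by under eq_integral do rewrite gee0_abs ?lee_fin ?normc_ge0//.
Qed.

Lemma cintegrable_le f (h : T -> R) : cmeasurable D f ->
  mu.-integrable D (EFin \o h) -> (forall x, D x -> normc (f x) <= h x) ->
  cintegrable f.
Proof.
move=> mf ih fh; split => //.
case/integrableP: (ih) => mh; apply: le_lt_trans.
apply: ge0_le_integral => //.
- by move=> x _; rewrite lee_fin normc_ge0.
- by apply/measurable_EFinP; exact: measurable_normc.
- exact: measurableT_comp.
- by move=> x Dx /=; rewrite lee_fin (le_trans (fh _ Dx))// ler_norm.
Qed.

Lemma cintegrable_Re f : cintegrable f -> mu.-integrable D (fun x => (cRe (f x))%:E).
Proof.
move=> cf; apply: (le_integrable mD) (cintegrable_normc cf).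
  by apply/measurable_EFinP; case: cf => -[].
by move=> x _ /=; rewrite lee_fin (le_trans (cRe_le _))// ler_norm.
Qed.

Lemma cintegrable_Im f : cintegrable f -> mu.-integrable D (fun x => (cIm (f x))%:E).
Proof.
move=> cf; apply: (le_integrable mD) (cintegrable_normc cf).
  by apply/measurable_EFinP; case: cf => -[].
by move=> x _ /=; rewrite lee_fin (le_trans (cIm_le _))// ler_norm.
Qed.

Lemma cintegrableD f g : cintegrable f -> cintegrable g ->
  cintegrable (fun x => f x + g x).
Proof.
move=> cf cg.
apply: (@cintegrable_le _ (fun x => normc (f x) + normc (g x))).
- by apply: cmeasurableD; [case: cf|case: cg].
- exact: (integrableD mD (cintegrable_normc cf) (cintegrable_normc cg)).
- by move=> x _; exact: le_normcD.
Qed.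

Lemma cintegrableJ f : cintegrable f -> cintegrable (fun x => conjc (f x)).
Proof.
move=> cf; apply: cintegrable_le (cintegrable_normc cf) _.
  by apply: cmeasurableJ; case: cf.
by move=> x _; rewrite normc_conj.
Qed.

Lemma cintegrableMl f g (M : R) : cmeasurable D f ->
  (forall x, D x -> normc (f x) <= M) -> cintegrable g ->
  cintegrable (fun x => f x * g x).
Proof.
move=> mf fM cg; apply: (@cintegrable_le _ (fun x => M * normc (g x))).
- by apply: cmeasurableM => //; case: cg.
- exact: (integrableZl mD M (cintegrable_normc cg)).
- by move=> x Dx; rewrite normcM ler_wpM2r ?normc_ge0 ?fM.
Qed.

Lemma cintegrableZ z f : cintegrable f -> cintegrable (fun x => z * f x).
Proof.
by move=> cf; apply: (@cintegrableMl (fun=> z) _ (normc z)) => //; exact: cmeasurable_cst.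
Qed.

Lemma cintegrableB f g : cintegrable f -> cintegrable g ->
  cintegrable (fun x => f x - g x).
Proof.
move=> cf cg; under eq_fun do rewrite -[- g _]mulN1r.
by apply: cintegrableD => //; exact: cintegrableZ.
Qed.

Lemma cintegrableR (f : T -> R) : mu.-integrable D (EFin \o f) ->
  cintegrable (fun x => (f x)%:C).
Proof.
move=> cf; apply: (@cintegrable_le _ (fun x => `|f x|)).
- by apply: cmeasurableR; case/integrableP: cf => /measurable_EFinP.
- exact: integrable_norm.
- by move=> x _; rewrite normcR.
Qed.

Lemma eq_cintegral f g : {in D, f =1 g} -> cintegral mu D f = cintegral mu D g.
Proof.
by move=> fg; rewrite /cintegral; congr (_ +i* _); apply: eq_Rintegral => x Dx; rewrite fg.
Qed.

Lemma ae_eq_cintegral f g : cmeasurable D f -> cmeasurable D g ->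
  f = g %[ae mu in D] -> cintegral mu D f = cintegral mu D g.
Proof.
move=> [f1 f2] [g1 g2] fg; rewrite /cintegral /Rintegral; congr (fine _ +i* fine _).
  apply: ae_eq_integral => //; try exact/measurable_EFinP.
  by move: fg; apply: filterS => x + Dx => ->.
apply: ae_eq_integral => //; try exact/measurable_EFinP.
by move: fg; apply: filterS => x + Dx => ->.
Qed.

Lemma cintegralD f g : cintegrable f -> cintegrable g ->
  cintegral mu D (fun x => f x + g x) = cintegral mu D f + cintegral mu D g.
Proof.
move=> cf cg; rewrite /cintegral; apply: complex_eqP; rewrite ?cReD ?cImD/=.
  under eq_Rintegral do rewrite cReD.
  by rewrite RintegralD//; [exact: cintegrable_Re|exact: cintegrable_Re].
under eq_Rintegral do rewrite cImD.
by rewrite RintegralD//; [exact: cintegrable_Im|exact: cintegrable_Im].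
Qed.

Lemma cintegralZ z f : cintegrable f ->
  cintegral mu D (fun x => z * f x) = z * cintegral mu D f.
Proof.
move=> cf; have i1 := cintegrable_Re cf; have i2 := cintegrable_Im cf.
have iZ1 r : mu.-integrable D (EFin \o (fun x => r * cRe (f x))).
  exact: (integrableZl mD r i1).
have iZ2 r : mu.-integrable D (EFin \o (fun x => r * cIm (f x))).
  exact: (integrableZl mD r i2).
rewrite /cintegral; apply: complex_eqP; rewrite ?cReM ?cImM/=.
  under eq_Rintegral do rewrite cReM.
  by rewrite RintegralB// !RintegralZl.
under eq_Rintegral do rewrite cImM.
by rewrite RintegralD// !RintegralZl.
Qed.

Lemma cintegralB f g : cintegrable f -> cintegrable g ->
  cintegral mu D (fun x => f x - g x) = cintegral mu D f - cintegral mu D g.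
Proof.
move=> cf cg; rewrite -[- cintegral _ _ g]mulN1r -cintegralZ//.
rewrite -cintegralD//; last exact: cintegrableZ.
by apply: eq_cintegral => x _; rewrite mulN1r.
Qed.

Lemma cintegralJ f : cintegrable f ->
  cintegral mu D (fun x => conjc (f x)) = conjc (cintegral mu D f).
Proof.
move=> cf; rewrite /cintegral; apply: complex_eqP => /=.
  by apply: eq_Rintegral => x _; rewrite cReJ.
under eq_Rintegral do rewrite cImJ -mulN1r.
by rewrite RintegralZl ?mulN1r//; exact: cintegrable_Im.
Qed.

Lemma cintegralR (f : T -> R) : mu.-integrable D (EFin \o f) ->
  cintegral mu D (fun x => (f x)%:C) = (Rintegral mu D f)%:C.
Proof.
by move=> cf; rewrite /cintegral/= Rintegral_cst// mul0r.
Qed.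

(* Not sharp, but the constant is irrelevant for limits. *)
Lemma normc_cintegral_le f : cintegrable f ->
  normc (cintegral mu D f) <= 2 * Rintegral mu D (fun x => normc (f x)).
Proof.
move=> cf; apply: (le_trans (normc_le_ReIm _)).
rewrite mulr_natl mulr2n; apply: lerD.
  apply: (le_trans (le_normr_Rintegral mD _)); first exact: cintegrable_Re.
  apply: le_Rintegral => //.
  + by apply: integrable_norm; exact: cintegrable_Re.
  + exact: cintegrable_normc.
  + by move=> x _; exact: cRe_le.
apply: (le_trans (le_normr_Rintegral mD _)); first exact: cintegrable_Im.
apply: le_Rintegral => //.
- by apply: integrable_norm; exact: cintegrable_Im.
- exact: cintegrable_normc.
- by move=> x _; exact: cIm_le.
Qed.

Lemma EFin_normc_cintegral_le f : cintegrable f ->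
  ((normc (cintegral mu D f))%:E <= 2%:E * \int[mu]_(x in D) (normc (f x))%:E)%E.
Proof.
move=> cf; have := normc_cintegral_le cf.
rewrite -lee_fin => /le_trans; apply.
rewrite EFinM /Rintegral fineK// integrable_fin_num//.
exact: cintegrable_normc.
Qed.

End cintegral_theory.

Section L2_theory.
Context d (T : measurableType d) (R : realType).
Variables (mu : {measure set T -> \bar R}) (D : set T).
Hypothesis mD : measurable D.
Implicit Types (f g h : T -> R[i]).

(** The square of [l2norm], kept in the extended reals: as the integral of a nonnegative function it
    is accessible to Tonelli and monotone convergence before it is known to be finite. *)
Definition sqnorm f : \bar R := (\int[mu]_(x in D) (normc (f x) ^+ 2)%:E)%E.

Lemma sqnorm_ge0 f : (0 <= sqnorm f)%E.
Proof. by apply: integral_ge0 => x _; rewrite lee_fin sqr_ge0. Qed.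

Lemma l2normE f : l2norm mu D f = sqrte (sqnorm f). Proof. by []. Qed.

Lemma l2norm_sqr f : (l2norm mu D f ^+ 2 = sqnorm f)%E.
Proof. by rewrite l2normE sqr_sqrte// sqnorm_ge0. Qed.

Lemma L2P f : L2 mu D f <-> cmeasurable D f /\ (sqnorm f < +oo)%E.
Proof.
suff e : (l2norm mu D f < +oo)%E = (sqnorm f < +oo)%E by rewrite /L2/= e.
rewrite l2normE -ge0_fin_numE ?sqrte_ge0// sqrte_fin_num ?sqnorm_ge0//.
by rewrite ge0_fin_numE ?sqnorm_ge0.
Qed.

Lemma L2_cmeasurable f : L2 mu D f -> cmeasurable D f.
Proof. by case. Qed.

Lemma L2_sqnorm_lty f : L2 mu D f -> (sqnorm f < +oo)%E.
Proof. by move/L2P => []. Qed.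

Lemma sqnorm_fin f : L2 mu D f -> sqnorm f \is a fin_num.
Proof. by move=> /L2_sqnorm_lty foo; rewrite ge0_fin_numE// sqnorm_ge0. Qed.

Lemma emeasurable_normc_sqr f : cmeasurable D f ->
  measurable_fun D (fun x => (normc (f x) ^+ 2)%:E).
Proof. by move=> mf; apply/measurable_EFinP; exact: measurable_normc_sqr. Qed.

Lemma L2_integrable f : L2 mu D f ->
  mu.-integrable D (fun x => (normc (f x) ^+ 2)%:E).
Proof.
move=> /L2P[mf foo]; apply/integrableP; split; first exact: emeasurable_normc_sqr.
by under eq_integral do rewrite gee0_abs ?lee_fin ?sqr_ge0//.
Qed.

Lemma L2_le f (h : T -> R) : cmeasurable D f ->
  mu.-integrable D (EFin \o h) -> (forall x, D x -> normc (f x) ^+ 2 <= h x) ->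
  L2 mu D f.
Proof.
move=> mf ih fh; apply/L2P; split => //.
case/integrableP: (ih) => mh; apply: le_lt_trans.
apply: ge0_le_integral => //.
- by move=> x _; rewrite lee_fin sqr_ge0.
- exact: emeasurable_normc_sqr.
- exact: measurableT_comp.
- by move=> x Dx /=; rewrite lee_fin (le_trans (fh _ Dx))// ler_norm.
Qed.

Lemma L2D f g : L2 mu D f -> L2 mu D g -> L2 mu D (fun x => f x + g x).
Proof.
move=> Lf Lg.
apply: (@L2_le _ (fun x => 2 * normc (f x) ^+ 2 + 2 * normc (g x) ^+ 2)).
- by apply: cmeasurableD; exact: L2_cmeasurable.
- exact: (integrableD mD (integrableZl mD 2 (L2_integrable Lf))
    (integrableZl mD 2 (L2_integrable Lg))).
- by move=> x _; exact: normc_sqrD_le.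
Qed.

Lemma L2Ml f g (M : R) : cmeasurable D f ->
  (forall x, D x -> normc (f x) <= M) -> L2 mu D g ->
  L2 mu D (fun x => f x * g x).
Proof.
move=> mf fM Lg; apply: (@L2_le _ (fun x => M ^+ 2 * normc (g x) ^+ 2)).
- by apply: cmeasurableM => //; exact: L2_cmeasurable.
- exact: (integrableZl mD (M ^+ 2) (L2_integrable Lg)).
- move=> x Dx; rewrite normcM exprMn ler_wpM2r ?sqr_ge0//.
  by rewrite lerXn2r ?nnegrE ?normc_ge0 ?fM// (le_trans (normc_ge0 (f x)))// fM.
Qed.

Lemma L2Z z f : L2 mu D f -> L2 mu D (fun x => z * f x).
Proof.
by move=> Lf; apply: (@L2Ml (fun=> z) _ (normc z)) => //; exact: cmeasurable_cst.
Qed.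

Lemma L2B f g : L2 mu D f -> L2 mu D g -> L2 mu D (fun x => f x - g x).
Proof.
move=> Lf Lg; under eq_fun do rewrite -[- g _]mulN1r.
by apply: L2D => //; exact: L2Z.
Qed.

Lemma sqnormJ f : sqnorm (fun x => conjc (f x)) = sqnorm f.
Proof. by apply: eq_integral => x _; rewrite normc_conj. Qed.

Lemma L2J f : L2 mu D f -> L2 mu D (fun x => conjc (f x)).
Proof.
move=> /L2P[mf foo]; apply/L2P; rewrite sqnormJ; split => //.
exact: cmeasurableJ.
Qed.

Lemma L2_0 : L2 mu D (fun=> 0).
Proof.
apply: (@L2_le _ (fun=> 0)).
- exact: (cmeasurable_cst D (0 : R[i])).
- exact: integrable0.
- by move=> x _; rewrite normc0 expr0n.
Qed.

Lemma ae_eq_sqnorm f g : cmeasurable D f -> cmeasurable D g ->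
  f = g %[ae mu in D] -> sqnorm f = sqnorm g.
Proof.
move=> mf mg fg; apply: ge0_ae_eq_integral => //.
- exact: emeasurable_normc_sqr.
- exact: emeasurable_normc_sqr.
- by move=> x _; rewrite lee_fin sqr_ge0.
- by move=> x _; rewrite lee_fin sqr_ge0.
- by move: fg; apply: filterS => x + Dx => ->.
Qed.

Lemma ae_eq_L2 f g : cmeasurable D g -> f = g %[ae mu in D] ->
  L2 mu D f -> L2 mu D g.
Proof.
move=> mg fg /L2P[mf foo]; apply/L2P; split => //.
by rewrite -(ae_eq_sqnorm mf mg fg).
Qed.

Lemma sqnorm_eq0 f : cmeasurable D f -> sqnorm f = 0%E -> f = (fun=> 0) %[ae mu in D].
Proof.
move=> mf f0.
have /ae_eq_integral_abs : measurable_fun D (fun x => (normc (f x) ^+ 2)%:E).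
  exact: emeasurable_normc_sqr.
move=> /(_ mu mD)[h _]; apply: filterS (h _) => [x /[apply] /= -[] /eqP|].
  by rewrite sqrf_eq0 normc_eq0 => /eqP.
by under eq_integral do rewrite gee0_abs ?lee_fin ?sqr_ge0//.
Qed.

Lemma sqnormD_le f g : cmeasurable D f -> cmeasurable D g ->
  (sqnorm (fun x => f x + g x)%R <= 2%:E * sqnorm f + 2%:E * sqnorm g)%E.
Proof.
move=> mf mg; have mf2 := emeasurable_normc_sqr mf.
have mg2 := emeasurable_normc_sqr mg.
rewrite /sqnorm -!ge0_integralZl_EFin//; try by move=> x _; rewrite lee_fin sqr_ge0.
rewrite -ge0_integralD//; try by move=> x _; rewrite -?EFinM lee_fin mulr_ge0 ?sqr_ge0.
- apply: ge0_le_integral => //.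
  + by move=> x _; rewrite lee_fin sqr_ge0.
  + by apply: emeasurable_normc_sqr; exact: cmeasurableD.
  + by apply: emeasurable_funD; apply: measurable_funeM.
  + by move=> x _; rewrite -!EFinM -EFinD lee_fin normc_sqrD_le.
- by apply: measurable_funeM.
- by apply: measurable_funeM.
Qed.

Lemma sqnormMl_le f g (M : R) : cmeasurable D f -> cmeasurable D g ->
  (forall x, D x -> normc (f x) <= M) ->
  (sqnorm (fun x => f x * g x)%R <= (M ^+ 2)%:E * sqnorm g)%E.
Proof.
move=> mf mg fM; have mg2 := emeasurable_normc_sqr mg.
rewrite /sqnorm -ge0_integralZl_EFin ?sqr_ge0//; last first.
  by move=> x _; rewrite lee_fin sqr_ge0.
apply: ge0_le_integral => //.
- by move=> x _; rewrite lee_fin sqr_ge0.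
- by apply: emeasurable_normc_sqr; exact: cmeasurableM.
- exact: measurable_funeM.
- move=> x Dx; rewrite -EFinM lee_fin normcM exprMn ler_wpM2r ?sqr_ge0//.
  by rewrite lerXn2r ?nnegrE ?normc_ge0 ?fM// (le_trans (normc_ge0 (f x)))// fM.
Qed.

Lemma sqnormB f g : sqnorm (fun x => f x - g x) = sqnorm (fun x => g x - f x).
Proof. by apply: eq_integral => x _; rewrite normcB. Qed.

Lemma L2M_cintegrable f g : L2 mu D f -> L2 mu D g ->
  cintegrable mu D (fun x => f x * g x).
Proof.
move=> Lf Lg.
apply: (@cintegrable_le _ _ _ _ _ mD _ (fun x => normc (f x) ^+ 2 + normc (g x) ^+ 2)).
- by apply: cmeasurableM; exact: L2_cmeasurable.
- exact: (integrableD mD (L2_integrable Lf) (L2_integrable Lg)).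
- move=> x _; rewrite normcM; have := normc_ge0 (f x); have := normc_ge0 (g x).
  by move: (normc _) (normc _) => a b; have := sqr_ge0 (a - b); nra.
Qed.

Lemma inner_cintegrable f g : L2 mu D f -> L2 mu D g ->
  cintegrable mu D (fun x => f x * conjc (g x)).
Proof. by move=> Lf Lg; apply: L2M_cintegrable => //; exact: L2J. Qed.

Lemma innerff f : L2 mu D f -> inner mu D f f = (fine (sqnorm f))%:C.
Proof.
move=> Lf; rewrite /inner -cintegralR//; last exact: L2_integrable.
by apply: eq_cintegral => x _; rewrite mulcJ.
Qed.

End L2_theory.

(** Optimising in t would give t = sqrt B / sqrt A, which fails when A or B vanishes; both roots are
    therefore shifted by a small n, at a cost that tends to 0. *)
Lemma le_sqrtM_amgm (R : realType) (A B I : R) : 0 <= A -> 0 <= B ->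
  (forall t, 0 < t -> 2 * I <= t * A + t^-1 * B) ->
  I <= Num.sqrt A * Num.sqrt B.
Proof.
move=> A0 B0 h; set a := Num.sqrt A; set b := Num.sqrt B.
have a0 : 0 <= a by exact: sqrtr_ge0.
have b0 : 0 <= b by exact: sqrtr_ge0.
have Aa : A = a ^+ 2 by rewrite sqr_sqrtr.
have Bb : B = b ^+ 2 by rewrite sqr_sqrtr.
apply/ler_addgt0Pr => e e0.
(* [n] is at most 1 and n (a + b + 1) <= e, so (a + n)(b + n) exceeds a b by at most e. *)
pose n := Num.min 1 (e / (a + b + 1)).
have n0 : 0 < n by rewrite lt_min ltr01 divr_gt0// ltr_wpDl// addr_ge0.
have n1 : n <= 1 by rewrite ge_min lexx.
have ne : n * (a + b + 1) <= e.
  by rewrite -ler_pdivlMr ?ltr_wpDl ?addr_ge0// ge_min lexx orbT.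
have an : 0 < a + n by rewrite ltr_wpDl.
have bn : 0 < b + n by rewrite ltr_wpDl.
have := h ((b + n) / (a + n)); rewrite divr_gt0// => /(_ isT).
rewrite Aa Bb invfM invrK => h1.
have h2 : (b + n) / (a + n) * a ^+ 2 <= (b + n) * (a + n).
  rewrite -mulrA ler_pM2l// mulrC ler_pdivrMr// -expr2.
  by rewrite lerXn2r ?nnegrE// ?(ltW an)// lerDl ltW.
have h3 : (b + n)^-1 * (a + n) * b ^+ 2 <= (a + n) * (b + n).
  rewrite mulrAC mulrC ler_pM2l// mulrC ler_pdivrMr// -expr2.
  by rewrite lerXn2r ?nnegrE// ?(ltW bn)// lerDl ltW.
nra.
Qed.

Section cauchy_schwarz.
Context d (T : measurableType d) (R : realType).
Variables (mu : {measure set T -> \bar R}) (D : set T).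
Hypothesis mD : measurable D.
Implicit Types (f g h : T -> R[i]).

Definition nrm f : R := Num.sqrt (fine (sqnorm mu D f)).

(** Cauchy-Schwarz by integrating 2 |f g| <= t |f|^2 + |g|^2 / t and optimising over t. The factor 2
    is that of [normc_cintegral_le]; it is harmless, since the bound serves limits and
    domination. *)
Lemma normc_inner_le f g : L2 mu D f -> L2 mu D g ->
  normc (inner mu D f g) <= 2 * (nrm f * nrm g).
Proof.
move=> Lf Lg; apply: (le_trans (normc_cintegral_le mD (inner_cintegrable mD Lf Lg))).
rewrite ler_pM2l//; apply: le_sqrtM_amgm; try exact: fine_ge0 (sqnorm_ge0 _ _ _).
move=> t t0.
have if2 := L2_integrable Lf; have ig2 := L2_integrable Lg.
have ifg := cintegrable_normc (inner_cintegrable mD Lf Lg).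
rewrite -[fine (sqnorm mu D f)]/(Rintegral mu D (fun x => normc (f x) ^+ 2)).
rewrite -[fine (sqnorm mu D g)]/(Rintegral mu D (fun x => normc (g x) ^+ 2)).
have itf : mu.-integrable D (EFin \o (fun x => t * normc (f x) ^+ 2)).
  exact: (integrableZl mD t if2).
have itg : mu.-integrable D (EFin \o (fun x => t^-1 * normc (g x) ^+ 2)).
  exact: (integrableZl mD t^-1 ig2).
rewrite -!RintegralZl// -RintegralD//; apply: le_Rintegral => //.
- exact: (integrableZl mD 2 ifg).
- exact: (integrableD mD itf itg).
move=> x _; rewrite normcM normc_conj.
move: (normc (f x)) (normc (g x)) => a b; rewrite -subr_ge0.
rewrite (_ : _ - _ = t^-1 * (t * a - b) ^+ 2); last by field; rewrite gt_eqF.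
by rewrite mulr_ge0 ?sqr_ge0// invr_ge0 ltW.
Qed.

End cauchy_schwarz.

(** * Limits in L_2 *)

Section ccvg.
Context (R : realType).
Implicit Types (z w : nat -> R[i]).

(** Convergence in R[i] expressed by a real sequence of moduli, which keeps the limit arguments in
    R. *)
Definition ccvg z (a : R[i]) := (fun n => normc (z n - a)) @ \oo --> (0 : R).

Lemma ccvg_unique z a b : ccvg z a -> ccvg z b -> a = b.
Proof.
move=> za zb; apply/eqP; rewrite -subr_eq0 -normc_eq0 -(negbK (_ == 0)); apply/negP => ab.
have ab0 : 0 < normc (a - b) by rewrite lt_neqAle eq_sym ab normc_ge0.
have c : (fun n => normc (z n - a) + normc (z n - b)) @ \oo --> (0 : R).
  by rewrite -[0]addr0; exact: cvgD.
have [N _ /(_ N (leqnn _))] := (cvgrPdist_lt _ _).1 c _ ab0.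
rewrite sub0r normrN /= ger0_norm ?addr_ge0 ?normc_ge0// ltNge => /negP; apply.
rewrite (_ : a - b = (a - z N) + (z N - b)); last by rewrite addrA subrK.
by rewrite (le_trans (le_normcD _ _))// normcB.
Qed.

Lemma ccvg_le z a (u : nat -> R) : (forall n, normc (z n - a) <= u n) ->
  u @ \oo --> (0 : R) -> ccvg z a.
Proof.
move=> zu u0; apply: (@squeeze_cvgr _ _ _ _ (fun=> 0) u) => //; last exact: cvg_cst.
by apply: nearW => n; rewrite normc_ge0 zu.
Qed.

End ccvg.

Section L2_limits.
Context d (T : measurableType d) (R : realType).
Variables (mu : {measure set T -> \bar R}) (D : set T).
Hypothesis mD : measurable D.
Implicit Types (f g h : T -> R[i]) (fs gs : nat -> T -> R[i]).

Definition L2cvg fs f :=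
  (fun n => sqnorm mu D (fun x => fs n x - f x)) @ \oo --> 0%E.

Lemma cvg_nrm fs f : L2cvg fs f ->
  (fun n => nrm mu D (fun x => fs n x - f x)) @ \oo --> (0 : R).
Proof.
move=> /fine_cvg h; rewrite -[0]sqrtr0.
by apply: continuous_cvg => //; exact: sqrt_continuous.
Qed.

Lemma L2cvg_L2 fs f : cmeasurable D f -> (forall n, L2 mu D (fs n)) ->
  L2cvg fs f -> L2 mu D f.
Proof.
move=> mf Lf cf; have /fcvg_is_fine[N _ /(_ N (leqnn _)) /= h] := cf.
rewrite (_ : f = (fun x => fs N x - (fs N x - f x))); last first.
  by apply/funext => x; rewrite subKr.
apply: (L2B mD) => //; apply/(L2P _ _).
split; first by apply: cmeasurableB => //; exact: L2_cmeasurable (Lf N).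
by rewrite -ge0_fin_numE ?sqnorm_ge0.
Qed.

(** Expanding <f_n, g_n> - <f, g> around the limits leaves three terms, each with a factor that
    tends to 0. *)
Lemma inner_cvg fs gs f g : (forall n, L2 mu D (fs n)) -> (forall n, L2 mu D (gs n)) ->
  L2 mu D f -> L2 mu D g -> L2cvg fs f -> L2cvg gs g ->
  ccvg (fun n => inner mu D (fs n) (gs n)) (inner mu D f g).
Proof.
move=> Lf_ Lg_ Lf Lg cf cg.
set a := fun n => nrm mu D (fun x => fs n x - f x).
set b := fun n => nrm mu D (fun x => gs n x - g x).
have a0 : a @ \oo --> (0 : R) := cvg_nrm cf.
have b0 : b @ \oo --> (0 : R) := cvg_nrm cg.
pose u n := 2 * (a n * b n) + 2 * (a n * nrm mu D g) + 2 * (nrm mu D f * b n).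
apply: (@ccvg_le _ _ _ u); last first.
  rewrite (_ : 0 = 2 * (0 * 0) + 2 * (0 * nrm mu D g) + 2 * (nrm mu D f * 0)); last by ring.
  apply: cvgD; first apply: cvgD.
  - by apply: cvgM; [exact: cvg_cst|exact: cvgM].
  - by apply: cvgM; [exact: cvg_cst|apply: cvgM => //; exact: cvg_cst].
  - by apply: cvgM; [exact: cvg_cst|apply: cvgM => //; exact: cvg_cst].
move=> n.
have LF := L2B mD (Lf_ n) Lf; have LG := L2B mD (Lg_ n) Lg.
have e : inner mu D (fs n) (gs n) - inner mu D f g =
    inner mu D (fun x => fs n x - f x) (fun x => gs n x - g x) +
    inner mu D (fun x => fs n x - f x) g + inner mu D f (fun x => gs n x - g x).
  rewrite /inner -cintegralB//; [|exact: inner_cintegrable..].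
  rewrite -!cintegralD//;
    do ?by [exact: inner_cintegrable|apply: cintegrableD => //; exact: inner_cintegrable].
  by apply: eq_cintegral => x _; rewrite !rmorphB/=; ring.
rewrite e; apply: (le_trans (le_normcD _ _)); apply: lerD; last exact: normc_inner_le.
apply: (le_trans (le_normcD _ _)); apply: lerD; exact: normc_inner_le.
Qed.

Lemma L2cvg_conj fs f : L2cvg fs f ->
  L2cvg (fun n x => conjc (fs n x)) (fun x => conjc (f x)).
Proof.
rewrite /L2cvg; under [in X in _ -> X]eq_fun do
  (under [X in sqnorm _ _ X]eq_fun do rewrite -rmorphB/=; rewrite sqnormJ).
by [].
Qed.

Lemma L2cvg_cst f : L2cvg (fun=> f) f.
Proof.
rewrite /L2cvg (_ : (fun _ => _) = cst 0%E); first exact: cvg_cst.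
apply/funext => n; rewrite /sqnorm; under eq_integral do rewrite subrr normc0 expr0n/=.
exact: integral0.
Qed.

Lemma L2cvg_unique fs f g : (forall n, cmeasurable D (fs n)) -> cmeasurable D f ->
  cmeasurable D g -> L2cvg fs f -> L2cvg fs g -> f = g %[ae mu in D].
Proof.
move=> mf_ mf mg cf cg.
have mfg : cmeasurable D (fun x => f x - g x) by exact: cmeasurableB.
suff e : sqnorm mu D (fun x => f x - g x) = 0%E.
  have := sqnorm_eq0 mD mfg e; apply: filterS => x /[apply] /eqP.
  by rewrite subr_eq0 => /eqP.
apply/eqP; rewrite eq_le sqnorm_ge0 andbT.
have c0 : (fun n => 2%:E * sqnorm mu D (fun x => fs n x - f x)%R +
    2%:E * sqnorm mu D (fun x => fs n x - g x)%R)%E @ \oo --> 0%E.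
  rewrite -[in X in _ --> X](adde0 0%E) -[in X in _ --> (X + _)%E](mule0 2%:E).
  rewrite -[in X in _ --> (_ + X)%E](mule0 2%:E).
  apply: cvgeD; first by rewrite mule0.
    exact: cvgeZl.
  exact: cvgeZl.
rewrite -(cvg_lim _ c0)//; apply: lime_ge; first by apply/cvg_ex; exists 0%E.
apply: nearW => n; rewrite sqnormB.
have := sqnormD_le mu mD (cmeasurableB mg (mf_ n)) (cmeasurableB (mf_ n) mf).
rewrite [in leRHS]addeC [X in (_ <= _ + 2%:E * X)%E -> _]sqnormB.
apply: le_trans; rewrite le_eqVlt; apply/orP; left; apply/eqP; congr sqnorm.
by apply/funext => x; rewrite addrA subrK.
Qed.

End L2_limits.

Section complex_dominated_convergence.
Context d (T : measurableType d) (R : realType).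
Variables (mu : {measure set T -> \bar R}) (D : set T).
Hypothesis mD : measurable D.

Lemma cintegral_dominated_cvg (fs : nat -> T -> R[i]) (f : T -> R[i]) (g : T -> R) :
  (forall n, cmeasurable D (fs n)) -> cmeasurable D f ->
  mu.-integrable D (EFin \o g) ->
  (forall n x, D x -> normc (fs n x) <= g x) -> (forall x, D x -> normc (f x) <= g x) ->
  (forall x, D x -> ccvg (fs ^~ x) (f x)) ->
  ccvg (fun n => cintegral mu D (fs n)) (cintegral mu D f).
Proof.
move=> mfs mf ig fg f0g fsf.
have cfs n : cintegrable mu D (fs n) by exact: (cintegrable_le mD (mfs n) ig (fg n)).
have cf : cintegrable mu D f by exact: (cintegrable_le mD mf ig f0g).
pose u n := 2 * Rintegral mu D (fun x => normc (fs n x - f x)).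
apply: (@ccvg_le _ _ _ u).
  move=> n; rewrite -cintegralB//; apply: (normc_cintegral_le mD).
  exact: cintegrableB.
rewrite -[X in _ --> X](mulr0 2); apply: cvgM; first exact: cvg_cst.
have ig2 : mu.-integrable D (EFin \o (fun x => 2 * g x)) by exact: (integrableZl mD 2 ig).
have [] := @dominated_convergence _ T R mu D mD (fun n x => (normc (fs n x - f x))%:E)
  (cst 0%E) (EFin \o (fun x => 2 * g x)).
- by move=> n; apply/measurable_EFinP; apply: measurable_normc; exact: cmeasurableB.
- exact: measurable_cst.
- apply: aeW => x Dx; apply: cvg_EFin; first exact: nearW.
  exact: fsf.
- exact: ig2.
- apply: aeW => x n Dx; rewrite /= lee_fin ger0_norm ?normc_ge0//.
  by rewrite (le_trans (le_normcD _ _))// normcN mulr_natl mulr2n lerD ?fg ?f0g.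
by move=> _ _; rewrite integral0 => /fine_cvg.
Qed.

End complex_dominated_convergence.

(** * Integration on a strip *)

Section rectangle_fubini.
Context d1 d2 (T1 : measurableType d1) (T2 : measurableType d2) (R : realType).
Variable m1 : {sigma_finite_measure set T1 -> \bar R}.
Variable m2 : {sigma_finite_measure set T2 -> \bar R}.
Variable D1 : set T1.
Hypothesis mD1 : measurable D1.
Local Notation E := (D1 `*` [set: T2]).

Lemma measurable_setXT : measurable E.
Proof. exact: measurableX. Qed.
Let mE := measurable_setXT.

Let patchXT U (z : U) (f : T1 * T2 -> U) x y :
  patch (fun=> z) E f (x, y) = if x \in D1 then f (x, y) else z.
Proof.
rewrite /patch (_ : ((x, y) \in E) = (x \in D1))//.
by apply/idP/idP; rewrite !inE; [case|split].
Qed.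

(** Extension by 0 off the strip reduces to Tonelli on the whole product; membership in the strip
    depends on the first variable only, so the inner integral is untouched. *)
Lemma rect_tonelli1 (f : T1 * T2 -> \bar R) : measurable_fun E f ->
  (forall z, E z -> 0 <= f z)%E ->
  (\int[m1 \x m2]_(z in E) f z = \int[m1]_(x in D1) \int[m2]_y f (x, y))%E.
Proof.
move=> mf f0; rewrite integral_mkcond fubini_tonelli1; last 2 first.
- exact: (measurable_restrictT f mE).1.
- by move=> z; apply: erestrict_ge0.
rewrite [RHS]integral_mkcond; apply: eq_integral => x _.
rewrite /fubini_F; under eq_integral do rewrite patchXT.
by rewrite patchE; case: ifPn => // _; rewrite integral0.
Qed.

Lemma rect_tonelli2 (f : T1 * T2 -> \bar R) : measurable_fun E f ->
  (forall z, E z -> 0 <= f z)%E ->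
  (\int[m1 \x m2]_(z in E) f z = \int[m2]_y \int[m1]_(x in D1) f (x, y))%E.
Proof.
move=> mf f0; rewrite integral_mkcond fubini_tonelli2; last 2 first.
- exact: (measurable_restrictT f mE).1.
- by move=> z; apply: erestrict_ge0.
apply: eq_integral => y _; rewrite [RHS]integral_mkcond; apply: eq_integral => x _.
by rewrite patchXT patchE.
Qed.

Lemma measurable_rect_tonelli1 (f : T1 * T2 -> \bar R) : measurable_fun E f ->
  (forall z, E z -> 0 <= f z)%E ->
  measurable_fun D1 (fun x => \int[m2]_y f (x, y))%E.
Proof.
move=> mf f0; have f1 z : (0 <= (f \_ E) z)%E by apply: erestrict_ge0.
have : measurable_fun setT (fubini_F m2 (f \_ E)).
  by apply: measurable_fun_fubini_tonelli_F => //; exact: (measurable_restrictT f mE).1.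
move=> /(measurable_funTS (D := D1)); apply: eq_measurable_fun => x xD.
by apply: eq_integral => y _; rewrite patchXT xD.
Qed.

Lemma measurable_rect_tonelli2 (f : T1 * T2 -> \bar R) : measurable_fun E f ->
  (forall z, E z -> 0 <= f z)%E ->
  measurable_fun setT (fun y => \int[m1]_(x in D1) f (x, y))%E.
Proof.
move=> mf f0; have f1 z : (0 <= (f \_ E) z)%E by apply: erestrict_ge0.
have : measurable_fun setT (fubini_G m1 (f \_ E)).
  by apply: measurable_fun_fubini_tonelli_G => //; exact: (measurable_restrictT f mE).1.
apply: eq_measurable_fun => y _.
rewrite [RHS]integral_mkcond; apply: eq_integral => x _.
by rewrite patchXT patchE.
Qed.

Lemma measurable_section2 d (U : measurableType d) (f : T1 * T2 -> U) y :
  measurable_fun E f -> measurable_fun D1 (fun x => f (x, y)).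
Proof.
move=> mf; apply: (@measurable_comp _ _ _ _ _ _ E f _ (pair^~ y)) => //.
  by move=> _ [x Dx <-].
exact: measurable_funTS.
Qed.

(** Positive and negative parts are treated separately by Tonelli, so no integrability is involved:
    where the inner integral is not finite, [fine] returns 0. *)
Lemma measurable_Rintegral1 (f : T1 * T2 -> R) : measurable_fun E f ->
  measurable_fun D1 (fun x => Rintegral m2 setT (fun y => f (x, y))).
Proof.
move=> mf; apply: (measurableT_comp (fine_measurable measurableT)) => //.
under eq_fun do rewrite integralE.
have mf' : measurable_fun E (EFin \o f) by exact/measurable_EFinP.
apply: emeasurable_funB.
  have h := measurable_rect_tonelli1 (measurable_funepos mf').
  by apply: eq_measurable_fun (h _) => [x _|z _];
    [apply: eq_integral => y _; rewrite !funeposE|exact: funepos_ge0].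
have h := measurable_rect_tonelli1 (measurable_funeneg mf').
by apply: eq_measurable_fun (h _) => [x _|z _];
    [apply: eq_integral => y _; rewrite !funenegE|exact: funeneg_ge0].
Qed.

Lemma measurable_Rintegral2 (f : T1 * T2 -> R) : measurable_fun E f ->
  measurable_fun setT (fun y => Rintegral m1 D1 (fun x => f (x, y))).
Proof.
move=> mf; apply: (measurableT_comp (fine_measurable measurableT)) => //.
under eq_fun do rewrite integralE.
have mf' : measurable_fun E (EFin \o f) by exact/measurable_EFinP.
apply: emeasurable_funB.
  have h := measurable_rect_tonelli2 (measurable_funepos mf').
  by apply: eq_measurable_fun (h _) => [x _|z _];
    [apply: eq_integral => y _; rewrite !funeposE|exact: funepos_ge0].
have h := measurable_rect_tonelli2 (measurable_funeneg mf').
by apply: eq_measurable_fun (h _) => [x _|z _];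
    [apply: eq_integral => y _; rewrite !funenegE|exact: funeneg_ge0].
Qed.

(** The inner integrals are finite only for almost every x; elsewhere [fine] gives the default value
    0, which affects the outer integrand on a null set. *)
Lemma Rintegral_rect1 (f : T1 * T2 -> R) : (m1 \x m2)%E.-integrable E (EFin \o f) ->
  Rintegral (m1 \x m2)%E E f =
  Rintegral m1 D1 (fun x => Rintegral m2 setT (fun y => f (x, y))).
Proof.
move=> intf; have mf : measurable_fun E f by case/integrableP: intf => /measurable_EFinP.
have intg := (integrable_mkcond _ mE).1 intf.
set g := (EFin \o f) \_ E in intg.
have gE x y : g (x, y) = if x \in D1 then (f (x, y))%:E else 0%E by rewrite /g patchXT.
rewrite /Rintegral; congr fine; rewrite integral_mkcond -integral12_prod_meas1//.
rewrite [RHS]integral_mkcond.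
have iF := integrable_fubini_F intg.
apply: ae_eq_integral => //.
- exact: measurable_int iF.
- apply: (measurable_restrictT _ mD1).1.
  exact: ((measurable_EFinP _ _).2 (measurable_Rintegral1 mf)).
- have := integrable_ae measurableT iF; apply: filterS => x /(_ I) + _.
  rewrite /fubini_F; under eq_integral do rewrite gE; rewrite patchE.
  by case: ifPn => _ h; [rewrite fineK|rewrite integral0].
Qed.

Lemma Rintegral_rect2 (f : T1 * T2 -> R) : (m1 \x m2)%E.-integrable E (EFin \o f) ->
  Rintegral (m1 \x m2)%E E f =
  Rintegral m2 setT (fun y => Rintegral m1 D1 (fun x => f (x, y))).
Proof.
move=> intf; have mf : measurable_fun E f by case/integrableP: intf => /measurable_EFinP.
have intg := (integrable_mkcond _ mE).1 intf.
set g := (EFin \o f) \_ E in intg.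
have gE y : (\int[m1]_x g (x, y) = \int[m1]_(x in D1) (f (x, y))%:E)%E.
  rewrite [RHS]integral_mkcond; apply: eq_integral => x _.
  by rewrite /g patchXT patchE.
rewrite /Rintegral; congr fine; rewrite integral_mkcond -integral21_prod_meas1//.
apply: ae_eq_integral => //.
- exact: (measurable_fubini_G intg).
- exact: ((measurable_EFinP _ _).2 (measurable_Rintegral2 mf)).
- have := ae_integrable2 intg; apply: filterS => y iy _.
  have := integrable_fin_num measurableT iy.
  by rewrite /fubini_G gE => h; rewrite fineK.
Qed.

Implicit Types f : T1 * T2 -> R[i].

Lemma cmeasurable_section2 f y : cmeasurable E f ->
  cmeasurable D1 (fun x => f (x, y)).
Proof.
by move=> [f1 f2]; split; [exact: (measurable_section2 y f1)|exact: (measurable_section2 y f2)].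
Qed.

Lemma cmeasurable_cintegral1 f : cmeasurable E f ->
  cmeasurable D1 (fun x => cintegral m2 setT (fun y => f (x, y))).
Proof.
by move=> [f1 f2]; split; [exact: (measurable_Rintegral1 f1)|exact: (measurable_Rintegral1 f2)].
Qed.

Lemma cmeasurable_cintegral2 f : cmeasurable E f ->
  cmeasurable setT (fun y => cintegral m1 D1 (fun x => f (x, y))).
Proof.
by move=> [f1 f2]; split; [exact: (measurable_Rintegral2 f1)|exact: (measurable_Rintegral2 f2)].
Qed.

Lemma cintegral_rect1 f : cintegrable (m1 \x m2)%E E f ->
  cintegral (m1 \x m2)%E E f =
  cintegral m1 D1 (fun x => cintegral m2 setT (fun y => f (x, y))).
Proof.
move=> cf; have h1 := cintegrable_Re mE cf; have h2 := cintegrable_Im mE cf.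
apply: complex_eqP => /=.
  exact: (@Rintegral_rect1 (fun z => cRe (f z))).
exact: (@Rintegral_rect1 (fun z => cIm (f z))).
Qed.

Lemma cintegral_rect2 f : cintegrable (m1 \x m2)%E E f ->
  cintegral (m1 \x m2)%E E f =
  cintegral m2 setT (fun y => cintegral m1 D1 (fun x => f (x, y))).
Proof.
move=> cf; have h1 := cintegrable_Re mE cf; have h2 := cintegrable_Im mE cf.
apply: complex_eqP => /=.
  exact: (@Rintegral_rect2 (fun z => cRe (f z))).
exact: (@Rintegral_rect2 (fun z => cIm (f z))).
Qed.

Lemma cfubini f : cintegrable (m1 \x m2)%E E f ->
  cintegral m1 D1 (fun x => cintegral m2 setT (fun y => f (x, y))) =
  cintegral m2 setT (fun y => cintegral m1 D1 (fun x => f (x, y))).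
Proof. by move=> cf; rewrite -cintegral_rect1// cintegral_rect2. Qed.

End rectangle_fubini.

(** * Affine changes of variable on the line *)

Section affine_change.
Context (R : realType).
Local Notation leb := (@lebesgue_measure R).
Local Notation mR := (measurableTypeR R).
Implicit Types a b : R.

Lemma measurable_affine a b (D : set mR) :
  measurable_fun D ((fun x => a * x + b) : mR -> mR).
Proof.
apply: measurable_funD; last exact: measurable_cst.
by apply: measurable_funM; [exact: measurable_cst|exact: measurable_id].
Qed.

(** The image of Lebesgue measure under x |-> a x + b, multiplied by |a|, has the right values on
    the intervals ]x, y], hence is Lebesgue measure; the formula is then integration against an
    image measure. *)
Lemma ge0_integral_affine a b (f : R -> \bar R) : a != 0 ->
  measurable_fun setT f -> (forall x, 0 <= f x)%E ->
  (\int[leb]_x f (a * x + b)%R = (`|a|^-1)%:E * \int[leb]_x f x)%E.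
Proof.
move=> a0 mf f0.
pose phi := (fun x : measurableTypeR R => a * x + b) : measurableTypeR R -> measurableTypeR R.
have mphi : measurable_fun setT phi by exact: measurable_affine.
have an0 : 0 <= `|a| by [].
pose nu := mscale (NngNum an0)
  (measure_function_pushforward__canonical__measure_function_Measure leb mphi).
have nuE A : measurable A -> leb A = nu A.
  apply: lebesgue_measure_unique => _ [[x y]] _ <-.
  rewrite -[RHS]/(`|a|%:E * leb (phi @^-1` `]x, y]))%E.
  have [xy|yx] := ltP x y; last first.
    rewrite set_itv_ge ?measure0 ?preimage_set0 ?measure0 ?mule0//.
    by rewrite bnd_simp -leNgt.
  have [ap|an] := ltP 0 a.
    rewrite (_ : phi @^-1` _ = `](x - b) / a, (y - b) / a]%classic); last first.
      apply/seteqP; split => z /=; rewrite !in_itv/= /phi ltr_pdivrMr// ler_pdivlMr//;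
        by rewrite ltrBlDr lerBrDr mulrC.
    rewrite !lebesgue_measure_itv/= !lte_fin xy ltr_pM2r ?invr_gt0// ltrD2r xy.
    rewrite -EFinB -EFinM gtr0_norm//; congr _%:E.
    by field; rewrite gt_eqF.
  (* A negative slope moves the closed end of the half-open interval to the other side; the length
     is the same. *)
  have {an a0} an : a < 0 by rewrite lt_neqAle a0.
  rewrite (_ : phi @^-1` _ = `[(y - b) / a, (x - b) / a[%classic); last first.
    apply/seteqP; split => z /=; rewrite !in_itv/= /phi ltr_ndivlMr// ler_ndivrMr//;
      by rewrite ltrBlDr lerBrDr mulrC andbC.
  rewrite !lebesgue_measure_itv/= !lte_fin xy ltr_nM2r ?invr_lt0// ltrD2r xy.
  rewrite -EFinB -EFinM ltr0_norm//; congr _%:E.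
  by field; rewrite lt_eqF.
have -> : (\int[leb]_x f x = \int[nu]_x f x)%E.
  by apply: eq_measure_integral => A mA _; exact: nuE.
rewrite ge0_integral_mscale// ge0_integral_pushforward//= muleA -EFinM.
by rewrite mulVf ?normr_eq0// mul1e.
Qed.

Lemma ae_affine a b (P : R -> Prop) : a != 0 ->
  (\forall x \ae leb, P x) -> \forall x \ae leb, P (a * x + b).
Proof.
move=> a0 [N [mN N0 PN]].
have mN' : measurable ((fun x => a * x + b : mR) @^-1` N).
  by rewrite -[X in measurable X]setTI; apply: measurable_affine.
exists ((fun x => a * x + b) @^-1` N); split => //; last by move=> x /=; exact: PN.
rewrite -[X in leb X]setIT -integral_indic//.
rewrite (_ : (fun x => _) = fun x : R => (EFin \o \1_N) (a * x + b)); last first.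
  by apply/funext => x /=; rewrite !indicE; congr (_%:R%:E); apply/idP/idP; rewrite !inE.
rewrite ge0_integral_affine//; last 2 first.
- by apply/measurable_EFinP; exact: measurable_indic.
- by move=> x /=; rewrite lee_fin.
suff -> : (\int[leb]_x (EFin \o \1_N) x = 0)%E by rewrite mule0.
by apply: etrans N0; rewrite integral_indic// setIT.
Qed.

Lemma cmeasurable_affine a b (f : R -> R[i]) :
  cmeasurable (setT : set (mR)) f ->
  cmeasurable (setT : set (mR)) (fun x => f (a * x + b)).
Proof.
move=> mf.
exact: (@cmeasurable_comp _ _ mR mR R setT f _ mf (@measurable_affine a b setT)).
Qed.

Lemma sqnorm_affine a b (f : R -> R[i]) : a != 0 ->
  cmeasurable (setT : set (mR)) f ->
  sqnorm leb setT (fun x => f (a * x + b)) = (`|a|^-1%:E * sqnorm leb setT f)%E.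
Proof.
move=> a0 mf.
apply: (@ge0_integral_affine a b (fun x => (normc (f x) ^+ 2)%:E)) => //.
- exact: emeasurable_normc_sqr.
- by move=> x; rewrite lee_fin sqr_ge0.
Qed.

Lemma L2_affine a b (f : R -> R[i]) : a != 0 ->
  L2 leb setT f -> L2 leb setT (fun x => f (a * x + b)).
Proof.
move=> a0 /L2P[mf foo]; apply/L2P; split; first exact: cmeasurable_affine.
by rewrite sqnorm_affine// lte_mul_pinfty// lee_fin invr_ge0.
Qed.

Lemma integrable_affine a b (f : R -> R) : a != 0 ->
  leb.-integrable setT (EFin \o f) ->
  leb.-integrable setT (EFin \o (fun x => f (a * x + b))).
Proof.
move=> a0 /integrableP[/measurable_EFinP mf foo]; apply/integrableP; split.
  apply/measurable_EFinP.
  exact: (measurableT_comp mf (@measurable_affine a b setT)).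
rewrite [ltLHS](ge0_integral_affine b a0 (f := fun x => `|(f x)%:E|%E))//.
  by rewrite lte_mul_pinfty// lee_fin invr_ge0.
by do 2 apply: measurableT_comp => //.
Qed.

Lemma fine_mulB (c : R) (x y : \bar R) : x \is a fin_num -> y \is a fin_num ->
  fine (c%:E * x - c%:E * y) = c * fine (x - y).
Proof. by case: x y => [x||] [y||]// _ _ /=; rewrite mulrBr. Qed.

Lemma Rintegral_affine a b (f : R -> R) : a != 0 ->
  leb.-integrable setT (EFin \o f) ->
  Rintegral leb setT (fun x => f (a * x + b)) = `|a|^-1 * Rintegral leb setT f.
Proof.
move=> a0 intf; have /integrableP[mf _] := intf.
rewrite /Rintegral integralE [in RHS]integralE.
have -> : (\int[leb]_x (fun x => (f (a * x + b))%:E)^\+ x =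
    \int[leb]_x (EFin \o f)^\+ (a * x + b)%R)%E.
  by apply: eq_integral => x _; rewrite !funeposE.
have -> : (\int[leb]_x (fun x => (f (a * x + b))%:E)^\- x =
    \int[leb]_x (EFin \o f)^\- (a * x + b)%R)%E.
  by apply: eq_integral => x _; rewrite !funenegE.
rewrite !ge0_integral_affine//; try exact: measurable_funepos; try exact: measurable_funeneg.
have fp := integrable_fin_num measurableT (integrable_funepos measurableT intf).
have fn := integrable_fin_num measurableT (integrable_funeneg measurableT intf).
exact: fine_mulB.
Qed.

Lemma cintegral_affine a b (f : R -> R[i]) : a != 0 -> cintegrable leb setT f ->
  cintegral leb setT (fun x => f (a * x + b)) = (`|a|^-1)%:C * cintegral leb setT f.
Proof.
move=> a0 cf; apply: complex_eqP; rewrite ?cReM ?cImM/= mul0r ?subr0 ?addr0.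
  exact: (Rintegral_affine b a0 (cintegrable_Re measurableT cf)).
exact: (Rintegral_affine b a0 (cintegrable_Im measurableT cf)).
Qed.

Lemma cintegrable_affine a b (f : R -> R[i]) : a != 0 -> cintegrable leb setT f ->
  cintegrable leb setT (fun x => f (a * x + b)).
Proof.
move=> a0 cf; have /integrableP[_ foo] := integrable_affine b a0 (cintegrable_normc cf).
split; first by apply: cmeasurable_affine; case: cf.
apply: le_lt_trans foo; rewrite le_eqVlt; apply/orP; left; apply/eqP.
by apply: eq_integral => x _ /=; rewrite ger0_norm// normc_ge0.
Qed.

End affine_change.

(** * Continuity of dilations and translations *)

Section L1_continuity.
Context (R : realType).
Local Notation leb := (@lebesgue_measure R).
Local Notation mR := (measurableTypeR R).
Implicit Types (h g : R -> R) (n : nat).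

Lemma leb_itvcc_lty (a b : R) : (leb `[a, b]%classic < +oo)%E.
Proof. by rewrite lebesgue_measure_itv/=; case: ifP => // _; rewrite -EFinB ltry. Qed.

Lemma ae_neq (p : R) : \forall x \ae leb, x != p.
Proof.
exists [set p]; split; [exact: measurable_set1|exact: lebesgue_measure_set1|].
by move=> x /= /negP; rewrite negbK => /eqP.
Qed.

Definition cutoff n h (x : R) : R := if `|x| <= n%:R then h x else 0.

Lemma measurable_cutoff n h : measurable_fun (setT : set mR) h ->
  measurable_fun (setT : set mR) (cutoff n h).
Proof.
move=> mh; apply: measurable_fun_ifT => //.
apply: measurable_fun_ler; last exact: measurable_cst.
exact: (@measurableT_comp _ _ _ _ _ _ (@Num.norm R R)).
Qed.

Lemma cutoff_near h (x : R) : \forall n \near \oo, cutoff n h x = h x.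
Proof.
exists (Num.truncn `|x|).+1 => // n /= xn; rewrite /cutoff ifT// ltW//.
by apply: (lt_le_trans (truncnS_gt _)); rewrite ler_nat.
Qed.

Lemma cutoff_cvg h : leb.-integrable setT (EFin \o h) ->
  (fun n => \int[leb]_x `|(cutoff n h x - h x)%:E|)%E @ \oo --> 0%E.
Proof.
move=> ih; have /integrableP[/measurable_EFinP mh _] := ih.
have ih' : leb.-integrable setT (fun x => `|(h x)%:E|%E) by exact: integrable_abse.
have [] := @dominated_convergence _ mR R leb setT measurableT
  (fun n x => (cutoff n h x)%:E) (EFin \o h) (fun x => `|(h x)%:E|%E).
- by move=> n; apply/measurable_EFinP; exact: measurable_cutoff.
- exact/measurable_EFinP.
- apply: aeW => x _; apply: cvg_near_cst.
  by apply: filterS (cutoff_near h x) => n ->.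
- exact: ih'.
- apply: aeW => x n _; rewrite /cutoff; case: ifPn => //= _.
  by rewrite normr0 lee_fin.
by [].
Qed.

Lemma cutoff_L1 h (e : R) : 0 < e -> leb.-integrable setT (EFin \o h) ->
  exists n, (\int[leb]_x `|(h x - cutoff n h x)%:E| < e%:E)%E.
Proof.
move=> e0 /cutoff_cvg /fine_cvgP[[N1 _ h1]] /cvgrPdist_lt /(_ e e0) [N2 _ h2].
exists (maxn N1 N2).
have := h2 (maxn N1 N2); rewrite /= leq_maxr => /(_ isT).
have := h1 (maxn N1 N2); rewrite /= leq_maxl => /(_ isT).
set I := (X in (X < _)%E); set J := (X in X \is a fin_num) => Jf.
have -> : I = J by apply: eq_integral => x _ /=; rewrite distrC.
rewrite sub0r normrN ger0_norm; last by rewrite fine_ge0// integral_ge0.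
by rewrite -lte_fin fineK.
Qed.

(** Continuous functions approximate in L_1 on a bounded interval; cutting them off sharply gives
    bounded support, at the price of possible jumps at n and -n. *)
Lemma cutoff_continuous_dense h (e : R) : 0 < e ->
  leb.-integrable setT (EFin \o h) ->
  exists n g, [/\ continuous g, leb.-integrable setT (EFin \o cutoff n g) &
    (\int[leb]_x `|(h x - cutoff n g x)%:E| < e%:E)%E].
Proof.
move=> e0 ih; have e20 : 0 < e / 2 by rewrite divr_gt0.
have /integrableP[/measurable_EFinP mh _] := ih.
have [n hn] := cutoff_L1 e20 ih.
pose E := (`[- n%:R, n%:R]%classic : set mR).
have mE : measurable E by exact: measurable_itv.
have inE' x : (x \in E) = (`|x| <= n%:R).
  by rewrite /E mem_setE in_itv/= ler_norml.
have cutE g : cutoff n g = g \_ E.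
  by apply/funext => x; rewrite patchE inE'.
have [||gs [cg ig]] := @approximation_continuous_integrable R E h mE.
- exact: leb_itvcc_lty.
- exact: integrableS ih.
move=> /fine_cvgP[[N1 _ h1]] /cvgrPdist_lt /(_ _ e20) [N2 _ h2].
pose N := maxn N1 N2; exists n, (gs N).
have iT : leb.-integrable setT (EFin \o cutoff n (gs N)).
  by rewrite cutE -restrict_EFin; apply/(integrable_mkcond _ mE).
split => //.
have mg : measurable_fun (setT : set mR) (gs N) by exact: continuous_measurable_fun.
have := h2 N; rewrite /= leq_maxr => /(_ isT).
have := h1 N; rewrite /= leq_maxl => /(_ isT) Jf.
rewrite sub0r normrN ger0_norm; last by rewrite fine_ge0// integral_ge0.
rewrite -lte_fin fineK// => J.
rewrite (splitr e) EFinD.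
have mc := measurable_cutoff n mh; have mcg := measurable_cutoff n mg.
apply: le_lt_trans (lteD hn J).
have m1 : measurable_fun (setT : set mR) (fun x => `|h x - cutoff n h x|%:E).
  by apply/measurable_EFinP; apply: measurableT_comp => //; exact: measurable_funB.
have m2 : measurable_fun (setT : set mR) ((fun x => `|h x - gs N x|%:E) \_ E).
  apply: (measurable_restrictT _ mE).1; apply: measurable_funTS.
  by apply/measurable_EFinP; apply: measurableT_comp => //; exact: measurable_funB.
have p2 (x : mR) : (0 <= ((fun x => `|h x - gs N x|%:E) \_ E) x)%E.
  by rewrite patchE; case: ifPn => // _; rewrite lee_fin.
rewrite [X in (_ <= _ + X)%E]integral_mkcond -ge0_integralD//=.
apply: ge0_le_integral => //.
- by apply/measurable_EFinP; apply: measurableT_comp => //; exact: measurable_funB.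
- exact: emeasurable_funD.
- move=> x _; rewrite patchE inE' /cutoff; case: ifPn => _ /=.
    by rewrite subrr normr0 add0e.
  by rewrite adde0.
Qed.

(** Density argument: dominated convergence applies to the cut-off continuous function [k], and the
    error h - k is carried along by the change of variables, which multiplies its norm by at most 2
    once |a n| >= 1/2. *)
Lemma affine_L1_cvg h (a b : nat -> R) : leb.-integrable setT (EFin \o h) ->
  (forall n, a n != 0) -> a @ \oo --> (1 : R) -> b @ \oo --> (0 : R) ->
  (fun n => Rintegral leb setT (fun x => `|h (a n * x + b n) - h x|)) @ \oo --> (0 : R).
Proof.
move=> ih a0 a1 b0; have /integrableP[/measurable_EFinP mh _] := ih.
apply/cvgrPdist_le => e e0.
(* Budget: 2 (e / 6) for h - k after the change of variables, e / 6 for h - k itself and e / 6 for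
   [k]. *)
have e60 : 0 < e / 6 by rewrite divr_gt0.
have [m [g [cg ig gh]]] := cutoff_continuous_dense e60 ih.
set k := cutoff m g in ig gh.
have mg : measurable_fun (setT : set mR) g by exact: continuous_measurable_fun.
have mk : measurable_fun (setT : set mR) k by exact: measurable_cutoff.
have ihk : leb.-integrable setT (EFin \o (fun x => h x - k x)).
  exact: (integrableB measurableT ih ig).
have Rhk : Rintegral leb setT (fun x => `|h x - k x|) <= e / 6.
  rewrite -lee_fin /Rintegral fineK ?ltW//.
  by apply: integrable_fin_num => //; exact: integrable_norm.
have [M gM] : exists M, forall x, `|k x| <= M.
  have cK : compact `[(- m%:R : R), m%:R] by exact: segment_compact.
  have : compact (g @` `[- m%:R, m%:R]).
    by apply: continuous_compact => //; apply: continuous_subspaceT.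
  move=> /compact_bounded[M0 [_ M0P]]; exists (`|M0| + 1) => x.
  rewrite /k /cutoff; case: ifPn => [xm|_]; last by rewrite normr0 addr_ge0.
  apply: (M0P (`|M0| + 1)); first by rewrite (le_lt_trans (ler_norm _))// ltrDl.
  by exists x => //=; rewrite in_itv/= -ler_norml.
have ck : (fun n => Rintegral leb setT (fun x => `|k (a n * x + b n) - k x|)) @ \oo --> (0 : R).
  have near_ab : \forall n \near \oo, 2^-1 <= `|a n| /\ `|b n| <= 1.
    near=> n; split.
      have : `|1 - a n| <= 2^-1 by near: n; apply: (cvgrPdist_le _ _).1 a1 _ _.
      have := lerB_dist 1 (a n); rewrite normr1; lra.
    by rewrite -normrN -sub0r; near: n; exact: (cvgrPdist_le _ _).1 b0 _ _.
  have [N _ hN] := near_ab.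
  rewrite -(cvg_shiftn N).
  (* Outside [E] both k(x) and k(a x + b) vanish: |a x + b| >= |x| / 2 - 1 > m as soon as |a| >= 1/2
     and |b| <= 1. *)
  pose E := (`[- (2 * (m%:R + 1)), 2 * (m%:R + 1)]%classic : set mR).
  have mE : measurable E by exact: measurable_itv.
  have iE : leb.-integrable setT (EFin \o (fun x => 2 * M * \1_E x)).
    have i1 : leb.-integrable setT (EFin \o (\1_E : mR -> R)).
      exact: integrable_indic_itv.
    exact: (integrableZl measurableT (2 * M) i1).
  have [] := @dominated_convergence _ mR R leb setT measurableT
    (fun n x => `|k (a (n + N)%N * x + b (n + N)%N) - k x|%:E) (cst 0%E)
    (EFin \o (fun x => 2 * M * \1_E x)).
  - move=> n; apply/measurable_EFinP; apply: measurableT_comp => //.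
    apply: measurable_funB => //.
    exact: (measurableT_comp mk (@measurable_affine _ _ _ setT)).
  - exact: measurable_cst.
  (* [k] is continuous away from its two possible jumps, which almost every x avoids. *)
  - apply: ae_impl2 (ae_neq m%:R) (ae_neq (- m%:R)) => x xm xNm _.
    have kx : {for x, continuous k}.
      have := ltgtP `|x| m%:R => -[xm'|xm'|/eqP]; last first.
      + by rewrite eqr_norml (negPf xm) (negPf xNm).
      + rewrite /prop_for /continuous_at /k {2}/cutoff leNgt xm'/=.
        apply: cvg_near_cst; near=> y; rewrite /cutoff ifF//; apply/negbTE; rewrite -ltNge.
        by near: y; apply: cvgr_gt xm'; exact: norm_continuous.
      + rewrite /prop_for /continuous_at /k {2}/cutoff ltW//.
        apply: cvg_trans (cg x); apply: near_eq_cvg; near=> y.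
        rewrite /cutoff ifT// ltW//.
        by near: y; apply: cvgr_lt xm'; exact: norm_continuous.
    apply: cvg_EFin; first exact: nearW.
    rewrite -(normr0 R) -(subrr (k x)); apply: cvg_norm; apply: cvgB; last exact: cvg_cst.
    apply: (cvg_comp (fun n => a (n + N)%N * x + b (n + N)%N) k); last exact: kx.
    have : (fun n => a (n + N)%N * x + b (n + N)%N) @ \oo --> 1 * x + 0.
      apply: cvgD; last by rewrite (cvg_shiftn N b).
      by apply: cvgM; [rewrite (cvg_shiftn N a)|exact: cvg_cst].
    by rewrite mul1r addr0.
  - exact: iE.
  - apply: aeW => x n _; rewrite /= normr_id lee_fin indicE.
    have [an bn] := hN (n + N)%N (leq_addl _ _).
    have [_|] := boolP (x \in E); rewrite /= ?mulr1 ?mulr0.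
      by rewrite (le_trans (ler_normB _ _))// mulr_natl mulr2n lerD.
    rewrite notin_setE /E/= in_itv/= -ler_norml => /negP; rewrite -ltNge => xm.
    rewrite /k /cutoff !ifF ?subrr ?normr0//; apply/negbTE; rewrite -ltNge.
      by apply: le_lt_trans xm; have : (0 : R) <= m%:R by []; lra.
    have := lerB_dist (a (n + N)%N * x) (- b (n + N)%N).
    rewrite opprK normrN normrM.
    have : 2^-1 * `|x| <= `|a (n + N)%N| * `|x| by rewrite ler_wpM2r.
    have : (0 : R) <= m%:R by []. 
    lra.
  by move=> _ _; rewrite integral0 => /fine_cvg.
near=> n.
have an : 2^-1 <= `|a n|.
  have : `|1 - a n| <= 2^-1 by near: n; apply: (cvgrPdist_le _ _).1 a1 _ _.
  have := lerB_dist 1 (a n); rewrite normr1; lra.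
have kn : Rintegral leb setT (fun x => `|k (a n * x + b n) - k x|) <= e / 6.
  rewrite -[leLHS]ger0_norm ?Rintegral_ge0// -normrN -sub0r.
  by near: n; exact: (cvgrPdist_le _ _).1 ck _ _.
rewrite sub0r normrN ger0_norm ?Rintegral_ge0//.
have ihka : leb.-integrable setT (EFin \o (fun x => h (a n * x + b n) - k (a n * x + b n))).
  exact: (integrable_affine (b n) (a0 n) ihk).
have ika : leb.-integrable setT (EFin \o (fun x => k (a n * x + b n) - k x)).
  exact: (integrableB measurableT (integrable_affine (b n) (a0 n) ig) ig).
have iha : leb.-integrable setT (EFin \o (fun x => h (a n * x + b n) - h x)).
  exact: (integrableB measurableT (integrable_affine (b n) (a0 n) ih) ih).
apply: (@le_trans _ _ (Rintegral leb setT
    (fun x => `|h (a n * x + b n) - k (a n * x + b n)| + `|k (a n * x + b n) - k x|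
      + `|h x - k x|))).
  apply: le_Rintegral => //.
  - exact: integrable_norm.
  - exact: (integrableD measurableT (integrableD measurableT (integrable_norm ihka)
      (integrable_norm ika)) (integrable_norm ihk)).
  - move=> x _; rewrite (distrC (h x) (k x)).
    apply: le_trans (lerD (ler_normD _ _) (lexx _)).
    apply: le_trans (ler_normD _ _); rewrite le_eqVlt; apply/orP; left; apply/eqP.
    by congr (`|_|); ring.
rewrite RintegralD//; last 2 first.
- exact: (integrableD measurableT (integrable_norm ihka) (integrable_norm ika)).
- exact: integrable_norm.
rewrite RintegralD//; [|exact: integrable_norm..].
have := @Rintegral_affine R (a n) (b n) (fun x => `|h x - k x|) (a0 n) (integrable_norm ihk).
move=> ->.
have : `|a n|^-1 * Rintegral leb setT (fun x => `|h x - k x|) <= 2 * (e / 6).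
  apply: ler_pM => //; first by rewrite Rintegral_ge0.
  by rewrite -[leRHS]invrK lef_pV2// posrE ?invr_gt0// normr_gt0.
move=> h1; rewrite (_ : e = 2 * (e / 6) + e / 6 + e / 6 + 2 * (e / 6)); last by field.
rewrite -[leLHS]addr0 lerD ?mulr_ge0 ?(ltW e60) ?(ltW e0)//.
by rewrite lerD// lerD.
Unshelve. all: by end_near.
Qed.

(* [`|a - b| ^ 2] is controlled by the increment of the signed square [a |a|]. *)
Lemma translation_L2_real (f : R -> R) (s : nat -> R) :
  measurable_fun (setT : set mR) f ->
  leb.-integrable setT (EFin \o (fun x => f x ^+ 2)) -> s @ \oo --> (0 : R) ->
  (fun n => Rintegral leb setT (fun x => (f (x - s n) - f x) ^+ 2)) @ \oo --> (0 : R).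
Proof.
move=> mf f2 s0; pose h x := f x * `|f x|.
have mh : measurable_fun (setT : set mR) h.
  by apply: measurable_funM => //; exact: measurableT_comp.
have ih : leb.-integrable setT (EFin \o h).
  apply: le_integrable f2 => //; first exact/measurable_EFinP.
  by move=> x _ /=; rewrite lee_fin /h normrM normr_id -expr2 real_normK ?num_real// ler_norm.
have c : (fun n => Rintegral leb setT (fun x => `|h (1 * x + - s n) - h x|)) @ \oo --> (0 : R).
  apply: (@affine_L1_cvg h (fun=> 1)) => //; first exact: cvg_cst.
  by rewrite -oppr0; exact: cvgN.
apply: (@squeeze_cvgr _ _ _ _ (fun=> 0) (fun n => 2 * Rintegral leb setT (fun x => `|h (1 * x + - s n) - h x|))).
- apply: nearW => n; rewrite Rintegral_ge0 => [|x _]; last exact: sqr_ge0.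
  have i1 : leb.-integrable setT (EFin \o (fun x => `|h (1 * x + - s n) - h x|)).
    apply: integrable_norm.
    exact: (integrableB measurableT (integrable_affine (- s n) (oner_neq0 R) ih) ih).
  rewrite -RintegralZl//.
  have i2 : leb.-integrable setT (EFin \o (fun x => 2 * `|h (1 * x + - s n) - h x|)).
    exact: (integrableZl measurableT 2 i1).
  (* For equal signs, |u^2 - v^2| = |u - v| |u + v| >= (u - v)^2. For opposite signs, u^2 + v^2 >=
     (u - v)^2 / 2, whence the factor 2. *)
  have p x : (f (x - s n) - f x) ^+ 2 <= 2 * `|h (1 * x + - s n) - h x|.
    rewrite mul1r /h; move: (f _) (f x) => u v.
    have := ler_norm (u * `|u| - v * `|v|).
    have := ler_norm (- (u * `|u| - v * `|v|)); rewrite normrN.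
    move: (`|_ - _|) => w.
    move=> w1 w2; have := sqr_ge0 (u + v).
    have [u0|u0] := ger0P u; have [v0|v0] := ger0P v;
      [rewrite (ger0_norm u0) (ger0_norm v0) in w1 w2|rewrite (ger0_norm u0) (ltr0_norm v0) in w1 w2
      |rewrite (ltr0_norm u0) (ger0_norm v0) in w1 w2|rewrite (ltr0_norm u0) (ltr0_norm v0) in w1 w2].
    - have [uv|/ltW uv] := leP u v; have := mulr_ge0 u0 v0; nra.
    - nra.
    - nra.
    - have [uv|/ltW uv] := leP u v; nra.
  apply: le_Rintegral => //.
  apply: le_integrable i2 => //.
    apply/measurable_EFinP; apply: measurable_funX; apply: measurable_funB => //.
    under eq_fun do rewrite -[x in x - _]mul1r.
    exact: (measurableT_comp mf (@measurable_affine _ _ _ setT)).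
  by move=> x _ /=; rewrite lee_fin ger0_norm ?sqr_ge0// (le_trans (p x))// ler_norm.
- exact: cvg_cst.
- by rewrite -[X in _ --> X](mulr0 2); apply: cvgM => //; exact: cvg_cst.
Qed.

Lemma translation_L2 (f : R -> R[i]) (s : nat -> R) :
  L2 leb setT f -> s @ \oo --> (0 : R) ->
  L2cvg leb setT (fun n x => f (x - s n)) f.
Proof.
move=> Lf s0; have [mf1 mf2] := L2_cmeasurable Lf.
have if2 := L2_integrable Lf.
have i1 : leb.-integrable setT (EFin \o (fun x => cRe (f x) ^+ 2)).
  apply: le_integrable if2 => //; first by apply/measurable_EFinP; exact: measurable_funX.
  by move=> x _ /=; rewrite lee_fin !ger0_norm ?sqr_ge0// normc_sqr lerDl sqr_ge0.
have i2 : leb.-integrable setT (EFin \o (fun x => cIm (f x) ^+ 2)).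
  apply: le_integrable if2 => //; first by apply/measurable_EFinP; exact: measurable_funX.
  by move=> x _ /=; rewrite lee_fin !ger0_norm ?sqr_ge0// normc_sqr lerDr sqr_ge0.
have c1 := translation_L2_real mf1 i1 s0.
have c2 := translation_L2_real mf2 i2 s0.
have LD n : L2 leb setT (fun x => f (x - s n) - f x).
  apply: (L2B measurableT _ Lf).
  have := L2_affine (- s n) (oner_neq0 R) Lf.
  by under eq_fun do rewrite mul1r.
apply: cvg_EFin; first by apply: nearW => n; exact: sqnorm_fin.
have c : (fun n => Rintegral leb setT (fun x => (cRe (f (x - s n)) - cRe (f x)) ^+ 2) +
    Rintegral leb setT (fun x => (cIm (f (x - s n)) - cIm (f x)) ^+ 2)) @ \oo --> (0 : R).
  by rewrite -[X in _ --> X](addr0 0); exact: cvgD.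
apply: cvg_trans c; apply: near_eq_cvg; apply: nearW => n /=.
have := L2_integrable (LD n) => iD.
have mD := L2_cmeasurable (LD n).
rewrite -RintegralD//.
- apply: eq_Rintegral => x _.
  by rewrite normc_sqr cReD cImD cReN cImN.
- apply: le_integrable iD => //.
    apply/measurable_EFinP; case: mD => [+ _].
    by under eq_fun do rewrite cReD cReN; exact: measurable_funX.
  move=> x _ /=; rewrite lee_fin !ger0_norm ?sqr_ge0// normc_sqr.
  by rewrite cReD cReN lerDl sqr_ge0.
- apply: le_integrable iD => //.
    apply/measurable_EFinP; case: mD => [_ +].
    by under eq_fun do rewrite cImD cImN; exact: measurable_funX.
  move=> x _ /=; rewrite lee_fin !ger0_norm ?sqr_ge0// normc_sqr.
  by rewrite cImD cImN lerDr sqr_ge0.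
Qed.

End L1_continuity.

(** * Plancherel's theorem *)

Section poisson_kernel.
Context (R : realType).
Local Notation leb := (@lebesgue_measure R).
Local Notation mR := (measurableTypeR R).
Implicit Types (e w p x y : R).

(** The damping factor of Abel summation; its Fourier transform is [poisson]. *)
Definition abel e p := expR (- (e * `|p|)).

Lemma abel_ge0 e p : 0 <= abel e p. Proof. exact: expR_ge0. Qed.

Lemma abelN e p : abel e (- p) = abel e p.
Proof. by rewrite /abel normrN. Qed.

Lemma continuous_abel e : continuous (abel e).
Proof.
move=> p; apply: (@continuous_comp _ _ _ (fun p => - (e * `|p|)) expR); last exact: continuous_expR.
apply: cvgN; apply: cvgM; [exact: cvg_cst|exact: norm_continuous].
Qed.

Lemma measurable_abel e (D : set mR) : measurable D -> measurable_fun D (abel e).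
Proof.
by move=> mD; apply: measurable_funTS; apply: continuous_measurable_fun; exact: continuous_abel.
Qed.

Let c_expN e : 0 < e -> expR (- (e * p)) @[p --> +oo] --> (0 : R).
Proof.
move=> e0; apply: (cvg_comp (fun p => e * p) (fun x => expR (- x))); last exact: cvgr_expR.
by apply: gt0_cvgMry => //; exact: cvg_id.
Qed.

(** The summand 1 makes the integrand nonnegative, so that the fundamental theorem of calculus on a
    half-line applies to it. *)
Lemma integral_abel_cos_half e w : 0 < e ->
  (\int[leb]_(p in `[0%R, +oo[) (expR (- (e * p)) * (1 + cos (w * p)))%:E =
  (e^-1 + e / (e ^+ 2 + w ^+ 2))%:E)%E.
Proof.
move=> e0.
(* A primitive is exp(- e p) [G] p: the term - 1 / e comes from the constant 1, the other one from
   the primitive exp(- e p) (w sin (w p) - e cos (w p)) / (e^2 + w^2) of exp(- e p) cos (w p). *)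
pose G p := - e^-1 + (e ^+ 2 + w ^+ 2)^-1 * (w * sin (w * p) - e * cos (w * p)).
pose F p := expR (- (e * p)) * G p.
have ew0 : e ^+ 2 + w ^+ 2 != 0 by rewrite gt_eqF// ltr_pwDl ?sqr_ge0// exprn_gt0.
have dmul (c p : R) : is_derive p 1 (fun p => c * p) c.
  exact: (is_derive_eq (is_deriveZ c (is_derive_id p 1)) (mulr1 c)).
have dF p : is_derive p 1 F (expR (- (e * p)) * (1 + cos (w * p))).
  have d0 : is_derive p 1 (fun p => - (e * p)) (- e) by exact: is_deriveN.
  have d1 := @is_derive1_comp R expR (fun p => - (e * p)) p _ _ (is_derive_expR _) d0.
  have d2 := @is_derive1_comp R (@sin R) (fun p => w * p) p _ _ (is_derive_sin _) (dmul w p).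
  have d3 := @is_derive1_comp R (@cos R) (fun p => w * p) p _ _ (is_derive_cos _) (dmul w p).
  have d4 := is_deriveD (is_derive_cst (- e^-1 : R) p 1)
    (is_deriveZ (e ^+ 2 + w ^+ 2)^-1 (is_deriveB (is_deriveZ w d2) (is_deriveZ e d3))).
  have d5 := is_deriveM d1 d4.
  apply: (is_derive_eq d5).
  rewrite -[LHS]/(expR (- (e * p)) * (0 + (e ^+ 2 + w ^+ 2)^-1 *
      (w * (cos (w * p) * w) - e * (- sin (w * p) * w))) +
    (- e^-1 + (e ^+ 2 + w ^+ 2)^-1 * (w * sin (w * p) - e * cos (w * p))) *
      (expR (- (e * p)) * - e)).
  by field; rewrite ew0/= gt_eqF.
rewrite (@ge0_continuous_FTC2y _ _ F _ 0).
- rewrite /F /G mulr0 oppr0 expR0 mulr0 sin0 cos0 -EFinB; congr _%:E.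
  by field; rewrite ew0 gt_eqF.
- by move=> x _; rewrite mulr_ge0 ?expR_ge0// -lerBlDl sub0r cos_geN1.
- apply: continuous_subspaceT => x.
  apply: cvgM.
    apply: (@continuous_comp _ _ _ (fun p => - (e * p)) expR); last exact: continuous_expR.
    by apply: cvgN; apply: cvgM; [exact: cvg_cst|exact: cvg_id].
  apply: cvgD; first exact: cvg_cst.
  apply: (@continuous_comp _ _ _ (fun p => w * p) (@cos R)); last exact: continuous_cos.
  by apply: cvgM; [exact: cvg_cst|exact: cvg_id].
(* [C] bounds |[G]|, so the primitive vanishes at infinity. *)
- pose C := e^-1 + (`|w| + e) / (e ^+ 2 + w ^+ 2).
  apply: (@squeeze_cvgr _ _ _ _ (fun p => - (expR (- (e * p)) * C)) (fun p => expR (- (e * p)) * C)).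
  + apply: nearW => p; rewrite -ler_norml /F normrM (ger0_norm (expR_ge0 _)) ler_wpM2l ?expR_ge0//.
    rewrite /G (le_trans (ler_normD _ _))// normrN (gtr0_norm (_ : 0 < e^-1)) ?invr_gt0//.
    rewrite lerD2l normrM (gtr0_norm (_ : 0 < (e ^+ 2 + w ^+ 2)^-1)); last first.
      by rewrite invr_gt0 ltr_pwDl ?sqr_ge0// exprn_gt0.
    rewrite [leLHS]mulrC ler_wpM2r// ?invr_ge0 ?addr_ge0 ?sqr_ge0//.
    rewrite (le_trans (ler_normB _ _))// !normrM lerD//.
      by rewrite -[leRHS]mulr1 ler_wpM2l// ler_norml sin_geN1 sin_le1.
    by rewrite (gtr0_norm e0) -[leRHS]mulr1 ler_wpM2l ?(ltW e0)// ler_norml cos_geN1 cos_le1.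
  + rewrite -oppr0 -[X in _ --> - X](mul0r C); apply: cvgN.
    by apply: cvgM; [exact: c_expN|exact: cvg_cst].
  + by rewrite -[X in _ --> X](mul0r C); apply: cvgM; [exact: c_expN|exact: cvg_cst].
- by move=> x _; exact: (@ex_derive _ _ _ _ _ _ _ (dF x)).
- apply: cvg_at_right_filter; apply: differentiable_continuous.
  by apply/derivable1_diffP; exact: (@ex_derive _ _ _ _ _ _ _ (dF 0)).
- by move=> x _; rewrite derive1E; exact: (@derive_val _ _ _ _ _ _ _ (dF x)).
Qed.

Lemma itvcyE : [set x : R | 0 <= x] = `[0%R, +oo[%classic.
Proof. by apply/seteqP; split => x/=; rewrite in_itv/= andbT. Qed.

Lemma integral_abel_cos e w : 0 < e ->
  (\int[leb]_p (abel e p * (1 + cos (w * p)))%:E = (2 * (e^-1 + e / (e ^+ 2 + w ^+ 2)))%:E)%E.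
Proof.
move=> e0; rewrite ge0_symfun_integralT.
- rewrite itvcyE EFinM -integral_abel_cos_half//; congr (_ * _)%E.
  apply: eq_integral => p; rewrite inE/= in_itv/= andbT => p0.
  by rewrite /abel ger0_norm.
- by move=> p; rewrite mulr_ge0 ?expR_ge0// -lerBlDl sub0r cos_geN1.
- move=> p; apply: cvgM; first exact: continuous_abel.
  apply: cvgD; first exact: cvg_cst.
  apply: (@continuous_comp _ _ _ (fun p => w * p) (@cos R)); last exact: continuous_cos.
  by apply: cvgM; [exact: cvg_cst|exact: cvg_id].
- by move=> p /=; rewrite abelN mulrN cosN.
Qed.

(** At w = 0 the cosine is 1, so the previous integral is twice this one. *)
Lemma integral_abel e : 0 < e -> (\int[leb]_p (abel e p)%:E = (2 / e)%:E)%E.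
Proof.
move=> e0; have := integral_abel_cos 0 e0.
under eq_integral do rewrite mul0r cos0 mulrC EFinM.
rewrite ge0_integralZl_EFin//; last 2 first.
- by move=> p _; rewrite lee_fin abel_ge0.
- by apply/measurable_EFinP; exact: measurable_abel.
rewrite expr0n addr0/= expr2 invfM mulrA mulfV ?gt_eqF// mul1r -mulr2n -mulr_natl.
set I := (\int[_]_x _)%E => h.
clearbody I; case: I h => [r||].
- by rewrite -EFinM => -[h]; congr EFin; lra.
- by rewrite mulry gtr0_sg ?mul1e// mulr_gt0.
- by rewrite mulrNy gtr0_sg ?mul1e// mulr_gt0.
Qed.

Lemma integrable_abel e : 0 < e -> leb.-integrable setT (EFin \o abel e).
Proof.
move=> e0; apply/integrableP; split; first by apply/measurable_EFinP; exact: measurable_abel.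
under eq_integral do rewrite gee0_abs ?lee_fin ?abel_ge0//.
by rewrite integral_abel// ltry.
Qed.

(** The Poisson kernel of the half-plane at height e, normalised to total mass 2 pi. *)
Definition poisson e w : R := 2 * e / (e ^+ 2 + w ^+ 2).

Lemma Rintegral_abel_cos e w : 0 < e ->
  Rintegral leb setT (fun p => abel e p * cos (w * p)) = poisson e w.
Proof.
move=> e0.
have mc : measurable_fun (setT : set mR) (fun p => cos (w * p)).
  apply: continuous_measurable_fun => p.
  apply: (@continuous_comp _ _ _ (fun p => w * p) (@cos R)); last exact: continuous_cos.
  by apply: cvgM; [exact: cvg_cst|exact: cvg_id].
have i1 := integrable_abel e0.
have i2 : leb.-integrable setT (EFin \o (fun p => abel e p * cos (w * p))).
  apply: le_integrable i1 => //.
    by apply/measurable_EFinP; apply: measurable_funM => //; exact: measurable_abel.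
  move=> p _ /=; rewrite lee_fin normrM ler_piMr// ler_norml cos_geN1 cos_le1//.
have := integral_abel_cos w e0 => /(congr1 fine).
rewrite -[LHS]/(Rintegral leb setT (fun p => abel e p * (1 + cos (w * p)))).
under eq_Rintegral do rewrite mulrDr mulr1.
rewrite RintegralD// {1}/Rintegral integral_abel//= => h.
have -> : Rintegral leb setT (fun p => abel e p * cos (w * p)) =
  2 * (e^-1 + e / (e ^+ 2 + w ^+ 2)) - 2 / e by rewrite -h addrC addKr.
by rewrite /poisson; ring.
Qed.

Lemma Rintegral_abel_sin e w : 0 < e ->
  Rintegral leb setT (fun p => abel e p * sin (w * p)) = 0.
Proof.
move=> e0.
have mc : measurable_fun (setT : set mR) (fun p => sin (w * p)).
  apply: continuous_measurable_fun => p.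
  apply: (@continuous_comp _ _ _ (fun p => w * p) (@sin R)); last exact: continuous_sin.
  by apply: cvgM; [exact: cvg_cst|exact: cvg_id].
have i2 : leb.-integrable setT (EFin \o (fun p => abel e p * sin (w * p))).
  apply: le_integrable (integrable_abel e0) => //.
    by apply/measurable_EFinP; apply: measurable_funM => //; exact: measurable_abel.
  move=> p _ /=; rewrite lee_fin normrM ler_piMr// ler_norml sin_geN1 sin_le1//.
have N1 : (-1 : R) != 0 by rewrite oppr_eq0 oner_neq0.
have := Rintegral_affine 0 N1 i2; rewrite normrN normr1 invr1 mul1r.
under eq_Rintegral do rewrite addr0 mulN1r abelN mulrN sinN mulrN -mulN1r.
rewrite RintegralZl// => h.
lra.
Qed.

Lemma cintegral_abel_expi e w : 0 < e ->
  cintegral leb setT (fun p => (abel e p)%:C * expi (w * p)) = (poisson e w)%:C.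
Proof.
move=> e0; apply: complex_eqP => /=.
  rewrite -(Rintegral_abel_cos w e0); apply: eq_Rintegral => p _.
  by rewrite /= mul0r subr0.
apply: etrans (Rintegral_abel_sin w e0); apply: eq_Rintegral => p _.
by rewrite /= mul0r addr0.
Qed.

Lemma poisson_ge0 e w : 0 < e -> 0 <= poisson e w.
Proof. by move=> e0; rewrite divr_ge0 ?addr_ge0 ?sqr_ge0// mulr_ge0// ltW. Qed.

Lemma poissonN e w : poisson e (- w) = poisson e w.
Proof. by rewrite /poisson sqrrN. Qed.

Lemma poissonM e w : 0 < e -> poisson e w = e^-1 * poisson 1 (w / e).
Proof.
move=> e0; rewrite /poisson; field.
by rewrite gt_eqF//= ?gt_eqF// ltr_pwDl ?sqr_ge0// exprn_gt0.
Qed.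

Lemma continuous_poisson e : 0 < e -> continuous (poisson e).
Proof.
move=> e0 w; apply: cvgM; first exact: cvg_cst.
apply: cvgV; first by rewrite gt_eqF// ltr_pwDl ?sqr_ge0// exprn_gt0.
by apply: cvgD; [exact: cvg_cst|exact: exprn_continuous].
Qed.

Lemma integral_poisson1 : (\int[leb]_w (poisson 1 w)%:E = (2 * pi)%:E)%E.
Proof.
rewrite ge0_symfun_integralT.
- rewrite itvcyE.
  under eq_integral do rewrite /poisson expr1n mulr1 EFinM.
  rewrite ge0_integralZl_EFin//; last 2 first.
  - by move=> p _; rewrite lee_fin invr_ge0 addr_ge0 ?sqr_ge0.
  - apply/measurable_EFinP; apply: measurable_funTS; apply: continuous_measurable_fun.
    exact: continuous_oneDsqrV.
  by rewrite integral0y_oneDsqr -!EFinM; congr _%:E; field.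
- by move=> w; exact: poisson_ge0.
- exact: continuous_poisson.
- by move=> w /=; rewrite poissonN.
Qed.

Lemma integrable_poisson1 : leb.-integrable setT (EFin \o poisson 1).
Proof.
apply/integrableP; split.
  by apply/measurable_EFinP; apply: continuous_measurable_fun; exact: continuous_poisson.
under eq_integral do rewrite gee0_abs ?lee_fin ?poisson_ge0//.
by rewrite integral_poisson1 ltry.
Qed.

End poisson_kernel.

(** * Polarization *)

Section sqnorm_add.
Context d (T : measurableType d) (R : realType).
Variables (mu : {measure set T -> \bar R}) (D : set T).
Hypothesis mD : measurable D.

Lemma fine_sqnormD (f g : T -> R[i]) (c : R[i]) : L2 mu D f -> L2 mu D g ->
  fine (sqnorm mu D (fun x => f x + c * g x)) =
  fine (sqnorm mu D f) + 2 * cRe (conjc c * inner mu D f g) +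
  normc c ^+ 2 * fine (sqnorm mu D g).
Proof.
move=> Lf Lg.
have if2 := L2_integrable Lf; have ig2 := L2_integrable Lg.
have ifg := cintegrableZ mD (conjc c) (inner_cintegrable mD Lf Lg).
have iRe := cintegrable_Re mD ifg.
have iR2 : mu.-integrable D (EFin \o (fun x => 2 * cRe (conjc c * (f x * conjc (g x))))).
  exact: (integrableZl mD 2 iRe).
have ic2 : mu.-integrable D (EFin \o (fun x => normc c ^+ 2 * normc (g x) ^+ 2)).
  exact: (integrableZl mD (normc c ^+ 2) ig2).
rewrite -[LHS]/(Rintegral mu D (fun x => normc (f x + c * g x) ^+ 2)).
under eq_Rintegral => x _.
  rewrite (_ : normc (f x + c * g x) ^+ 2 = normc (f x) ^+ 2 +
    2 * cRe (conjc c * (f x * conjc (g x))) + normc c ^+ 2 * normc (g x) ^+ 2); last first.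
    by rewrite !normc_sqr !(cReD, cImD, cReM, cImM, cReJ, cImJ); ring.
  over.
rewrite RintegralD//; last exact: (integrableD mD if2 iR2).
rewrite RintegralD// !RintegralZl//.
by rewrite -[inner mu D f g]/(cintegral mu D _) -cintegralZ//; exact: inner_cintegrable.
Qed.

End sqnorm_add.

(** The four values c = 1, -1, i, -i determine the real and imaginary parts of the inner product.
    Only one pair of functions on each side is compared, so no map between the two spaces has to be
    linear. *)
Lemma polarization d (T : measurableType d) d' (T' : measurableType d') (R : realType)
    (mu : {measure set T -> \bar R}) (D : set T)
    (mu' : {measure set T' -> \bar R}) (D' : set T')
    (f g : T -> R[i]) (f' g' : T' -> R[i]) :
  measurable D -> measurable D' ->
  L2 mu D f -> L2 mu D g -> L2 mu' D' f' -> L2 mu' D' g' ->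
  (forall c, sqnorm mu' D' (fun x => f' x + c * g' x) =
             sqnorm mu D (fun x => f x + c * g x)) ->
  inner mu' D' f' g' = inner mu D f g.
Proof.
move=> mD mD' Lf Lg Lf' Lg' h.
have e c := congr1 fine (h c).
have {}e c : fine (sqnorm mu' D' f') + 2 * cRe (conjc c * inner mu' D' f' g') +
    normc c ^+ 2 * fine (sqnorm mu' D' g') =
    fine (sqnorm mu D f) + 2 * cRe (conjc c * inner mu D f g) +
    normc c ^+ 2 * fine (sqnorm mu D g).
  by rewrite -!fine_sqnormD.
have ni : normc ('i : R[i]) = 1 by rewrite /= expr0n expr1n/= add0r sqrtr1.
move: e; move: (inner mu D f g) (inner mu' D' f' g') => z z' e.
have := e 1; have := e (-1); have := e 'i; have := e (- 'i).
rewrite !normcN ni normc1 !cReM !cReJ !cImJ !cReN !cImN /=.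
by move=> h1 h2 h3 h4; apply: complex_eqP; lra.
Qed.

(** * The Fourier transform of integrable functions *)

Section fourier_L1.
Context (R : realType).
Local Notation leb := (@lebesgue_measure R).
Local Notation mR := (measurableTypeR R).
Implicit Types (s p x y e : R) (f g k h : R -> R[i]).

(** The factor [s] stands for both -2 pi and 2 pi: Plancherel depends on s^2 only, and the two cases
    of the theorem use opposite signs. *)
Definition ft s k p : R[i] := cintegral leb setT (fun x => k x * expi (s * x * p)).

Lemma cmeasurable_expiM s p : cmeasurable (setT : set mR) (fun x => expi (s * x * p)).
Proof.
apply: cmeasurable_expi; apply: continuous_measurable_fun => x.
by apply: cvgM; [apply: cvgM; [exact: cvg_cst|exact: cvg_id]|exact: cvg_cst].
Qed.

Lemma cintegrable_expi k (t : R -> R) : cmeasurable (setT : set mR) (fun x => expi (t x)) ->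
  cintegrable leb setT k -> cintegrable leb setT (fun x => k x * expi (t x)).
Proof.
move=> mt ck; under eq_fun do rewrite mulrC.
by apply: (@cintegrableMl _ _ _ _ _ _ _ _ 1) => // x _; rewrite normc_expi.
Qed.

Lemma ft_integrable s k p : cintegrable leb setT k ->
  cintegrable leb setT (fun x => k x * expi (s * x * p)).
Proof. by move=> ck; apply: cintegrable_expi => //; exact: cmeasurable_expiM. Qed.

Lemma normc_ft_le s k p : cintegrable leb setT k ->
  normc (ft s k p) <= 2 * Rintegral leb setT (fun x => normc (k x)).
Proof.
move=> ck; apply: (le_trans (normc_cintegral_le measurableT (ft_integrable s p ck))).
rewrite ler_pM2l// le_eqVlt; apply/orP; left; apply/eqP.
by apply: eq_Rintegral => x _; rewrite normcM normc_expi mulr1.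
Qed.

Lemma cmeasurable_fst (f : R -> R[i]) : cmeasurable (setT : set mR) f ->
  cmeasurable (setT : set (mR * mR)) (fun z => f z.1).
Proof. by move=> mf; apply: (cmeasurable_comp mf); exact: measurable_fst. Qed.

Lemma cmeasurable_snd (f : R -> R[i]) : cmeasurable (setT : set mR) f ->
  cmeasurable (setT : set (mR * mR)) (fun z => f z.2).
Proof. by move=> mf; apply: (cmeasurable_comp mf); exact: measurable_snd. Qed.

Lemma cmeasurable_expi2 s :
  cmeasurable (setT : set (mR * mR)) (fun z => expi (s * z.2 * z.1)).
Proof.
apply: cmeasurable_expi; apply: measurable_funM; last exact: measurable_fst.
by apply: measurable_funM; [exact: measurable_cst|exact: measurable_snd].
Qed.

Let setTX : ([set: mR] `*` [set: mR] = [set: mR * mR]).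
Proof. exact: setXTT. Qed.

Lemma cmeasurable_ft s k : cmeasurable (setT : set mR) k ->
  cmeasurable (setT : set mR) (ft s k).
Proof.
move=> mk.
apply: (@cmeasurable_cintegral1 _ _ mR mR R leb setT measurableT
  (fun z => k z.2 * expi (s * z.2 * z.1))).
rewrite setTX; apply: cmeasurableM; last exact: cmeasurable_expi2.
exact: cmeasurable_snd.
Qed.

(** The multiplication formula: Fubini for k(x) g(p) exp(i s x p), whose exponential is symmetric in
    x and p. *)
Lemma ft_mult s k g : cintegrable leb setT k -> cintegrable leb setT g ->
  cintegral leb setT (fun p => ft s k p * g p) =
  cintegral leb setT (fun x => k x * ft s g x).
Proof.
move=> ck cg; have [mk _] := ck; have [mg _] := cg.
pose F (z : R * R) := g z.1 * (k z.2 * expi (s * z.2 * z.1)).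
have mF : cmeasurable (setT : set (mR * mR)) F.
  apply: cmeasurableM; first exact: cmeasurable_fst.
  by apply: cmeasurableM; [exact: cmeasurable_snd|exact: cmeasurable_expi2].
have cF : cintegrable (leb \x leb)%E ([set: mR] `*` [set: mR]) F.
  rewrite setTX; split => //.
  have mnF : measurable_fun (setT : set (mR * mR)) (fun z => (normc (F z))%:E).
    by apply/measurable_EFinP; exact: measurable_normc.
  rewrite -setTX rect_tonelli1//; [|by rewrite setTX|by move=> z _; rewrite lee_fin normc_ge0].
  have -> : (\int[leb]_x \int[leb]_y (normc (F (x, y)))%:E =
    \int[leb]_x ((normc (g x))%:E * \int[leb]_y (normc (k y))%:E))%E.
    apply: eq_integral => x _; rewrite -ge0_integralZl_EFin ?normc_ge0//.
    - by apply: eq_integral => y _; rewrite /F/= !normcM normc_expi mulr1 EFinM.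
    - by move=> y _; rewrite lee_fin normc_ge0.
    - by apply/measurable_EFinP; exact: measurable_normc.
  rewrite ge0_integralZr//.
  - by rewrite lte_mul_pinfty ?integral_ge0//; [move=> x _; rewrite lee_fin normc_ge0|
      rewrite ge0_fin_numE ?(cg.2)// integral_ge0// => x _; rewrite lee_fin normc_ge0|exact: ck.2].
  - by apply/measurable_EFinP; exact: measurable_normc.
  - by move=> x _; rewrite lee_fin normc_ge0.
  - by apply: integral_ge0 => x _; rewrite lee_fin normc_ge0.
have := cfubini measurableT cF.
rewrite (_ : cintegral _ _ _ = cintegral leb setT (fun p => ft s k p * g p)); last first.
  apply: eq_cintegral => p _; by rewrite [RHS]mulrC -cintegralZ//; exact: ft_integrable.
move=> ->; apply: eq_cintegral => x _; rewrite -cintegralZ//; last exact: ft_integrable.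
by apply: eq_cintegral => p _; rewrite /F/= mulrCA (mulrAC s).
Qed.

Lemma ftD s f g p : cintegrable leb setT f -> cintegrable leb setT g ->
  ft s (fun x => f x + g x) p = ft s f p + ft s g p.
Proof.
move=> cf cg; rewrite /ft -cintegralD//; [|exact: ft_integrable..].
by apply: eq_cintegral => x _; rewrite mulrDl.
Qed.

Lemma ftZ s c f p : cintegrable leb setT f ->
  ft s (fun x => c * f x) p = c * ft s f p.
Proof.
move=> cf; rewrite /ft -cintegralZ//; last exact: ft_integrable.
by apply: eq_cintegral => x _; rewrite mulrA.
Qed.

End fourier_L1.

Lemma ccvg_Re (R : realType) (z : nat -> R[i]) a : ccvg z a ->
  (fun n => cRe (z n)) @ \oo --> cRe a.
Proof.
move=> za; apply/cvgrPdist_le => e e0.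
have [N _ h] := (cvgrPdist_le _ _).1 za _ e0; exists N => // n Nn; have := h n Nn.
rewrite sub0r normrN ger0_norm ?normc_ge0//; apply: le_trans.
by rewrite distrC -cReN -cReD cRe_le.
Qed.

Section plancherel_L1.
Context (R : realType).
Local Notation leb := (@lebesgue_measure R).
Local Notation mR := (measurableTypeR R).
Variable s : R.
Hypothesis s2pi : s ^+ 2 = (2 * pi) ^+ 2.
Implicit Types (p x y e t u : R) (f g k h : R -> R[i]).

Let s0 : s != 0.
Proof. by rewrite -sqrf_eq0 s2pi sqrf_eq0 mulf_neq0// gt_eqF// pi_gt0. Qed.

Let norm_s : `|s| = 2 * pi.
Proof.
have p0 : 0 <= 2 * pi :> R by rewrite mulr_ge0// pi_ge0.
by apply/eqP; rewrite -(@eqrXn2 _ 2)// real_normK ?num_real// s2pi.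
Qed.

Lemma cintegrable_abel e : 0 < e -> cintegrable leb setT (fun p => (abel e p)%:C).
Proof. by move=> e0; apply: cintegrableR => //; exact: integrable_abel. Qed.

Lemma poisson_le e t : 0 < e -> poisson e t <= 2 / e.
Proof.
move=> e0; rewrite /poisson ler_pdivrMr ?ltr_pwDl ?sqr_ge0 ?exprn_gt0//.
rewrite mulrDr (_ : 2 / e * e ^+ 2 = 2 * e); last by field; rewrite gt_eqF.
by rewrite lerDl mulr_ge0 ?sqr_ge0// divr_ge0// ltW.
Qed.

Lemma cmeasurable_poisson e : 0 < e ->
  cmeasurable (setT : set mR) (fun t => (poisson e (s * t))%:C).
Proof.
move=> e0; apply: cmeasurableR; apply: continuous_measurable_fun => x.
apply: (@continuous_comp _ _ _ (fun t => s * t) (poisson e)); last exact: continuous_poisson.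
by apply: cvgM; [exact: cvg_cst|exact: cvg_id].
Qed.

Lemma cintegrable_poissonM e k : 0 < e -> cintegrable leb setT k ->
  cintegrable leb setT (fun t => k t * (poisson e (s * t))%:C).
Proof.
move=> e0 ck; under eq_fun do rewrite mulrC.
apply: (@cintegrableMl _ _ _ _ _ _ _ _ (2 / e)) => //.
- exact: cmeasurable_poisson.
- by move=> t _; rewrite normcR ger0_norm ?poisson_ge0// poisson_le.
Qed.

Lemma ft_abel e x y : 0 < e ->
  ft s (fun p => (abel e p)%:C * expi (- (s * x * p))) y = (poisson e (s * (y - x)))%:C.
Proof.
move=> e0; rewrite -cintegral_abel_expi//; apply: eq_cintegral => p _.
by rewrite -mulrA -expiD; congr (_ * expi _); ring.
Qed.

(** Two applications of the multiplication formula: one moves the transform from k to the damped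
    conjugate of [ft s k], the other moves it onto the damped exponential, whose transform is a
    translated Poisson kernel. *)
Lemma abel_sum e k : 0 < e -> cintegrable leb setT k ->
  cintegral leb setT (fun p => (abel e p * normc (ft s k p) ^+ 2)%:C) =
  cintegral leb setT (fun x => k x * conjc (cintegral leb setT
     (fun t => k (x - t) * (poisson e (s * t))%:C))).
Proof.
move=> e0 ck; have [mk _] := ck.
pose g p := conjc (ft s k p) * (abel e p)%:C.
have cg : cintegrable leb setT g.
  apply: (@cintegrableMl _ _ _ _ _ _ _ _ (2 * Rintegral leb setT (fun x => normc (k x)))) => //.
  - by apply: cmeasurableJ; exact: cmeasurable_ft.
  - by move=> p _; rewrite normc_conj; exact: normc_ft_le.
  - exact: cintegrable_abel.
transitivity (cintegral leb setT (fun p => ft s k p * g p)).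
  by apply: eq_cintegral => p _; rewrite /g mulrA mulcJ -rmorphM/= mulrC.
rewrite (ft_mult s ck cg); apply: eq_cintegral => x _.
suff -> : ft s g x = conjc (cintegral leb setT
    (fun t => k (x - t) * (poisson e (s * t))%:C)) by [].
pose a p := (abel e p)%:C * expi (- (s * x * p)).
have ca : cintegrable leb setT a.
  apply: cintegrable_expi; last exact: cintegrable_abel.
  have := cmeasurable_expiM (- s) x; under eq_fun do rewrite mulNr mulNr -mulrA (mulrC _ x) mulrA.
  by [].
transitivity (conjc (cintegral leb setT (fun p => ft s k p * a p))).
  rewrite -cintegralJ//; last first.
    apply: (@cintegrableMl _ _ _ _ _ _ _ _ (2 * Rintegral leb setT (fun x => normc (k x)))) => //.
    - exact: cmeasurable_ft.
    - by move=> p _; exact: normc_ft_le.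
  apply: eq_cintegral => p _; rewrite /g /a !conjcM conjc_real -expiN opprK mulrA.
  by congr (_ * expi _); ring.
have cf : cintegrable leb setT (fun y => k y * (poisson e (s * (y - x)))%:C).
  under eq_fun do rewrite mulrC.
  apply: (@cintegrableMl _ _ _ _ _ _ _ _ (2 / e)) => //.
  - have := cmeasurable_affine 1 (- x) (cmeasurable_poisson e0).
    by under eq_fun do rewrite mul1r.
  - by move=> t _; rewrite normcR ger0_norm ?poisson_ge0// poisson_le.
have N1 : (-1 : R) != 0 by rewrite oppr_eq0 oner_neq0.
have := cintegral_affine x N1 cf; rewrite normrN normr1 invr1 mul1r => h.
rewrite (ft_mult s ck ca); under eq_cintegral do rewrite ft_abel//.
rewrite -h; apply: (congr1 conjc); apply: eq_cintegral => t _; rewrite mulN1r addrC; congr (_ * (_)%:C).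
by rewrite addrAC subrr add0r mulrN poissonN.
Qed.

Definition autocorr k t := inner leb setT k (fun x => k (x - t)).

Lemma L2_shift k t : L2 leb setT k -> L2 leb setT (fun x => k (x - t)).
Proof.
by move=> Lk; have := L2_affine (- t) (oner_neq0 R) Lk; under eq_fun do rewrite mul1r.
Qed.

Lemma sqnorm_shift k t : L2 leb setT k ->
  sqnorm leb setT (fun x => k (x - t)) = sqnorm leb setT k.
Proof.
move=> [mk _]; have := sqnorm_affine (- t) (oner_neq0 R) mk.
by under eq_fun do rewrite mul1r; rewrite normr1 invr1 mul1e.
Qed.

Lemma normc_autocorr_le k t : L2 leb setT k ->
  normc (autocorr k t) <= 2 * fine (sqnorm leb setT k).
Proof.
move=> Lk; apply: (le_trans (normc_inner_le measurableT Lk (L2_shift t Lk))).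
by rewrite /nrm sqnorm_shift// -expr2 sqr_sqrtr// fine_ge0 ?sqnorm_ge0.
Qed.

Let mminus : measurable_fun (setT : set (mR * mR)) ((fun z => z.1 - z.2) : mR * mR -> mR).
Proof. by apply: measurable_funB; [exact: measurable_fst|exact: measurable_snd]. Qed.

Let setTX : ([set: mR] `*` [set: mR] = [set: mR * mR]).
Proof. exact: setXTT. Qed.

Let cmeasurable_corr k : cmeasurable (setT : set mR) k ->
  cmeasurable (setT : set (mR * mR)) (fun z => k z.1 * conjc (k (z.1 - z.2))).
Proof.
move=> mk; apply: cmeasurableM; first exact: cmeasurable_fst.
apply: cmeasurableJ.
exact: (@cmeasurable_comp _ _ _ mR R setT k (fun z : mR * mR => z.1 - z.2) mk mminus).
Qed.

Lemma cmeasurable_autocorr k : cmeasurable (setT : set mR) k ->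
  cmeasurable (setT : set mR) (autocorr k).
Proof.
move=> mk.
apply: (@cmeasurable_cintegral2 _ _ mR mR R leb setT measurableT
  (fun z => k z.1 * conjc (k (z.1 - z.2)))).
by rewrite setTX; exact: cmeasurable_corr.
Qed.

Lemma integrable_poisson e : 0 < e ->
  leb.-integrable setT (EFin \o (fun t => poisson e (s * t))).
Proof.
move=> e0.
have se : s / e != 0 by rewrite mulf_neq0// invr_eq0 gt_eqF.
have := integrable_affine 0 se (integrable_poisson1 R) => h.
have {}h := integrableZl measurableT e^-1 h; apply: eq_integrable h => // t _ /=.
by rewrite addr0 -EFinM (poissonM _ e0); congr (_ * poisson _ _)%:E; ring.
Qed.

Lemma Rintegral_poisson1 : Rintegral leb setT (fun t => poisson 1 (s * t)) = 1.
Proof.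
have := Rintegral_affine 0 s0 (integrable_poisson1 R).
under eq_Rintegral do rewrite addr0.
move=> ->; rewrite {1}/Rintegral integral_poisson1 norm_s/= mulVf//.
by rewrite mulf_neq0// gt_eqF// pi_gt0.
Qed.

Lemma cintegrable_autocorrM e k : 0 < e -> L2 leb setT k ->
  cintegrable leb setT (fun t => autocorr k t * (poisson e (s * t))%:C).
Proof.
move=> e0 Lk; apply: (@cintegrableMl _ _ _ _ _ _ _ _ (2 * fine (sqnorm leb setT k))) => //.
- by apply: cmeasurable_autocorr; exact: L2_cmeasurable Lk.
- by move=> t _; exact: normc_autocorr_le.
- by apply: cintegrableR => //; exact: integrable_poisson.
Qed.

(** Integrating in x first produces the autocorrelation; the substitution t = e u then replaces the
    concentrating kernel by the fixed one [poisson 1]. *)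
Lemma abel_sum_autocorr e k : 0 < e -> cintegrable leb setT k -> L2 leb setT k ->
  cintegral leb setT (fun p => (abel e p * normc (ft s k p) ^+ 2)%:C) =
  cintegral leb setT (fun u => autocorr k (e * u) * (poisson 1 (s * u))%:C).
Proof.
move=> e0 ck Lk; rewrite abel_sum//; have [mk _] := ck.
pose F (z : R * R) := k z.1 * conjc (k (z.1 - z.2)) * (poisson e (s * z.2))%:C.
have mF : cmeasurable (setT : set (mR * mR)) F.
  apply: cmeasurableM; first exact: cmeasurable_corr.
  exact: (cmeasurable_snd (cmeasurable_poisson e0)).
have cF : cintegrable (leb \x leb)%E ([set: mR] `*` [set: mR]) F.
  rewrite setTX; split => //.
  have mnF : measurable_fun (setT : set (mR * mR)) (fun z => (normc (F z))%:E).
    by apply/measurable_EFinP; exact: measurable_normc.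
  rewrite -setTX rect_tonelli2//; [|by rewrite setTX|by move=> z _; rewrite lee_fin normc_ge0].
  have ip := integrable_poisson e0; have /integrableP[mp _] := ip.
  pose N := (2 * fine (sqnorm leb setT k)).
  apply: (@le_lt_trans _ _ (\int[leb]_t (N * poisson e (s * t))%:E)%E); last first.
    have := integrableZl measurableT N ip => /integrableP[_].
    apply: le_lt_trans; apply: ge0_le_integral => //.
    + by move=> t _; rewrite lee_fin mulr_ge0 ?poisson_ge0// mulr_ge0// fine_ge0 ?sqnorm_ge0.
    + by apply/measurable_EFinP; apply: measurable_funM => //; exact/measurable_EFinP.
    + by apply: measurableT_comp => //; apply: measurable_funeM.
    + by move=> t _; rewrite lee_fin ler_norm.
  apply: ge0_le_integral => //.
  + by move=> t _; apply: integral_ge0 => x _; rewrite lee_fin normc_ge0.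
  + have mnF' : measurable_fun ([set: mR] `*` [set: mR]) (fun z => (normc (F z))%:E).
      by rewrite setTX.
    apply: (@measurable_rect_tonelli2 _ _ mR mR R leb setT measurableT _ mnF') => z _.
    by rewrite lee_fin normc_ge0.
  + by apply/measurable_EFinP; apply: measurable_funM => //; exact/measurable_EFinP.
  + move=> t _; have Lt := L2_shift t Lk.
    (* |k(x) k(x - t)| <= |k(x)|^2 + |k(x - t)|^2, whose integral [N] does not depend on t. *)
    have iN : (\int[leb]_x (normc (k x) ^+ 2 + normc (k (x - t)) ^+ 2)%:E = N%:E)%E.
      under eq_integral do rewrite EFinD.
      rewrite ge0_integralD//; try by move=> x _; rewrite lee_fin sqr_ge0.
      * rewrite -[X in (X + _)%E]/(sqnorm leb setT k).
        rewrite -[X in (_ + X)%E]/(sqnorm leb setT (fun x => k (x - t))) sqnorm_shift//.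
        by rewrite -(fineK (sqnorm_fin Lk)) -EFinD /N; congr _%:E; ring.
      * exact: emeasurable_normc_sqr.
      * by apply: emeasurable_normc_sqr; exact: L2_cmeasurable Lt.
    rewrite EFinM -iN muleC -ge0_integralZl_EFin ?poisson_ge0//.
    * apply: ge0_le_integral => //.
      - by move=> x _; rewrite lee_fin normc_ge0.
      - apply/measurable_EFinP; apply: measurable_normc.
        have mF' : cmeasurable ([set: mR] `*` [set: mR]) F by rewrite setTX.
        exact: (@cmeasurable_section2 _ _ mR mR R setT measurableT F t mF').
      - apply: measurable_funeM; apply/measurable_EFinP; apply: measurable_funD.
          exact: measurable_normc_sqr.
        by apply: measurable_normc_sqr; exact: L2_cmeasurable Lt.
      - move=> x _; rewrite -EFinM lee_fin /F/= !normcM normc_conj normcR (ger0_norm (poisson_ge0 _ _))//.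
        rewrite mulrC ler_wpM2l ?poisson_ge0//.
        have := normc_ge0 (k x); have := normc_ge0 (k (x - t)).
        by move: (normc _) (normc _) => a b; have := sqr_ge0 (a - b); nra.
    * by move=> x _; rewrite lee_fin addr_ge0 ?sqr_ge0.
    * apply/measurable_EFinP; apply: measurable_funD; first exact: measurable_normc_sqr.
      by apply: measurable_normc_sqr; exact: L2_cmeasurable Lt.
transitivity (cintegral leb setT (fun x => cintegral leb setT (fun t => F (x, t)))).
  apply: eq_cintegral => x _.
  have cx : cintegrable leb setT (fun t => k (x - t) * (poisson e (s * t))%:C).
    apply: cintegrable_poissonM => //.
    have N1 : (-1 : R) != 0 by rewrite oppr_eq0 oner_neq0.
    by have := cintegrable_affine x N1 ck; under eq_fun do rewrite mulN1r addrC.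
  rewrite -cintegralJ// -cintegralZ//; last exact: cintegrableJ.
  by apply: eq_cintegral => t _; rewrite /F/= conjcM conjc_real mulrA.
rewrite (cfubini measurableT cF).
have e0' : e != 0 by rewrite gt_eqF.
have := cintegral_affine 0 e0' (cintegrable_autocorrM e0 Lk).
rewrite gtr0_norm// => h.
transitivity (cintegral leb setT (fun t => autocorr k t * (poisson e (s * t))%:C)).
  apply: eq_cintegral => t _; rewrite mulrC -cintegralZ//.
    by apply: eq_cintegral => x _; rewrite /F/= mulrC.
  by apply: inner_cintegrable => //; exact: L2_shift.
have -> : cintegral leb setT (fun t => autocorr k t * (poisson e (s * t))%:C) =
  e%:C * cintegral leb setT (fun x => autocorr k (e * x + 0) * (poisson e (s * (e * x + 0)))%:C).
  by rewrite h mulrA -rmorphM/= mulfV// mul1r.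
rewrite -cintegralZ//.
  apply: eq_cintegral => u _; rewrite addr0 mulrCA -rmorphM/=; congr (_ * (_)%:C).
  rewrite (poissonM _ e0) mulVKf//; congr poisson.
  by field.
exact: (cintegrable_affine 0 e0' (cintegrable_autocorrM e0 Lk)).
Qed.

(** The kernel [poisson 1 (s * u)] does not depend on n and has integral 1, so dominated convergence
    applies; pointwise, [autocorr k] is continuous at 0 because translations are continuous in
    L_2. *)
Lemma abel_sum_cvg k : cintegrable leb setT k -> L2 leb setT k ->
  ccvg (fun n => cintegral leb setT
    (fun p => (abel (n.+1%:R^-1) p * normc (ft s k p) ^+ 2)%:C))
    (fine (sqnorm leb setT k))%:C.
Proof.
move=> ck Lk; have [mk _] := ck.
under eq_fun do rewrite abel_sum_autocorr ?invr_gt0//.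
have -> : (fine (sqnorm leb setT k))%:C =
    cintegral leb setT (fun u => autocorr k 0 * (poisson 1 (s * u))%:C).
  rewrite cintegralZ//; last by apply: cintegrableR => //; exact: integrable_poisson.
  rewrite cintegralR//; last exact: integrable_poisson.
  rewrite Rintegral_poisson1 mulr1 -innerff// /autocorr.
  by congr inner; apply/funext => x; rewrite subr0.
pose N := 2 * fine (sqnorm leb setT k).
have ip := integrable_poisson (@ltr01 R).
have mp := cmeasurable_poisson (@ltr01 R).
have mA := cmeasurable_autocorr mk.
have bound (z : R[i]) u : normc z <= N -> normc (z * (poisson 1 (s * u))%:C) <= N * poisson 1 (s * u).
  move=> zN; rewrite normcM normcR (ger0_norm (poisson_ge0 _ _))//.
  by rewrite ler_wpM2r// poisson_ge0.
apply: (@cintegral_dominated_cvg _ mR R leb setT measurableT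
  (fun n u => autocorr k (n.+1%:R^-1 * u) * (poisson 1 (s * u))%:C)
  (fun u => autocorr k 0 * (poisson 1 (s * u))%:C)
  (fun u => N * poisson 1 (s * u))) => //.
- move=> n; apply: cmeasurableM => //.
  by have := cmeasurable_affine n.+1%:R^-1 0 mA; under eq_fun do rewrite addr0.
- by apply: cmeasurableM => //; exact: cmeasurable_cst.
- exact: (integrableZl measurableT N ip).
- by move=> n u _; apply: bound; exact: normc_autocorr_le.
- by move=> u _; apply: bound; exact: normc_autocorr_le.
move=> u _.
have c0 : (fun n => n.+1%:R^-1 * u) @ \oo --> (0 : R).
  rewrite -[X in _ --> X](mul0r u); apply: cvgM; last exact: cvg_cst.
  exact: cvg_harmonic.
have ca : ccvg (fun n => autocorr k (n.+1%:R^-1 * u)) (autocorr k 0).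
  apply: inner_cvg => //.
  - by move=> n; exact: L2_shift.
  - exact: L2_shift.
  - exact: L2cvg_cst.
  - rewrite (_ : (fun x => k (x - 0)) = k); last by apply/funext => x; rewrite subr0.
    exact: translation_L2.
apply: (@ccvg_le _ _ _ (fun n => normc (autocorr k (n.+1%:R^-1 * u) - autocorr k 0) * poisson 1 (s * u))).
  by move=> n; rewrite -mulrBl normcM normcR (ger0_norm (poisson_ge0 _ _)).
rewrite -[X in _ --> X](mul0r (poisson 1 (s * u))).
by apply: cvgM; [exact: ca|exact: cvg_cst].
Qed.

(* The Abel means of [normc (ft s k) ^+ 2] are the Poisson means of the
   autocorrelation of [k], which is continuous with value [sqnorm k] at 0. *)
Lemma plancherel_L1 k : cintegrable leb setT k -> L2 leb setT k ->
  sqnorm leb setT (ft s k) = sqnorm leb setT k.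
Proof.
move=> ck Lk; have [mk _] := ck.
have mft := cmeasurable_ft s mk.
pose e (n : nat) : R := n.+1%:R^-1.
have e0 n : 0 < e n by rewrite invr_gt0.
pose f n p := (abel (e n) p * normc (ft s k p) ^+ 2).
have f0 n p : 0 <= f n p by rewrite mulr_ge0 ?abel_ge0 ?sqr_ge0.
have mf n : measurable_fun (setT : set mR) (EFin \o f n).
  apply/measurable_EFinP; apply: measurable_funM; first exact: measurable_abel.
  exact: measurable_normc_sqr.
pose M := 2 * Rintegral leb setT (fun x => normc (k x)).
have if_ n : leb.-integrable setT (EFin \o f n).
  have iM : leb.-integrable setT (EFin \o (fun p => M ^+ 2 * abel (e n) p)).
    exact: (integrableZl measurableT (M ^+ 2) (integrable_abel (e0 n))).
  apply: le_integrable iM => // p _ /=.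
  rewrite lee_fin (ger0_norm (f0 n p)) ger0_norm; last by rewrite mulr_ge0 ?sqr_ge0 ?abel_ge0.
  rewrite /f mulrC ler_wpM2r ?abel_ge0//.
  by rewrite lerXn2r ?nnegrE ?normc_ge0 ?normc_ft_le// (le_trans (normc_ge0 _) (normc_ft_le s p ck)).
(* The Abel factors increase to 1, so monotone convergence applies before the limit is known to be
   finite. *)
have c1 : (fun n => \int[leb]_p (f n p)%:E)%E @ \oo --> sqnorm leb setT (ft s k).
  have Lp p : limn (fun n => (f n p)%:E) = (normc (ft s k p) ^+ 2)%:E.
    apply/cvg_lim => //; apply: cvg_EFin; first exact: nearW.
    rewrite -[X in _ --> X]mul1r; apply: cvgM; last exact: cvg_cst.
    rewrite -(@expR0 R) -oppr0 -[in X in _ --> X](mul0r `|p|).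
    apply: (@cvg_comp _ _ _ (fun n => - (e n * `|p|)) expR); last exact: continuous_expR.
    apply: cvgN; apply: cvgM; [exact: cvg_harmonic|exact: cvg_cst].
  have -> : sqnorm leb setT (ft s k) = (\int[leb]_p limn (fun n => (f n p)%:E))%E.
    by apply: eq_integral => p _; rewrite Lp.
  apply: (@cvg_monotone_convergence _ _ _ leb setT measurableT (fun n => EFin \o f n) mf).
    by move=> n p _; rewrite lee_fin.
  move=> p _ m n mn; rewrite lee_fin ler_wpM2r ?sqr_ge0// /abel ler_expR lerN2 ler_wpM2r//.
  by rewrite lef_pV2 ?posrE// ler_nat.
have c2 : (fun n => \int[leb]_p (f n p)%:E)%E @ \oo --> sqnorm leb setT k.
  rewrite -(fineK (sqnorm_fin Lk)); apply: cvg_EFin.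
    by apply: nearW => n; exact: (integrable_fin_num measurableT (if_ n)).
  have c := abel_sum_cvg ck Lk.
  apply: cvg_trans (ccvg_Re c); apply: near_eq_cvg; apply: nearW => n.
  by rewrite cintegralR//; exact: if_.
exact: (cvg_unique _ c1 c2).
Qed.

End plancherel_L1.

(** * Completeness of L_2 *)

Lemma geometric_increments_cvg (R : realType) (u : nat -> R) (C : R) :
  (forall j, `|u j.+1 - u j| <= C * 2^-1 ^+ j) -> cvgn u.
Proof.
move=> uC; have C0 : 0 <= C.
  by have := le_trans (normr_ge0 _) (uC 0%N); rewrite expr0 mulr1.
have : cvgn (series (telescope u)).
  apply: normed_cvg; apply: (@series_le_cvg _ _ (geometric C 2^-1)) => //.
  - by move=> n; exact: normr_ge0.
  - by move=> n; rewrite /geometric/= mulr_ge0// exprn_ge0.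
  - by apply: is_cvg_geometric_series; rewrite ger0_norm// invf_lt1// ltr1n.
rewrite telescopeK => /cvg_ex[l ul]; apply/cvg_ex; exists (l + u 0%N).
rewrite [X in X @ _](_ : u = (fun n => (u n - u 0%N) + u 0%N)); last by apply/funext => n; rewrite subrK.
by apply: cvgD => //; exact: cvg_cst.
Qed.

Lemma ereal_cvg0 (R : realType) (u : nat -> \bar R) : (forall n, 0 <= u n)%E ->
  (forall e : R, 0 < e -> exists M, forall m, (M <= m)%N -> (u m <= e%:E)%E) ->
  u @ \oo --> 0%E.
Proof.
move=> u0 h; apply: cvg_EFin.
  have [M hM] := h 1 ltr01; exists M => // m /= /hM um.
  by rewrite ge0_fin_numE// (le_lt_trans um)// ltry.
apply/cvgrPdist_le => e e0; have [M hM] := h e e0; exists M => // m /= /hM um.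
rewrite sub0r normrN ger0_norm ?fine_ge0// -lee_fin fineK//.
by rewrite ge0_fin_numE// (le_lt_trans um)// ltry.
Qed.

Section L2_complete.
Context d (T : measurableType d) (R : realType).
Variables (mu : {measure set T -> \bar R}) (D : set T).
Hypothesis mD : measurable D.

(* Riesz-Fischer: along a subsequence with increments of squared norm at most
   [8^-j] the weighted sum [\sum_j 4^j |f_(j+1) - f_j|^2] is finite almost
   everywhere, which forces pointwise convergence there. *)
Lemma L2_complete (fs : nat -> T -> R[i]) : (forall n, L2 mu D (fs n)) ->
  (forall e : R, 0 < e -> exists N, forall m n, (N <= m)%N -> (N <= n)%N ->
    (sqnorm mu D (fun x => fs m x - fs n x)%R <= e%:E)%E) ->
  exists2 g, L2 mu D g & L2cvg mu D fs g.
Proof.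
move=> Lfs hC.
have p8 j : 0 < 8^-1 ^+ j :> R by rewrite exprn_gt0.
have [N hN] := choice (fun j : nat => hC (8^-1 ^+ j) (p8 j)).
(* Partial sums of the N i + 1 make the subsequence increasing while keeping [N j] <= [n j]. *)
pose n j := (\sum_(i < j.+1) (N i).+1)%N.
have nS j : n j.+1 = (n j + (N j.+1).+1)%N by rewrite /n big_ord_recr.
have nN j : (N j <= n j)%N by rewrite /n big_ord_recr/= (leq_trans (leqnSn _))// leq_addl.
have n_le j k : (j <= k)%N -> (n j <= n k)%N.
  move=> jk; rewrite -(subnKC jk); elim: (k - j)%N => [|m IH]; first by rewrite addn0.
  by rewrite addnS nS (leq_trans IH)// leq_addr.
have n_ge j : (j <= n j)%N.
  by elim: j => // j IH; rewrite nS addnS ltnS (leq_trans IH)// leq_addr.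
pose h j x := normc (fs (n j.+1) x - fs (n j) x) ^+ 2.
have mfs j : cmeasurable D (fs j) by exact: L2_cmeasurable (Lfs j).
have mh j : measurable_fun D (h j).
  by apply: measurable_normc_sqr; exact: cmeasurableB.
have h0 j x : 0 <= h j x by exact: sqr_ge0.
have ih j : (\int[mu]_(x in D) (h j x)%:E <= (8^-1 ^+ j)%:E)%E.
  by apply: hN; [rewrite (leq_trans (nN j))// n_le|exact: nN].
pose w j x := (4 ^+ j * h j x)%:E.
have w0 j x : (0 <= w j x)%E by rewrite lee_fin mulr_ge0// exprn_ge0.
have mw j : measurable_fun D (w j).
  by apply/measurable_EFinP; apply: measurable_funM.
pose G x := (\sum_(j <oo) w j x)%E.
have mG : measurable_fun D G by apply: ge0_emeasurable_sum => // k x _ _; exact: w0.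
have intG : (\int[mu]_(x in D) G x < +oo)%E.
  rewrite integral_nneseries//.
  apply: (@le_lt_trans _ _ (\sum_(j <oo) (2 / (2 ^ (j + 1))%:R)%:E)%E); last first.
    by rewrite (cvg_lim _ (@cvg_geometric_eseries_half R 2 0))// ltry.
  apply: lee_nneseries => [j _ _|j _]; first exact: integral_ge0.
  have -> : (\int[mu]_(x in D) w j x = (4 ^+ j)%:E * \int[mu]_(x in D) (h j x)%:E)%E.
    rewrite -ge0_integralZl_EFin ?exprn_ge0//; first by move=> x _; rewrite lee_fin.
    exact/measurable_EFinP.
  apply: (le_trans (lee_wpmul2l _ (ih j))); first by rewrite lee_fin exprn_ge0.
  rewrite -EFinM lee_fin -exprMn addn1 natrX exprS invfM mulrA mulfV// mul1r.
  by rewrite -exprVn (_ : 4 * 8^-1 = 2^-1 :> R)//; field.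
pose A := D `&` [set x | (G x < +oo)%E].
have mA : measurable A by exact: emeasurable_fun_infty_o.
have aeA : \forall x \ae mu, D x -> A x.
  have iG : mu.-integrable D G.
    apply/integrableP; split => //.
    by under eq_integral do rewrite gee0_abs ?nneseries_ge0//.
  apply: ae_impl (integrable_ae mD iG) => x + Dx => /(_ Dx) Gf; split => //=.
  by rewrite ltey_eq Gf.
(* [p] stands for the real or the imaginary part. Since 4^j h_j <= G, its increments are at most
   sqrt G times 2^-j. *)
have cvA (p : R[i] -> R) x : A x -> (forall z, `|p z| <= normc z) ->
    {morph p : a b / a - b} -> cvgn (fun j => p (fs (n j) x)).
  move=> [Dx Gx] pz pB.
  have Gf : G x \is a fin_num by rewrite ge0_fin_numE// nneseries_ge0.
  apply: (@geometric_increments_cvg _ _ (Num.sqrt (fine (G x)))) => j.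
  rewrite -pB; apply: (le_trans (pz _)).
  have e : normc (fs (n j.+1) x - fs (n j) x) = Num.sqrt (h j x).
    by rewrite sqrtr_sqr ger0_norm// normc_ge0.
  have -> : 2^-1 ^+ j = Num.sqrt (4^-1 ^+ j) :> R.
    rewrite (_ : 4^-1 = 2^-1 ^+ 2 :> R); last by field.
    by rewrite exprAC sqrtr_sqr ger0_norm// exprn_ge0.
  rewrite e -sqrtrM ?fine_ge0 ?nneseries_ge0//; apply: ler_wsqrtr.
  rewrite exprVn ler_pdivlMr ?exprn_gt0// mulrC.
  rewrite -lee_fin fineK//.
  have H := @nneseries_lim_ge R (fun k => w k x) xpredT 0%N j.+1 (fun k _ _ => w0 k x).
  apply: le_trans H; rewrite big_nat_recr//= leeDr// sume_ge0//.
pose re x := limn (fun j => if x \in A then cRe (fs (n j) x) else 0).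
pose im x := limn (fun j => if x \in A then cIm (fs (n j) x) else 0).
pose g x := re x +i* im x.
pose k j x := if x \in A then fs (n j) x else 0.
have mk j : cmeasurable D (k j).
  rewrite (_ : k j = fun x => (\1_A x)%:C * fs (n j) x); last first.
    by apply/funext => x; rewrite /k indicE; case: ifP => _; rewrite ?mul1r ?mul0r.
  by apply: cmeasurableM => //; apply: cmeasurableR; exact: measurable_indic.
have cre x : (fun j => cRe (k j x)) @ \oo --> re x.
  rewrite /k /re; have [|_] := boolP (x \in A); last exact: is_cvg_cst.
  rewrite inE => Ax; apply: (cvA (@complex.Re R)) => //; first exact: cRe_le.
  by move=> a b; rewrite cReD cReN.
have cim x : (fun j => cIm (k j x)) @ \oo --> im x.
  rewrite /k /im; have [|_] := boolP (x \in A); last exact: is_cvg_cst.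
  rewrite inE => Ax; apply: (cvA (@complex.Im R)) => //; first exact: cIm_le.
  by move=> a b; rewrite cImD cImN.
have mg : cmeasurable D g.
  split; [apply: (measurable_fun_cvg (h := fun j x => cRe (k j x)))
         |apply: (measurable_fun_cvg (h := fun j x => cIm (k j x)))].
  - by move=> j; case: (mk j).
  - by move=> x _; exact: cre.
  - by move=> j; case: (mk j).
  - by move=> x _; exact: cim.
(* Fatou along the subsequence carries the Cauchy bound to the limit [g]; [maxn j M] keeps the index
   beyond M. *)
have key e : 0 < e -> exists M, forall m, (M <= m)%N ->
    (sqnorm mu D (fun x => fs m x - g x)%R <= e%:E)%E.
  move=> e0; have [M hM] := hC e e0; exists M => m Mm.
  pose q j x := (normc (fs m x - k j x) ^+ 2)%:E.
  have cq x : (fun j => q j x) @ \oo --> (normc (fs m x - g x) ^+ 2)%:E.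
    apply: cvg_EFin; first exact: nearW.
    under eq_cvg do rewrite /= normc_sqr !cReD !cImD !cReN !cImN.
    rewrite normc_sqr !cReD !cImD !cReN !cImN.
    by apply: cvgD; rewrite !expr2; apply: cvgM; apply: cvgB => //; exact: cvg_cst.
  rewrite /sqnorm (_ : (\int[mu]_(x in D) _)%E =
      (\int[mu]_(x in D) limn_einf (fun j => q j x))%E); last first.
    apply: eq_integral => x _; rewrite is_cvg_limn_einfE; last by apply/cvg_ex; eexists; exact: cq.
    by apply/esym/cvg_lim => //; exact: cq.
  apply: le_trans (fatou mu mD _ _) _ => //.
  - by move=> j; apply: emeasurable_normc_sqr; exact: cmeasurableB.
  - by move=> j x _; rewrite lee_fin sqr_ge0.
  rewrite limn_einf_lim; apply: lime_le; first exact: is_cvg_einfs.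
  near=> j.
  apply: ereal_inf_le; exists (\int[mu]_(x in D) q (maxn j M) x)%E.
    by exists (maxn j M) => //=; rewrite leq_maxl.
  have -> : (\int[mu]_(x in D) q (maxn j M) x = sqnorm mu D (fun x => fs m x - fs (n (maxn j M)) x)%R)%E.
    apply: ae_eq_integral => //.
    + by apply: emeasurable_normc_sqr; exact: cmeasurableB.
    + by apply: emeasurable_normc_sqr; exact: cmeasurableB.
    + apply: ae_impl aeA => x + Dx => /(_ Dx) Ax.
      by rewrite /q /k ifT// inE.
  by apply: hM => //; rewrite (leq_trans (leq_maxr j M))// n_ge.
have cg : L2cvg mu D fs g.
  by apply: ereal_cvg0 => // m; exact: sqnorm_ge0.
exists g => //; exact: (L2cvg_L2 mD mg Lfs cg).
Unshelve. all: by end_near.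
Qed.

End L2_complete.

(** * The Fourier transform on L_2 *)

Section fourier_L2.
Context (R : realType).
Local Notation leb := (@lebesgue_measure R).
Local Notation mR := (measurableTypeR R).
Implicit Types (p x y e t u v : R) (f g k h : R -> R[i]).

Definition trunc n f x : R[i] := if `|x| <= n%:R then f x else 0.

Let ms : R := - (2 * pi).

Let ms2 : ms ^+ 2 = (2 * pi) ^+ 2. Proof. by rewrite sqrrN. Qed.

Lemma truncE n f : trunc n f = fun x => (if `|x| <= n%:R then 1 else 0) * f x.
Proof. by apply/funext => x; rewrite /trunc; case: ifP; rewrite ?mul1r ?mul0r. Qed.

Lemma cmeasurable_one_trunc n :
  cmeasurable (setT : set mR) (fun x => if `|x| <= n%:R then 1 else 0 : R[i]).
Proof.
have m1 : measurable_fun (setT : set mR) (cutoff n (cst 1 : R -> R)).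
  by apply: measurable_cutoff; exact: measurable_cst.
rewrite (_ : (fun x => _) = fun x => (cutoff n (cst 1 : R -> R) x)%:C).
  exact: cmeasurableR.
by apply/funext => x; rewrite /cutoff; case: ifP.
Qed.

Lemma cmeasurable_trunc n f : cmeasurable (setT : set mR) f ->
  cmeasurable (setT : set mR) (trunc n f).
Proof.
move=> mf; rewrite truncE.
by apply: cmeasurableM => //; exact: cmeasurable_one_trunc.
Qed.

Lemma L2_trunc n f : L2 leb setT f -> L2 leb setT (trunc n f).
Proof.
move=> Lf; rewrite truncE.
apply: (@L2Ml _ mR R leb setT measurableT _ f 1) => //.
  exact: cmeasurable_one_trunc.
by move=> x _; case: ifP => _; rewrite ?normc1 ?normc0.
Qed.

Lemma L2_one_trunc n : L2 leb setT (fun x => if `|x| <= n%:R then 1 else 0 : R[i]).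
Proof.
have i1 := @integrable_indic_itv R (- n%:R) n%:R true false.
apply: (@L2_le _ mR R leb setT measurableT _ _ (cmeasurable_one_trunc n) i1) => x _ /=.
rewrite indicE mem_setE in_itv/= -ler_norml; case: ifP => _.
  by rewrite normc1 expr1n.
by rewrite normc0 expr0n.
Qed.

Lemma cintegrable_trunc n f : L2 leb setT f -> cintegrable leb setT (trunc n f).
Proof.
move=> Lf; rewrite truncE.
by apply: (L2M_cintegrable measurableT) => //; exact: L2_one_trunc.
Qed.

Lemma L2cvg_trunc f : L2 leb setT f -> L2cvg leb setT (fun n => trunc n f) f.
Proof.
move=> Lf; have := cutoff_cvg (L2_integrable Lf); apply: cvg_trans.
apply: near_eq_cvg; apply: nearW => n; apply: eq_integral => x _ /=.
rewrite /trunc /cutoff; case: ifP => _; first by rewrite !subrr normr0 normc0 expr0n.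
by rewrite !sub0r normrN ger0_norm ?sqr_ge0// normcN.
Qed.

Lemma fourier_truncE f n xi : fourier_trunc f n xi = ft ms (trunc n f) xi.
Proof.
have e (p : R[i] -> R) : p 0 = 0 -> Rintegral leb `[- n%:R, n%:R]%classic
    (fun x => p (f x * expi (- (2 * pi * x * xi)))) =
  Rintegral leb setT (fun x => p (trunc n f x * expi (ms * x * xi))).
  move=> p0; rewrite Rintegral_mkcond; apply: eq_Rintegral => x _.
  rewrite patchE mem_setE in_itv/= -ler_norml /trunc; case: ifP => _.
    by rewrite /ms !mulNr.
  by rewrite mul0r p0.
by apply: complex_eqP; [exact: (e (@complex.Re R))|exact: (e (@complex.Im R))].
Qed.

Lemma l2norm_cvg0P (fs : nat -> R -> R[i]) :
  (fun n => l2norm leb setT (fs n)) @ \oo --> 0%E <->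
  (fun n => sqnorm leb setT (fs n)) @ \oo --> 0%E.
Proof.
split=> h.
  apply: ereal_cvg0 => [n|e e0]; first exact: sqnorm_ge0.
  have /fine_cvgP[[N1 _ h1] /cvgrPdist_le h2] := h.
  have se0 : 0 < Num.sqrt e by rewrite sqrtr_gt0.
  have [N2 _ h3] := h2 _ se0.
  exists (maxn N1 N2) => m; rewrite geq_max => /andP[N1m N2m].
  have := h3 m N2m; have := h1 m N1m => /= f1.
  rewrite sub0r normrN ger0_norm ?fine_ge0 ?sqrte_ge0// => le.
  rewrite -l2norm_sqr -(fineK f1) -EFin_expe lee_fin -(sqr_sqrtr (ltW e0)).
  by rewrite lerXn2r ?nnegrE ?fine_ge0 ?sqrte_ge0 ?sqrtr_ge0.
apply: ereal_cvg0 => [n|e e0]; first exact: sqrte_ge0.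
have /fine_cvgP[[N1 _ h1] /cvgrPdist_le h2] := h.
have [N2 _ h3] := h2 _ (exprn_gt0 2 e0).
exists (maxn N1 N2) => m; rewrite geq_max => /andP[N1m N2m].
have := h3 m N2m; have := h1 m N1m => /= f1.
rewrite sub0r normrN ger0_norm ?fine_ge0 ?sqnorm_ge0//.
rewrite -lee_fin fineK// l2normE => le.
have -> : e%:E = sqrte (e ^+ 2)%:E by rewrite /= sqrtr_sqr gtr0_norm.
by rewrite lee_sqrt// lee_fin sqr_ge0.
Qed.

Lemma L2_ft f : cintegrable leb setT f -> L2 leb setT f -> L2 leb setT (ft ms f).
Proof.
move=> cf Lf; apply/L2P; split; first by apply: cmeasurable_ft; case: cf.
by rewrite plancherel_L1//; exact: L2_sqnorm_lty.
Qed.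

Lemma sqnorm_ftB f g : cintegrable leb setT f -> cintegrable leb setT g ->
  L2 leb setT f -> L2 leb setT g ->
  sqnorm leb setT (fun p => ft ms f p - ft ms g p) = sqnorm leb setT (fun x => f x - g x).
Proof.
move=> cf cg Lf Lg.
rewrite -(plancherel_L1 ms2 (cintegrableB measurableT cf cg) (L2B measurableT Lf Lg)).
congr sqnorm; apply/funext => p.
have e := ftD ms p cf (cintegrableZ measurableT (-1) cg).
rewrite (ftZ ms (-1) p cg) mulN1r in e; rewrite -e; congr (ft _ _ p).
by apply/funext => x; rewrite mulN1r.
Qed.

Lemma inner_ft f g : cintegrable leb setT f -> cintegrable leb setT g ->
  L2 leb setT f -> L2 leb setT g ->
  inner leb setT (ft ms f) (ft ms g) = inner leb setT f g.
Proof.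
move=> cf cg Lf Lg; apply: polarization => //; [exact: L2_ft|exact: L2_ft|].
move=> c; have Lc := L2D measurableT Lf (L2Z measurableT c Lg).
have cc := cintegrableD measurableT cf (cintegrableZ measurableT c cg).
rewrite -(plancherel_L1 ms2 cc Lc); congr sqnorm; apply/funext => p.
by rewrite (ftD ms p cf (cintegrableZ measurableT c cg)) (ftZ ms c p cg).
Qed.

Lemma is_fourierP f g :
  is_fourier f g <-> L2 leb setT g /\ L2cvg leb setT (fun n => ft ms (trunc n f)) g.
Proof.
have e : (fun n => l2norm leb setT (fun xi => g xi - fourier_trunc f n xi)) =
  (fun n => l2norm leb setT (fun xi => ft ms (trunc n f) xi - g xi)).
  apply/funext => n; rewrite !l2normE sqnormB; congr (sqrte (sqnorm _ _ _)).
  by apply/funext => x; rewrite fourier_truncE.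
by rewrite /is_fourier e; split => -[Lg h]; split => //; exact/l2norm_cvg0P.
Qed.

(** The transforms of the truncations form a Cauchy sequence, since by Plancherel their distances
    are those of the truncations. *)
Lemma is_fourier_ex f : L2 leb setT f -> exists g, is_fourier f g.
Proof.
move=> Lf.
have [||g Lg cg] := @L2_complete _ mR R leb setT measurableT (fun n => ft ms (trunc n f)).
- by move=> n; apply: L2_ft; [exact: cintegrable_trunc|exact: L2_trunc].
- move=> e e0.
  have c := L2cvg_trunc Lf.
  have /fine_cvgP[[N1 _ h1] /cvgrPdist_le h2] := c.
  (* Squared norms satisfy |a + b|^2 <= 2 |a|^2 + 2 |b|^2, so two errors of e / 4 add up to e. *)
  have e4 : 0 < e / 4 by rewrite divr_gt0.
  have [N2 _ h3] := h2 _ e4.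
  have small j : (maxn N1 N2 <= j)%N -> (sqnorm leb setT (fun x => trunc j f x - f x)%R <= (e / 4)%:E)%E.
    rewrite geq_max => /andP[j1 j2]; have := h3 j j2; have := h1 j j1 => /= f1.
    rewrite sub0r normrN ger0_norm ?fine_ge0 ?sqnorm_ge0//.
    by rewrite -lee_fin fineK.
  exists (maxn N1 N2) => m n Nm Nn.
  rewrite sqnorm_ftB; [|exact: cintegrable_trunc|exact: cintegrable_trunc|exact: L2_trunc|exact: L2_trunc].
  have mt j := cmeasurable_trunc j (L2_cmeasurable Lf).
  have := sqnormD_le leb measurableT (cmeasurableB (mt m) (L2_cmeasurable Lf))
    (cmeasurableB (L2_cmeasurable Lf) (mt n)).
  under [X in (X <= _)%E -> _]eq_integral do rewrite addrA subrK.
  move=> h; apply: (le_trans h); rewrite [X in (_ + _ * X <= _)%E]sqnormB.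
  have -> : (e%:E = 2%:E * (e / 4)%:E + 2%:E * (e / 4)%:E)%E.
    by rewrite -!EFinM -EFinD; congr EFin; field.
  by apply: leeD; apply: lee_wpmul2l => //; exact: small.
by exists g; exact/is_fourierP.
Qed.

Lemma fourier_is_fourier f g : is_fourier f g -> is_fourier f (fourier f).
Proof.
by move=> fg; exact: (@xgetPex _ (fun=> 0) [set g | is_fourier f g] (ex_intro _ g fg)).
Qed.

(* Keeps unification from unfolding the epsilon operator. *)
Local Opaque fourier.

Lemma fourierP f : L2 leb setT f ->
  L2 leb setT (fourier f) /\ L2cvg leb setT (fun n => ft ms (trunc n f)) (fourier f).
Proof.
move=> Lf; have [g gf] := is_fourier_ex Lf; apply/is_fourierP.
exact: fourier_is_fourier gf.
Qed.

Lemma L2_fourier f : L2 leb setT f -> L2 leb setT (fourier f).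
Proof. by move=> /fourierP[]. Qed.

Lemma fourier_parseval f g : L2 leb setT f -> L2 leb setT g ->
  inner leb setT (fourier f) (fourier g) = inner leb setT f g.
Proof.
move=> Lf Lg; have [LFf cf] := fourierP Lf; have [LFg cg] := fourierP Lg.
have Lt h n : L2 leb setT h -> L2 leb setT (ft ms (trunc n h)).
  by move=> Lh; apply: L2_ft; [exact: cintegrable_trunc|exact: L2_trunc].
have c1 := inner_cvg measurableT (fun n => Lt f n Lf) (fun n => Lt g n Lg) LFf LFg cf cg.
have c2 := inner_cvg measurableT (fun n => L2_trunc n Lf) (fun n => L2_trunc n Lg)
  Lf Lg (L2cvg_trunc Lf) (L2cvg_trunc Lg).
apply: ccvg_unique c1 _; rewrite (_ : (fun n => _) =
   (fun n => inner leb setT (trunc n f) (trunc n g)))//.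
apply/funext => n; apply: inner_ft; [exact: cintegrable_trunc|exact: cintegrable_trunc
  |exact: L2_trunc|exact: L2_trunc].
Qed.

(** Conjugating the second factor turns the bilinear integral into an inner product, so that
    [inner_cvg] extends the formula from truncations to L_2. *)
Lemma fourier_mult f g : L2 leb setT f -> L2 leb setT g ->
  cintegral leb setT (fun x => fourier f x * g x) =
  cintegral leb setT (fun x => f x * fourier g x).
Proof.
move=> Lf Lg; have [LFf cf] := fourierP Lf; have [LFg cg] := fourierP Lg.
have Lt h n : L2 leb setT h -> L2 leb setT (ft ms (trunc n h)).
  by move=> Lh; apply: L2_ft; [exact: cintegrable_trunc|exact: L2_trunc].
have c1 := inner_cvg measurableT (fun n => Lt f n Lf) (fun n => L2J (L2_trunc n Lg))
  LFf (L2J Lg) cf (L2cvg_conj (L2cvg_trunc Lg)).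
have c2 := inner_cvg measurableT (fun n => L2_trunc n Lf) (fun n => L2J (Lt g n Lg))
  Lf (L2J LFg) (L2cvg_trunc Lf) (L2cvg_conj cg).
have e (a b : R -> R[i]) : inner leb setT a (fun x => conjc (b x)) =
  cintegral leb setT (fun x => a x * b x).
  by apply: eq_cintegral => x _; rewrite conjcK.
rewrite -!e; apply: ccvg_unique c1 _; rewrite (_ : (fun n => _) =
   (fun n => inner leb setT (trunc n f) (fun x => conjc (ft ms (trunc n g) x))))//.
by apply/funext => n; rewrite !e; apply: ft_mult; exact: cintegrable_trunc.
Qed.

(** Uniqueness of limits: by Plancherel the transforms of the truncations also converge to
    [ft ms k]. *)
Lemma fourierE_L1 k : cintegrable leb setT k -> L2 leb setT k ->
  fourier k = ft ms k %[ae leb in setT].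
Proof.
move=> ck Lk; have [LFk c] := fourierP Lk.
have mk := L2_cmeasurable Lk.
apply: (L2cvg_unique measurableT _ _ _ c).
- by move=> n; apply: cmeasurable_ft; exact: cmeasurable_trunc.
- exact: L2_cmeasurable LFk.
- exact: cmeasurable_ft.
rewrite /L2cvg (_ : (fun n => _) = (fun n => sqnorm leb setT (fun x => trunc n k x - k x))).
  exact: L2cvg_trunc.
by apply/funext => n; apply: sqnorm_ftB => //; [exact: cintegrable_trunc|exact: L2_trunc].
Qed.

(** [fourier f] is a chosen representative, so linearity is not at hand; the norm of a difference is
    expanded into norms and an inner product, all preserved by Parseval. *)
Lemma sqnorm_fourierB f g : L2 leb setT f -> L2 leb setT g ->
  sqnorm leb setT (fun x => fourier f x - fourier g x) = sqnorm leb setT (fun x => f x - g x).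
Proof.
move=> Lf Lg; have LFf := L2_fourier Lf; have LFg := L2_fourier Lg.
have e (a b : R -> R[i]) : L2 leb setT a -> L2 leb setT b ->
    sqnorm leb setT (fun x => a x - b x) = (fine (sqnorm leb setT a) +
      2 * cRe (conjc (-1) * inner leb setT a b) + normc (-1) ^+ 2 * fine (sqnorm leb setT b))%:E.
  move=> La Lb; rewrite -(fine_sqnormD measurableT (-1) La Lb) fineK.
    by apply: eq_integral => x _; rewrite mulN1r.
  apply: sqnorm_fin; apply: (L2D measurableT La); exact: L2Z.
have n h : L2 leb setT h -> fine (sqnorm leb setT (fourier h)) = fine (sqnorm leb setT h).
  move=> Lh; have := fourier_parseval Lh Lh.
  by rewrite (innerff measurableT (L2_fourier Lh)) (innerff measurableT Lh) => -[].
have key (a b a' b' : R -> R[i]) : L2 leb setT a -> L2 leb setT b ->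
    L2 leb setT a' -> L2 leb setT b' ->
    fine (sqnorm leb setT a) = fine (sqnorm leb setT a') ->
    fine (sqnorm leb setT b) = fine (sqnorm leb setT b') ->
    inner leb setT a b = inner leb setT a' b' ->
    sqnorm leb setT (fun x => a x - b x) = sqnorm leb setT (fun x => a' x - b' x).
  by move=> La Lb La' Lb' h1 h2 h3; rewrite (e a b)// (e a' b')// h1 h2 h3.
exact: (key _ _ _ _ LFf LFg Lf Lg (n f Lf) (n g Lg) (fourier_parseval Lf Lg)).
Qed.

Lemma fourier_cvg (fs : nat -> R -> R[i]) f : (forall n, L2 leb setT (fs n)) -> L2 leb setT f ->
  L2cvg leb setT fs f -> L2cvg leb setT (fun n => fourier (fs n)) (fourier f).
Proof.
move=> Lfs Lf; rewrite /L2cvg; under [X in _ -> X @ _ --> _]eq_fun do rewrite sqnorm_fourierB//.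
by [].
Qed.

(** The preimage is the conjugate of the transform of the conjugate of k. The multiplication formula
    and Parseval show that its transform and k have the same integral against g, and the choice of g
    as the conjugate of their difference makes the norm of that difference 0. *)
Lemma fourier_surj k : L2 leb setT k ->
  exists2 f, L2 leb setT f & fourier f = k %[ae leb in setT].
Proof.
move=> Lk; pose f x := conjc (fourier (fun y => conjc (k y)) x).
have LFJ := L2_fourier (L2J Lk).
have Lf : L2 leb setT f by exact: L2J.
exists f => //; have LFf := L2_fourier Lf.
have LD := L2B measurableT LFf Lk.
pose g x := conjc (fourier f x - k x).
have Lg : L2 leb setT g by exact: L2J.
have e : cintegral leb setT (fun x => fourier f x * g x) = cintegral leb setT (fun x => k x * g x).
  rewrite fourier_mult//.
  have -> : cintegral leb setT (fun x => f x * fourier g x) =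
      inner leb setT (fourier g) (fourier (fun y => conjc (k y))).
    by apply: eq_cintegral => x _; rewrite mulrC.
  rewrite fourier_parseval//; last exact: L2J.
  by apply: eq_cintegral => x _; rewrite conjcK mulrC.
have : inner leb setT (fun x => fourier f x - k x) (fun x => fourier f x - k x) = 0.
  rewrite -(subrr (cintegral leb setT (fun x => k x * g x))) -[X in X - _]e.
  rewrite -cintegralB//; [|exact: L2M_cintegrable|exact: L2M_cintegrable].
  by apply: eq_cintegral => x _; rewrite -mulrBl.
rewrite innerff// => /complexI h.
have /(sqnorm_eq0 measurableT (L2_cmeasurable LD)) : sqnorm leb setT (fun x => fourier f x - k x) = 0%E.
  by rewrite -(fineK (sqnorm_fin LD)) h.
apply: ae_impl => x /[apply] /eqP; rewrite subr_eq0 => /eqP //.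
Qed.

(** For truncations this is a change of variable in an absolutely convergent integral; both sides
    then pass to the limit in L_2. *)
Lemma fourier_dilate_translate k u v : 0 < u -> L2 leb setT k ->
  fourier (fun x => k ((x - v) / u)) =
  (fun w => u%:C * expi (ms * v * w) * fourier k (u * w)) %[ae leb in setT].
Proof.
move=> u0 Lk; have u0' : u != 0 by rewrite gt_eqF.
pose S (h : R -> R[i]) x := h (u^-1 * x + - (v / u)).
have SE h : (fun x => h ((x - v) / u)) = S h.
  by apply/funext => x; rewrite /S; congr h; field.
pose M (h : R -> R[i]) w := (u%:C * expi (ms * v * w)) * h (u * w).
have mM h : cmeasurable (setT : set mR) h -> cmeasurable (setT : set mR) (M h).
  move=> mh; apply: cmeasurableM; last first.
    by have := cmeasurable_affine u 0 mh; under eq_fun do rewrite addr0.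
  apply: cmeasurableZ; apply: cmeasurable_expi; apply: continuous_measurable_fun => x.
  by apply: cvgM; [exact: cvg_cst|exact: cvg_id].
have LS h : L2 leb setT h -> L2 leb setT (S h).
  by apply: L2_affine; rewrite invr_eq0.
have ck n := cintegrable_trunc n Lk; have Lkn n := L2_trunc n Lk.
have mk := L2_cmeasurable Lk.
have cS : L2cvg leb setT (fun n => S (trunc n k)) (S k).
  have h : (fun n => (`|u^-1|^-1)%:E * sqnorm leb setT (fun x => trunc n k x - k x)%R)%E @ \oo --> 0%E.
    by rewrite -(mule0 (`|u^-1|^-1)%:E); apply: cvgeZl => //; exact: L2cvg_trunc.
  apply: cvg_trans h; apply: near_eq_cvg; apply: nearW => n /=.
  rewrite -(@sqnorm_affine R u^-1 (- (v / u)) (fun x => trunc n k x - k x)) ?invr_eq0//.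
  by apply: cmeasurableB => //; exact: cmeasurable_trunc.
have cSk n : cintegrable leb setT (S (trunc n k)).
  by apply: cintegrable_affine => //; rewrite invr_eq0.
have e n : fourier (S (trunc n k)) = M (ft ms (trunc n k)) %[ae leb in setT].
  apply: ae_impl (fourierE_L1 (cSk n) (LS _ (Lkn n))) => w h _; rewrite h//.
  have ce : cintegrable leb setT (fun x => trunc n k x * expi (ms * (u * x + v) * w)).
    apply: cintegrable_expi (ck n); apply: cmeasurable_expi; apply: continuous_measurable_fun => x.
    apply: cvgM; last exact: cvg_cst.
    apply: cvgM; first exact: cvg_cst.
    by apply: cvgD; [apply: cvgM; [exact: cvg_cst|exact: cvg_id]|exact: cvg_cst].
  have u1 : u^-1 != 0 by rewrite invr_eq0.
  have := cintegral_affine (- (v / u)) u1 ce.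
  rewrite ger0_norm ?invr_ge0 ?ltW// invrK => e1.
  transitivity (u%:C * cintegral leb setT (fun x => trunc n k x * expi (ms * (u * x + v) * w))).
    rewrite -e1; apply: eq_cintegral => x _; rewrite /S; congr (_ * expi _).
    by field.
  rewrite /M -mulrA; congr (_ * _).
  rewrite -cintegralZ//; last exact: ft_integrable.
  apply: eq_cintegral => x _; rewrite mulrCA -expiD; congr (_ * expi _).
  by ring.
have [LFk cFk] := fourierP Lk.
have LFS := L2_fourier (LS _ Lk).
rewrite SE -[X in _ = X %[ae _ in _]]/(M (fourier k)).
apply: (@L2cvg_unique _ mR R leb setT measurableT (fun n => M (ft ms (trunc n k)))).
- by move=> n; apply: mM; apply: cmeasurable_ft; exact: cmeasurable_trunc.
- exact: L2_cmeasurable LFS.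
- by apply: mM; exact: L2_cmeasurable LFk.
- have := fourier_cvg (fun n => LS _ (Lkn n)) (LS _ Lk) cS.
  apply: cvg_trans; apply: near_eq_cvg; apply: nearW => n.
  apply: ae_eq_sqnorm => //.
  + by apply: cmeasurableB; [exact: L2_cmeasurable (L2_fourier (LS _ (Lkn n)))|exact: L2_cmeasurable LFS].
  + apply: cmeasurableB; last exact: L2_cmeasurable LFS.
    by apply: mM; apply: cmeasurable_ft; exact: cmeasurable_trunc.
  + by apply: ae_impl (e n) => w h _; rewrite h.
- have h : (fun n => (u ^+ 2)%:E * ((`|u|^-1)%:E * sqnorm leb setT (fun x => ft ms (trunc n k) x - fourier k x)%R))%E @ \oo --> 0%E.
    rewrite -(mule0 (u ^+ 2)%:E); apply: cvgeZl => //.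
    by rewrite -(mule0 (`|u|^-1)%:E); apply: cvgeZl.
  apply: cvg_trans h; apply: near_eq_cvg; apply: nearW => n /=.
  have mD : cmeasurable (setT : set mR) (fun x => ft ms (trunc n k) x - fourier k x).
    apply: cmeasurableB; last exact: L2_cmeasurable LFk.
    by apply: cmeasurable_ft; exact: cmeasurable_trunc.
  rewrite -(sqnorm_affine 0 u0' mD) /sqnorm -ge0_integralZl_EFin ?sqr_ge0//.
  + apply: eq_integral => x _; rewrite addr0 -EFinM /M -mulrBr normcM exprMn normcM normc_expi mulr1.
    by rewrite normcR gtr0_norm.
  + by move=> x _; rewrite lee_fin sqr_ge0.
  + apply: emeasurable_normc_sqr.
    exact: (cmeasurable_affine u 0 mD).
Qed.

End fourier_L2.

Lemma cmeasurable_comp_in d d' (T : measurableType d) (T' : measurableType d')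
    (R : realType) (D : set T) (E : set T') (f : T' -> R[i]) (g : T -> T') :
  measurable E -> g @` D `<=` E -> measurable_fun D g -> cmeasurable E f ->
  cmeasurable D (fun x => f (g x)).
Proof.
move=> mE gDE mg [f1 f2]; split.
  exact: (measurable_comp mE gDE f1 mg).
exact: (measurable_comp mE gDE f2 mg).
Qed.

Section inner_ft.
Context (R : realType).
Local Notation leb := (@lebesgue_measure R).
Variable s : R.
Hypothesis s2pi : s ^+ 2 = (2 * pi) ^+ 2.

Lemma L2_ft_gen (f : R -> R[i]) : cintegrable leb setT f -> L2 leb setT f ->
  L2 leb setT (ft s f).
Proof.
move=> cf Lf; apply/L2P; split; first by apply: cmeasurable_ft; case: cf.
by rewrite plancherel_L1//; exact: L2_sqnorm_lty.
Qed.

Lemma inner_ft_gen (f g : R -> R[i]) : cintegrable leb setT f -> cintegrable leb setT g ->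
  L2 leb setT f -> L2 leb setT g ->
  inner leb setT (ft s f) (ft s g) = inner leb setT f g.
Proof.
move=> cf cg Lf Lg.
have LFf := L2_ft_gen cf Lf; have LFg := L2_ft_gen cg Lg.
apply: (polarization measurableT measurableT Lf Lg LFf LFg) => c.
have Lc := L2D measurableT Lf (L2Z measurableT c Lg).
have cc := cintegrableD measurableT cf (cintegrableZ measurableT c cg).
rewrite -(plancherel_L1 s2pi cc Lc); congr sqnorm; apply/funext => p.
by rewrite (ftD s p cf (cintegrableZ measurableT c cg)) (ftZ s c p cg).
Qed.

End inner_ft.

(** * The transform as a partial Fourier transform *)

Section transform_model.
Context (R : realType).
Local Notation leb := (@lebesgue_measure R).
Local Notation mR := (measurableTypeR R).
Variable m1 : {sigma_finite_measure set mR -> \bar R}.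
Variable D1 : set mR.
Hypothesis mD1 : measurable D1.
Variable l : R -> R -> R[i].
Variable s : R.
Hypothesis s2pi : s ^+ 2 = (2 * pi) ^+ 2.
Variable freq : set R.
Local Notation G := (D1 `*` [set: mR]).
Local Notation mu := (m1 \x leb)%E.
Hypothesis ml : cmeasurable G (fun z => l z.1 z.2).
Hypothesis Ll : forall r, D1 r -> L2 leb setT (l r).
Hypothesis l1 : forall w, freq w -> (\int[m1]_(r in D1) (normc (l r w) ^+ 2)%:E = 1)%E.
Hypothesis aefreq : \forall w \ae leb, freq w.
Implicit Types (k h f g : R -> R[i]) (b : R -> R).

Let mG : measurable G. Proof. exact: measurableX. Qed.

(** The map U of the overview, for an abstract kernel [l] and factor [s]. *)
Definition wt k (z : R * R) : R[i] := ft s (fun w => k w * l z.1 w) z.2.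

Lemma wt_integrable k r : L2 leb setT k -> D1 r ->
  cintegrable leb setT (fun w => k w * l r w).
Proof. by move=> Lk Dr; apply: (L2M_cintegrable measurableT Lk (Ll Dr)). Qed.

Lemma cmeasurable_wt k : L2 leb setT k -> cmeasurable G (wt k).
Proof.
move=> Lk.
pose f (y : (R * R) * R) := k y.2 * l y.1.1 y.2 * expi (s * y.2 * y.1.2).
have mGT : measurable (G `*` [set: mR]) by exact: measurableX.
apply: (@cmeasurable_cintegral1 _ _ (mR * mR)%type mR R leb G mG f).
apply: cmeasurableM; first apply: cmeasurableM.
- apply: (@cmeasurable_comp _ _ _ mR R _ k (fun y : (mR * mR) * mR => y.2)).
    exact: L2_cmeasurable Lk.
  by apply: measurable_funTS; exact: measurable_snd.
- apply: (@cmeasurable_comp_in _ _ _ (mR * mR)%type R _ G (fun z => l z.1 z.2)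
    (fun y : (mR * mR) * mR => (y.1.1, y.2))) => //.
  + by move=> _ [[[a c] x] [[/= Da _] _] <-].
  + apply: measurable_funTS; apply: measurable_fun_pair => //.
    by apply: measurableT_comp; [exact: measurable_fst|exact: measurable_fst].
- apply: cmeasurable_expi; apply: measurable_funTS; apply: measurable_funM.
    by apply: measurable_funM; [exact: measurable_cst|exact: measurable_snd].
  by apply: measurableT_comp; [exact: measurable_snd|exact: measurable_fst].
Qed.

Lemma wt_lin c k h z : L2 leb setT k -> L2 leb setT h -> G z ->
  wt (fun w => c * k w + h w) z = c * wt k z + wt h z.
Proof.
move=> Lk Lh [Dz _]; have ck := wt_integrable Lk Dz; have ch := wt_integrable Lh Dz.
rewrite /wt -(ftZ s c z.2 ck) -(ftD s z.2 (cintegrableZ measurableT c ck) ch).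
by congr ft; apply/funext => w; rewrite mulrDl mulrA.
Qed.

Lemma measurable_fstG b : measurable_fun D1 b -> measurable_fun G (fun z => b z.1).
Proof.
move=> mb; apply: (@measurable_comp _ _ _ (mR * mR)%type mR R D1 b G fst mD1) => //.
  by move=> _ [z [Dz _] <-].
by apply: measurable_funTS; exact: measurable_fst.
Qed.

Lemma cmeasurable_fstG (a : R -> R[i]) : cmeasurable D1 a -> cmeasurable G (fun z => a z.1).
Proof. by move=> [a1 a2]; split; [exact: (measurable_fstG a1)|exact: (measurable_fstG a2)]. Qed.

Lemma cmeasurable_sndG k : cmeasurable (setT : set mR) k -> cmeasurable G (fun z => k z.2).
Proof.
move=> mk; apply: (@cmeasurable_comp _ _ _ mR R _ k (fun z : mR * mR => z.2)) => //.
by apply: measurable_funTS; exact: measurable_snd.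
Qed.

(** The analogue of gamma for a real weight, in the extended reals because finiteness has to be
    proved; it is used for the weight 1, for |alpha|^2 and for truncations of |alpha|^2. *)
Definition Gam b w : \bar R := (\int[m1]_(r in D1) (b r * normc (l r w) ^+ 2)%:E)%E.

Let bl_meas b : measurable_fun D1 b ->
  measurable_fun G (fun z => (b z.1 * normc (l z.1 z.2) ^+ 2)%:E).
Proof.
move=> mb; apply/measurable_EFinP; apply: measurable_funM; first exact: measurable_fstG.
exact: measurable_normc_sqr ml.
Qed.

Lemma measurable_Gam b : measurable_fun D1 b -> (forall r, 0 <= b r) ->
  measurable_fun (setT : set mR) (Gam b).
Proof.
move=> mb b0.
apply: (@measurable_rect_tonelli2 _ _ mR mR R m1 D1 mD1 _ (bl_meas mb)) => z _.
by rewrite lee_fin mulr_ge0 ?sqr_ge0.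
Qed.

Lemma Gam_ge0 b w : (forall r, 0 <= b r) -> (0 <= Gam b w)%E.
Proof. by move=> b0; apply: integral_ge0 => r _; rewrite lee_fin mulr_ge0 ?sqr_ge0. Qed.

Let kl2_meas k b : L2 leb setT k -> measurable_fun D1 b ->
  measurable_fun G (fun z => (b z.1 * normc (k z.2 * l z.1 z.2) ^+ 2)%:E).
Proof.
move=> Lk mb; apply/measurable_EFinP; apply: measurable_funM; first exact: measurable_fstG.
apply: measurable_normc_sqr; apply: cmeasurableM => //.
exact: cmeasurable_sndG (L2_cmeasurable Lk).
Qed.

Lemma integral_Gam k b : L2 leb setT k -> measurable_fun D1 b -> (forall r, 0 <= b r) ->
  (\int[m1]_(r in D1) \int[leb]_w (b r * normc (k w * l r w) ^+ 2)%:E =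
   \int[leb]_w ((normc (k w) ^+ 2)%:E * Gam b w))%E.
Proof.
move=> Lk mb b0.
have mf := kl2_meas Lk mb.
have f0 z : G z -> (0 <= (b z.1 * normc (k z.2 * l z.1 z.2) ^+ 2)%:E)%E.
  by rewrite lee_fin mulr_ge0 ?sqr_ge0.
rewrite -(@rect_tonelli1 _ _ mR mR R m1 leb D1 mD1 _ mf f0).
rewrite (@rect_tonelli2 _ _ mR mR R m1 leb D1 mD1 _ mf f0).
apply: eq_integral => w _; rewrite /Gam -ge0_integralZl_EFin ?sqr_ge0//.
- by apply: eq_integral => r _; rewrite -EFinM normcM exprMn; congr EFin; ring.
- by move=> r _; rewrite lee_fin mulr_ge0 ?sqr_ge0.
- exact: (@measurable_section2 _ _ mR mR D1 mD1 _ _ _ w (bl_meas mb)).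
Qed.

Lemma Gam1 w : freq w -> Gam (fun=> 1) w = 1%E.
Proof. by move=> fw; rewrite -(l1 fw); apply: eq_integral => r _; rewrite mul1r. Qed.

(** Plancherel needs square integrable slices, whereas a product of two L_2 functions is a priori
    only integrable. By Tonelli and the normalisation of [l], the squared norms of the slices have
    integral |k|^2, hence are finite almost everywhere. *)
Lemma ae_L2_slice k : L2 leb setT k ->
  \forall r \ae m1, D1 r -> L2 leb setT (fun w => k w * l r w).
Proof.
move=> Lk; have mk := L2_cmeasurable Lk.
have m1c : measurable_fun D1 (fun=> 1 : R) by exact: measurable_cst.
have h := integral_Gam Lk m1c (fun=> ler01).
have mf := kl2_meas Lk m1c.
have f0 z : G z -> (0 <= (1 * normc (k z.2 * l z.1 z.2) ^+ 2)%:E)%E.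
  by rewrite lee_fin mulr_ge0 ?sqr_ge0.
have e : (\int[leb]_w ((normc (k w) ^+ 2)%:E * Gam (fun=> 1%R) w) = sqnorm leb setT k)%E.
  apply: ge0_ae_eq_integral => //.
  - apply: emeasurable_funM; first exact: emeasurable_normc_sqr.
    exact: measurable_Gam.
  - exact: emeasurable_normc_sqr.
  - by move=> w _; rewrite mule_ge0 ?Gam_ge0// lee_fin sqr_ge0.
  - by move=> w _; rewrite lee_fin sqr_ge0.
  - by apply: ae_impl aefreq => w fw _; rewrite Gam1// mule1.
have mF : measurable_fun D1 (fun r => \int[leb]_w (1 * normc (k w * l r w) ^+ 2)%:E)%E.
  exact: (@measurable_rect_tonelli1 _ _ mR mR R leb D1 mD1 _ mf f0).
have iF : m1.-integrable D1 (fun r => \int[leb]_w (1 * normc (k w * l r w) ^+ 2)%:E)%E.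
  apply/integrableP; split => //.
  under eq_integral => r _.
    rewrite gee0_abs; last by apply: integral_ge0 => w _; rewrite lee_fin mulr_ge0 ?sqr_ge0.
    over.
  by rewrite h e; exact: L2_sqnorm_lty.
apply: ae_impl (integrable_ae mD1 iF) => r + Dr => /(_ Dr) fr.
apply/L2P; split; first by apply: cmeasurableM => //; exact: L2_cmeasurable (Ll Dr).
move: fr; rewrite ge0_fin_numE; last by apply: integral_ge0 => w _; rewrite lee_fin mulr_ge0 ?sqr_ge0.
by under eq_integral do rewrite mul1r.
Qed.

(** The weight depends on r only, so it passes through Plancherel in the second variable, applied on
    almost every slice. *)
Lemma integral_wt k b : L2 leb setT k -> measurable_fun D1 b -> (forall r, 0 <= b r) ->
  (\int[mu]_(z in G) (b z.1 * normc (wt k z) ^+ 2)%:E =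
   \int[leb]_w ((normc (k w) ^+ 2)%:E * Gam b w))%E.
Proof.
move=> Lk mb b0; have mk := L2_cmeasurable Lk.
have mw : measurable_fun G (fun z => (b z.1 * normc (wt k z) ^+ 2)%:E).
  apply/measurable_EFinP; apply: measurable_funM; first exact: measurable_fstG.
  by apply: measurable_normc_sqr; exact: cmeasurable_wt.
have w0 z : G z -> (0 <= (b z.1 * normc (wt k z) ^+ 2)%:E)%E.
  by rewrite lee_fin mulr_ge0 ?sqr_ge0.
rewrite (@rect_tonelli1 _ _ mR mR R m1 leb D1 mD1 _ mw w0) -(integral_Gam Lk mb b0).
have mf := kl2_meas Lk mb.
have f0 z : G z -> (0 <= (b z.1 * normc (k z.2 * l z.1 z.2) ^+ 2)%:E)%E.
  by rewrite lee_fin mulr_ge0 ?sqr_ge0.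
apply: ge0_ae_eq_integral => //.
- exact: (@measurable_rect_tonelli1 _ _ mR mR R leb D1 mD1 _ mw w0).
- exact: (@measurable_rect_tonelli1 _ _ mR mR R leb D1 mD1 _ mf f0).
- by move=> r _; apply: integral_ge0 => t _; rewrite lee_fin mulr_ge0 ?sqr_ge0.
- by move=> r _; apply: integral_ge0 => t _; rewrite lee_fin mulr_ge0 ?sqr_ge0.
apply: ae_impl (ae_L2_slice Lk) => r + Dr => /(_ Dr) Lr.
have cr := wt_integrable Lk Dr.
transitivity (\int[leb]_t ((b r)%:E * (normc (ft s (fun w => k w * l r w) t) ^+ 2)%:E))%E.
  by apply: eq_integral => t _; rewrite -EFinM.
rewrite ge0_integralZl_EFin//; last 2 first.
- by move=> t _; rewrite lee_fin sqr_ge0.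
- by apply: emeasurable_normc_sqr; exact: L2_cmeasurable (L2_ft_gen s2pi cr Lr).
rewrite -[X in (_ * X)%E]/(sqnorm leb setT (ft s (fun w => k w * l r w))) plancherel_L1//.
rewrite /sqnorm -ge0_integralZl_EFin//.
- by move=> t _; rewrite lee_fin sqr_ge0.
- by apply: emeasurable_normc_sqr; exact: L2_cmeasurable Lr.
Qed.

Lemma sqnorm_wt k : L2 leb setT k -> sqnorm mu G (wt k) = sqnorm leb setT k.
Proof.
move=> Lk.
have m1c : measurable_fun D1 (fun=> 1 : R) by exact: measurable_cst.
have h := integral_wt Lk m1c (fun=> ler01).
transitivity (\int[mu]_(z in G) (1 * normc (wt k z) ^+ 2)%:E)%E.
  by apply: eq_integral => z _; rewrite mul1r.
rewrite h; apply: ge0_ae_eq_integral => //.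
- apply: emeasurable_funM; last exact: measurable_Gam.
  by apply: emeasurable_normc_sqr; exact: L2_cmeasurable Lk.
- by apply: emeasurable_normc_sqr; exact: L2_cmeasurable Lk.
- by move=> w _; rewrite mule_ge0 ?Gam_ge0// lee_fin sqr_ge0.
- by move=> w _; rewrite lee_fin sqr_ge0.
- by apply: ae_impl aefreq => w fw _; rewrite Gam1// mule1.
Qed.

Lemma L2_wt k : L2 leb setT k -> L2 mu G (wt k).
Proof.
move=> Lk; apply/L2P; split; first exact: cmeasurable_wt.
by rewrite sqnorm_wt//; exact: L2_sqnorm_lty.
Qed.

Lemma inner_wt k h : L2 leb setT k -> L2 leb setT h ->
  inner mu G (wt k) (wt h) = inner leb setT k h.
Proof.
move=> Lk Lh; apply: (polarization measurableT mG Lk Lh (L2_wt Lk) (L2_wt Lh)) => c.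
have Lc : L2 leb setT (fun w => c * h w + k w) by apply: (L2D measurableT) Lk; exact: L2Z.
have -> : (fun x => k x + c * h x) = (fun w => c * h w + k w) by apply/funext => w; rewrite addrC.
rewrite -(sqnorm_wt Lc); apply: eq_integral => z; rewrite inE => Gz.
by rewrite wt_lin// addrC.
Qed.

(** Each value is an integral in w, insensitive to null sets, so the equality holds at every point
    of the strip. *)
Lemma wt_ae k h : cmeasurable (setT : set mR) h -> L2 leb setT k ->
  k = h %[ae leb in setT] -> forall z, G z -> wt k z = wt h z.
Proof.
move=> mh Lk e z [Dz _]; have Lh := ae_eq_L2 measurableT mh e Lk.
apply: (ae_eq_cintegral measurableT).
- by case: (ft_integrable s z.2 (wt_integrable Lk Dz)).
- by case: (ft_integrable s z.2 (wt_integrable Lh Dz)).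
- by apply: ae_impl e => w + _ => ->.
Qed.

End transform_model.

(** * Integrable functions charging given sets, and disjoint sets of positive measure *)

Section bump.
Context (R : realType).
Local Notation leb := (@lebesgue_measure R).
Local Notation mR := (measurableTypeR R).

Lemma finite_measure_subset (E : set mR) : measurable E -> (0 < leb E)%E ->
  exists F : set mR, [/\ measurable F, F `<=` E, (0 < leb F)%E & (leb F < +oo)%E].
Proof.
move=> mE E0; apply: contrapT => nF.
pose B (n : nat) : set mR := E `&` `[- n%:R, n%:R]%classic.
have mB n : measurable (B n) by apply: measurableI => //; exact: measurable_itv.
have B0 n : leb (B n) = 0%E.
  apply: contrapT => Bn; apply: nF; exists (B n); split => //.
  - by move=> x [].
  - by rewrite lt0e; apply/andP; split => //; exact/eqP.
  - apply: le_lt_trans (leb_itvcc_lty (- n%:R) n%:R).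
    by apply: le_measure; rewrite ?inE// => x [].
have : leb.-negligible (\bigcup_n B n).
  apply: (@negligible_bigcup _ mR R leb B) => n.
  by apply/(negligibleP _ (mB n)); exact: B0.
have -> : \bigcup_n B n = E.
  apply/seteqP; split => [x [n _ []]//|x Ex]; exists (Num.Def.truncn `|x|).+1 => //.
  split => //=; rewrite in_itv/= -ler_norml; apply: ltW; exact: truncnS_gt.
by move=> /(negligibleP _ mE) EE; rewrite EE ltxx in E0.
Qed.

(** A weighted sum of indicators of subsets of finite positive measure. The sum may be infinite on a
    null set, hence the [fine] in the witness. *)
Lemma bump (E : nat -> set mR) : (forall m, measurable (E m)) ->
  (forall m, (0 < leb (E m))%E) ->
  exists q : R -> R, [/\ measurable_fun (setT : set mR) q, forall x, 0 <= q x,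
    (\int[leb]_x (q x)%:E < +oo)%E &
    forall m, ((2^-1 ^+ m)%:E <= \int[leb]_(x in E m) (q x)%:E)%E].
Proof.
move=> mE E0.
have /choice[F FP] := fun m => finite_measure_subset (mE m) (E0 m).
have mF m : measurable (F m) by case: (FP m).
have fF m : leb (F m) \is a fin_num by case: (FP m) => _ _ _ h; rewrite ge0_fin_numE.
have F0 m : 0 < fine (leb (F m)) by case: (FP m) => _ _ h1 h2; rewrite fine_gt0// h1.
(* This weight gives [F m] the mass 2^-m, and these masses are summable. *)
pose a m : R := 2^-1 ^+ m / fine (leb (F m)).
have a0 m : 0 <= a m by rewrite divr_ge0 ?exprn_ge0// ltW.
pose w m (x : mR) : \bar R := (a m * \1_(F m) x)%:E.
have w0 m x : (0 <= w m x)%E by rewrite lee_fin mulr_ge0.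
have mw m : measurable_fun (setT : set mR) (w m).
  by apply/measurable_EFinP; apply: measurable_funM => //; exact: measurable_indic.
have iw m (D : set mR) : measurable D -> F m `<=` D ->
    (\int[leb]_(x in D) w m x = (2^-1 ^+ m)%:E)%E.
  move=> mD FD; under eq_integral do rewrite /w EFinM.
  rewrite ge0_integralZl_EFin//; last first.
    by apply/measurable_EFinP; exact: measurable_indic.
  rewrite integral_indic// setIidl// -[X in (_ * X)%E](fineK (fF m)) -EFinM /a mulfVK//.
  by rewrite gt_eqF.
pose f x := (\sum_(0 <= m <oo) w m x)%E.
have f0 x : (0 <= f x)%E by apply: nneseries_ge0.
have mf : measurable_fun (setT : set mR) f.
  exact: (@ge0_emeasurable_sum _ _ R setT w xpredT).
have sf : (\int[leb]_x f x < +oo)%E.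
  rewrite integral_nneseries//.
  under eq_eseriesr => m _ do rewrite (iw m setT measurableT)//.
  apply: (@le_lt_trans _ _ 2%:E); last exact: ltry.
  have := @epsilon_trick0 R 2 xpredT ltac:(done).
  apply: le_trans; apply: lee_nneseries => m _; first by rewrite lee_fin exprn_ge0.
  by rewrite lee_fin natrX exprS invfM mulrA divff// mul1r exprVn.
have If : leb.-integrable setT f.
  apply/integrableP; split => //.
  by under eq_integral do rewrite gee0_abs//.
have fe : f = (fun x => (fine (f x))%:E) %[ae leb in setT].
  by apply: ae_impl (integrable_ae measurableT If) => x /(_ I) h _; rewrite fineK.
have mq : measurable_fun (setT : set mR) (fun x => fine (f x)).
  exact: (measurableT_comp (fine_measurable measurableT)).
have eD (D : set mR) : measurable D ->
    (\int[leb]_(x in D) f x = \int[leb]_(x in D) (fine (f x))%:E)%E.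
  move=> mD; apply: ge0_ae_eq_integral => //.
  - exact: measurable_funTS.
  - by apply/measurable_EFinP; exact: measurable_funTS.
  - by move=> x _; rewrite lee_fin fine_ge0.
  - by apply: ae_impl fe => x + _ => /(_ I).
exists (fun x => fine (f x)); split => //.
- by move=> x; rewrite fine_ge0.
- by have := sf; rewrite (eD setT measurableT).
move=> m; have [_ FE _ _] := FP m.
move: (eD (E m) (mE m)) => <-; move: (iw m (E m) (mE m) FE) => <-.
apply: ge0_le_integral => //; [exact: measurable_funTS|exact: measurable_funTS|].
move=> x _; have := @nneseries_lim_ge R (fun k => w k x) xpredT 0%N m.+1 (fun k _ _ => w0 k x).
by apply: le_trans; rewrite big_nat_recr//= leeDr// sume_ge0.
Qed.

Lemma nested_geometric_tail (r : nat -> \bar R) (e : R) : 0 <= e ->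
  (forall i, (r i <= (e / (2 ^ i.+1)%:R)%:E)%E) -> (forall i, (0 <= r i)%E) ->
  (\sum_(0 <= i <oo) r i <= e%:E)%E.
Proof.
move=> e0 re r0; apply: le_trans (@epsilon_trick0 R e xpredT e0).
by apply: lee_nneseries => // i _.
Qed.

(* Shrink balls contained in the [S m] geometrically and remove from each of
   them all the later ones. *)
Lemma disjoint_positive_sets (S : nat -> set R) : (forall m, open (S m)) ->
  (forall m, S m !=set0) -> exists C : nat -> set mR,
  [/\ forall m, measurable (C m), forall m, (0 < leb (C m))%E,
      forall m, C m `<=` S m & trivIset setT C].
Proof.
move=> oS S0.
have /choice[xr xrP] m : exists xr : R * R, 0 < xr.2 /\
    (forall y, `|y - xr.1| < xr.2 -> S m y).
  have [x Sx] := S0 m; have /nbhs_ballP[r /= r0 rS] := open_nbhs_nbhs (conj (oS m) Sx).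
  by exists (x, r); split => //= y; rewrite distrC => xy; exact: rS.
pose x m := (xr m).1; pose r m := (xr m).2.
have r0 m : 0 < r m by case: (xrP m).
(* With the ratio 4 all later intervals together have length at most [rho m], which is half the
   length of [J m]. *)
pose fix rho m : R := if m is k.+1 then Num.min (rho k / 4) (r m) else r 0%N.
have rho0 m : 0 < rho m by elim: m => [|m ih] //=; rewrite lt_min r0 divr_gt0.
have rhor m : rho m <= r m by case: m => [|m] //=; rewrite ge_min lexx orbT.
have rhoS m i : rho (m + i)%N <= rho m / 4 ^+ i.
  elim: i => [|i ih]; first by rewrite addn0 expr0 divr1.
  rewrite addnS /= ge_min; apply/orP; left.
  by rewrite exprSr invfM mulrA ler_wpM2r.
pose J m : set mR := `]x m - rho m, x m + rho m[%classic.
have mJ m : measurable (J m) by exact: measurable_itv.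
have JS m : J m `<=` S m.
  move=> y; rewrite /J /= in_itv/= => /andP[h1 h2]; have [_ h] := xrP m; apply: h.
  by rewrite ltr_distl; have := rhor m; rewrite /r /x in h1 h2 *; move=> ?; apply/andP; split; lra.
have lJ m : leb (J m) = (2 * rho m)%:E.
  rewrite lebesgue_measure_itv/= lte_fin.
  by have := rho0 m => ?; rewrite ifT; [rewrite -EFinD; congr EFin; ring|lra].
pose K m : set mR := \bigcup_(k in [set k | (m < k)%N]) J k.
have mK m : measurable (K m) by exact: bigcup_measurable.
have lK m : (leb (K m) <= (rho m)%:E)%E.
  have KE : K m `<=` \bigcup_i J (m + i.+1)%N.
    move=> y [k /= mk Jy]; exists (k - m.+1)%N => //.
    by rewrite addnS -addSn subnKC.
  apply: le_trans (@measure_sigma_subadditive _ R mR leb (K m) (fun i => J (m + i.+1)%N) _ _ KE) _.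
  - by [].
  - by [].
  apply: nested_geometric_tail; [exact: ltW| |by move=> i; exact: measure_ge0].
  move=> i; rewrite [X in (X <= _)%E]lJ lee_fin.
  have h : (4 ^+ i.+1 : R) = 2 ^+ i.+1 * 2 ^+ i.+1 by rewrite -exprMn; congr (_ ^+ _); ring.
  apply: (@le_trans _ _ (2 * (rho m / 4 ^+ i.+1))); first by rewrite ler_pM2l.
  rewrite h invfM natrX mulrCA ler_pM2l// mulrA ler_piMl ?invr_ge0 ?exprn_ge0//.
  rewrite exprS invfM mulrA divff// mul1r invf_le1 ?exprn_gt0// exprn_ege1//.
  by rewrite ler1n.
exists (fun m => J m `\` K m); split.
- by move=> m; exact: measurableD.
- move=> m; have := @measureDI _ mR R leb (J m) (K m) (mJ m) (mK m); rewrite [X in X = _]lJ => e.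
  rewrite lt0e measure_ge0 andbT; apply/eqP => e0; move: e; rewrite [X in (X + _)%E]e0 add0e => e.
  have : ((2 * rho m)%:E <= (rho m)%:E)%E.
    rewrite e; apply: le_trans (lK m); apply: le_measure; rewrite ?inE//.
    exact: measurableI.
  by rewrite lee_fin; have := rho0 m; lra.
- by move=> m y [/JS].
move=> i j _ _ [y [[Ji nKi] [Jj nKj]]].
case: (ltngtP i j) => // h; exfalso; [by apply: nKi; exists j|by apply: nKj; exists i].
Qed.

End bump.

Lemma normc_triangle (R : rcfType) (x y : R[i]) : normc (x + y) <= normc x + normc y.
Proof. exact: (@le_normcD R x y). Qed.

Lemma ae_forall d (T : measurableType d) (R : realType) (mu : {measure set T -> \bar R})
    (I : finType) (P : I -> T -> Prop) :
  (forall i, \forall x \ae mu, P i x) -> \forall x \ae mu, forall i, P i x.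
Proof. by move=> h; apply: filter_forall. Qed.

Section L2_sum.
Context d (T : measurableType d) (R : realType) (mu : {measure set T -> \bar R}).
Variable D : set T.
Hypothesis mD : measurable D.

Lemma L2_sum (I : Type) (s : seq I) (c : I -> R[i]) (e : I -> T -> R[i]) :
  (forall i, L2 mu D (e i)) -> L2 mu D (fun x => \sum_(i <- s) c i * e i x).
Proof.
move=> Le; elim: s => [|i s ih].
  by under eq_fun do rewrite big_nil; exact: (L2_0 mu mD).
by under eq_fun do rewrite big_cons; apply: (L2D mD) ih; exact: L2Z.
Qed.

End L2_sum.

Lemma left_kernel_neq0 (K : fieldType) (n : nat) (M : 'M[K]_(n.+1, n)) :
  exists2 d : 'rV[K]_n.+1, d != 0 & d *m M = 0.
Proof.
have : kermx M != 0.
  rewrite kermx_eq0 -row_leq_rank -ltnNge ltnS; exact: rank_leq_col.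
by case/rowV0Pn => d /sub_kermxP dM d0; exists d.
Qed.

(** * Spectrum of a multiplication operator *)

(* [U] is the isometry of L_2(R) onto the range [S]; operators on [S] are
   described by the multiplication they become on L_2(R). *)
Section multiplication_model.
Context d (T : measurableType d) (R : realType) (mu : {measure set T -> \bar R}).
Local Notation leb := (@lebesgue_measure R).
Local Notation mR := (measurableTypeR R).
Variable G : set T.
Hypothesis mG : measurable G.
Variables (U : (R -> R[i]) -> T -> R[i]) (S : set (T -> R[i])).
Hypothesis U_lin : forall c k h, L2 leb setT k -> L2 leb setT h -> forall z, G z ->
  U (fun w => c * k w + h w) z = c * U k z + U h z.
Hypothesis L2_U : forall k, L2 leb setT k -> L2 mu G (U k).
Hypothesis sqnorm_U : forall k, L2 leb setT k -> sqnorm mu G (U k) = sqnorm leb setT k.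
Hypothesis U_ae : forall k h, L2 leb setT k -> L2 leb setT h ->
  k = h %[ae leb in setT] -> forall z, G z -> U k z = U h z.
Hypothesis SP : forall F, S F <-> L2 mu G F /\
  exists2 k, L2 leb setT k & F = U k %[ae mu in G].
Implicit Types (k h g q : R -> R[i]) (A B : (T -> R[i]) -> T -> R[i]).

(** Quantified over all pairs of representatives: A acts on functions, while k is determined by F
    only up to a null set. *)
Definition multiplies A g := forall F k, S F -> L2 leb setT k ->
  F = U k %[ae mu in G] -> A F = U (fun w => g w * k w) %[ae mu in G].

Definition bounded_symbol g :=
  cmeasurable (setT : set mR) g /\ exists M : R, forall w, normc (g w) <= M.

Definition kof (F : T -> R[i]) : R -> R[i] :=
  xget (fun=> 0) [set k | L2 leb setT k /\ F = U k %[ae mu in G]].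

Lemma kofP F : S F -> L2 leb setT (kof F) /\ F = U (kof F) %[ae mu in G].
Proof.
move=> /SP[_ [k Lk Fk]]; rewrite /kof.
by case: xgetP => [h _ //|/(_ k)]; case.
Qed.

Lemma S_U k : L2 leb setT k -> S (U k).
Proof.
by move=> Lk; apply/SP; split; [exact: L2_U|exists k => //; apply: aeW].
Qed.

Lemma U_inj k h : L2 leb setT k -> L2 leb setT h ->
  U k = U h %[ae mu in G] -> k = h %[ae leb in setT].
Proof.
move=> Lk Lh e.
have Lc : L2 leb setT (fun w => (-1) * h w + k w) by apply: (L2D measurableT) Lk; exact: L2Z.
have : sqnorm leb setT (fun w => (-1) * h w + k w) = 0%E.
  rewrite -(sqnorm_U Lc) -(@integral0 _ _ R mu G); apply: ge0_ae_eq_integral => //.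
  - by apply: emeasurable_normc_sqr; exact: L2_cmeasurable (L2_U Lc).
  - by move=> z _; rewrite lee_fin sqr_ge0.
  - apply: ae_impl e => z + Gz => /(_ Gz) e.
    by rewrite U_lin// mulN1r e addrC subrr normc0 expr0n.
move=> /(sqnorm_eq0 measurableT (L2_cmeasurable Lc)); apply: ae_impl => x /[apply] /eqP.
by rewrite mulN1r addrC subr_eq0 => /eqP.
Qed.

Lemma L2_symbol g k : bounded_symbol g -> L2 leb setT k -> L2 leb setT (fun w => g w * k w).
Proof. by move=> [mg [M gM]] Lk; apply: (L2Ml measurableT mg (M := M)). Qed.

Lemma S_lin c F H : S F -> S H -> S (fun z => c * F z + H z).
Proof.
move=> /SP[LF [k Lk Fk]] /SP[LH [h Lh Hh]]; apply/SP; split.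
  by apply: (L2D mG) LH; exact: L2Z.
exists (fun w => c * k w + h w); first by apply: (L2D measurableT) Lh; exact: L2Z.
by apply: ae_impl2 Fk Hh => z Fk Hh Gz; rewrite U_lin// Fk// Hh.
Qed.

Lemma multiplies_bounded A g : bounded_symbol g -> (forall F, S F -> S (A F)) ->
  multiplies A g -> bounded_operator mu G S A.
Proof.
move=> bg SA Ag; split => //.
- move=> c F H SF SH; have [Lk Fk] := kofP SF; have [Lh Hh] := kofP SH.
  set k := kof F in Lk Fk; set h := kof H in Lh Hh.
  have Lc : L2 leb setT (fun w => c * k w + h w) by apply: (L2D measurableT) Lh; exact: L2Z.
  have e : (fun z => c * F z + H z) = U (fun w => c * k w + h w) %[ae mu in G].
    by apply: ae_impl2 Fk Hh => z Fk Hh Gz; rewrite U_lin// Fk// Hh.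
  have := Ag _ _ (S_lin c SF SH) Lc e.
  apply: ae_impl3 (Ag _ _ SF Lk Fk) (Ag _ _ SH Lh Hh) => z Ak Ah Ac Gz.
  rewrite (Ac Gz) (Ak Gz) (Ah Gz) -U_lin//; try exact: L2_symbol.
  by congr U; apply/funext => w; ring.
have [mg [M gM]] := bg; exists `|M| => F SF; have [Lk Fk] := kofP SF.
have LF : L2 mu G F by move/SP: SF => [].
have LAF : L2 mu G (A F) by move/SP: (SA _ SF) => [].
have mA := L2_cmeasurable LAF.
rewrite !l2normE (ae_eq_sqnorm mG (L2_cmeasurable LF) (L2_cmeasurable (L2_U Lk)) Fk).
rewrite (ae_eq_sqnorm mG mA (L2_cmeasurable (L2_U (L2_symbol bg Lk))) (Ag _ _ SF Lk Fk)).
rewrite !sqnorm_U//; last exact: L2_symbol.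
have h := sqnormMl_le leb measurableT mg (L2_cmeasurable Lk) (fun w _ => gM w).
rewrite -[X in (_ <= X%:E * _)%E](@sqrtr_sqr R M) -[(Num.sqrt _)%:E]/(sqrte (M ^+ 2)%:E).
rewrite -sqrteM ?lee_fin ?sqr_ge0// lee_sqrt//.
by rewrite mule_ge0 ?sqnorm_ge0// lee_fin sqr_ge0.
Qed.

Lemma multiplies_shift A g lambda : multiplies A g -> bounded_symbol g ->
  multiplies (Defs.shift A lambda) (fun w => g w - lambda).
Proof.
move=> Ag bg F k SF Lk Fk; apply: ae_impl2 (Ag _ _ SF Lk Fk) Fk => z Az Fz Gz.
have Lg := L2_symbol bg Lk.
rewrite /Defs.shift (Az Gz) (Fz Gz) addrC -mulNr -U_lin//.
by congr U; apply/funext => w; ring.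
Qed.

Lemma S_shift A lambda F : (forall F, S F -> S (A F)) -> S F -> S (Defs.shift A lambda F).
Proof.
move=> SA SF.
have -> : Defs.shift A lambda F = (fun z => - lambda * F z + A F z).
  by apply/funext => z; rewrite /Defs.shift addrC mulNr.
by apply: S_lin => //; exact: SA.
Qed.

Lemma bounded_symbolB g lambda : bounded_symbol g -> bounded_symbol (fun w => g w - lambda).
Proof.
move=> [mg [M gM]]; split; first by apply: cmeasurableB => //; exact: cmeasurable_cst.
exists (M + normc lambda) => w; have := normc_triangle (g w) (- lambda).
rewrite (_ : normc (- lambda) = normc lambda); last by rewrite -sub0r normcB subr0.
by move=> /le_trans; apply; rewrite lerD2r.
Qed.

Lemma multiplies_comp_id A B g q F : (forall F, S F -> S (A F)) -> multiplies A g ->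
  multiplies B q -> bounded_symbol g -> bounded_symbol q ->
  (\forall w \ae leb, q w * g w = 1) ->
  S F -> B (A F) = F %[ae mu in G].
Proof.
move=> SA Ag Bq bg bq gq SF; have [Lk Fk] := kofP SF.
have Lg := L2_symbol bg Lk.
apply: ae_impl2 (Bq _ _ (SA _ SF) Lg (Ag _ _ SF Lk Fk)) Fk => z Bz Fz Gz.
rewrite (Bz Gz) (Fz Gz); apply: U_ae => //; first exact: L2_symbol.
by apply: ae_impl gq => w gq _; rewrite mulrA gq mul1r.
Qed.

Variable freq : set R.
Hypothesis aefreq : \forall w \ae leb, freq w.

(** The inverse is multiplication by 1 / g, which has to be replaced by a symbol bounded on the
    whole line, off [freq] too. *)
Lemma multiplies_invertible A g (e : R) : bounded_symbol g -> (forall F, S F -> S (A F)) ->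
  multiplies A g -> 0 < e -> (forall w, freq w -> e <= normc (g w)) ->
  invertible mu G S A.
Proof.
move=> bg SA Ag e0 ge; have [mg [M gM]] := bg.
have M0 : 0 <= M by exact: le_trans (normc_ge0 _) (gM 0).
(* On [freq] the maximum is |g|^2, so that [q] is 1 / g there; elsewhere it keeps the denominator
   away from 0. *)
pose v w := Num.max (e ^+ 2) (normc (g w) ^+ 2).
have v0 w : 0 < v w by rewrite lt_max exprn_gt0.
pose q w := conjc (g w) * ((v w)^-1)%:C.
have mv : measurable_fun (setT : set mR) v.
  by apply: measurable_maxr; [exact: measurable_cst|exact: measurable_normc_sqr].
have bq : bounded_symbol q.
  split; first apply: cmeasurableM.
  - exact: cmeasurableJ.
  - apply: cmeasurableR; apply: (@measurable_comp _ _ _ mR mR mR `]0, +oo[ (@GRing.inv R) setT v) => //.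
    + by move=> _ [w _ <-]; rewrite /= in_itv/= andbT.
    + apply: open_continuous_measurable_fun; first exact: interval_open.
      by move=> x; rewrite inE /= in_itv/= andbT => x0; apply: inv_continuous; rewrite gt_eqF.
  exists (M / e ^+ 2) => w; rewrite normcM normc_conj normcR ger0_norm ?invr_ge0 ?(ltW (v0 w))//.
  apply: ler_pM => //; [exact: normc_ge0|by rewrite invr_ge0 ltW|].
  by rewrite lef_pV2 ?posrE ?exprn_gt0// le_max lexx.
have qg w : freq w -> q w * g w = 1.
  move=> fw; rewrite /q mulrAC [_ * g w]mulrC mulcJ.
  have -> : v w = normc (g w) ^+ 2.
    by apply/max_idPr; rewrite ler_sqr ?nnegrE ?normc_ge0// ?ge// ltW.
  rewrite -[_%:C * _%:C](rmorphM (real_complex R)) mulfV// expf_neq0// gt_eqF//.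
  exact: lt_le_trans (ge _ fw).
pose B F := U (fun w => q w * kof F w).
have SB F : S F -> S (B F).
  by move=> SF; have [Lk _] := kofP SF; apply: S_U; exact: L2_symbol.
have Bq : multiplies B q.
  move=> F k SF Lk Fk; have [Lh Fh] := kofP SF.
  have e1 : U (kof F) = U k %[ae mu in G].
    by apply: ae_impl2 Fk Fh => z Fk Fh Gz; rewrite -Fk// Fh.
  apply: aeW => z Gz; apply: U_ae => //; [exact: L2_symbol|exact: L2_symbol|].
  by apply: ae_impl (U_inj Lh Lk e1) => w /(_ I) + _ => ->.
exists B; split; first exact: multiplies_bounded bq SB Bq.
move=> F SF; split.
  by apply: (multiplies_comp_id SA Ag Bq) => //; apply: ae_impl aefreq => w /qg.
apply: (multiplies_comp_id SB Bq Ag) => //; apply: ae_impl aefreq => w /qg.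
by rewrite mulrC.
Qed.

(** Empty families serve for kernel and cokernel. Since B acts on representatives, it is its
    boundedness that gives B (A F) = 0 almost everywhere when A F vanishes almost everywhere. *)
Lemma invertible_fredholm A : (forall F, S F -> S (A F)) ->
  invertible mu G S A -> fredholm mu G S A.
Proof.
move=> SA [B [[SB _ [M BM]] AB]].
have sum0 (c : 'I_0 -> R[i]) (a : 'I_0 -> T -> R[i]) z : \sum_(i < 0) c i * a i z = 0.
  by rewrite big_ord0.
have e0 : 'I_0 -> T -> R[i] by case.
have c0 : 'I_0 -> R[i] by case.
split.
- exists 0%N, e0; split; first by case.
  move=> F SF AF0; exists c0.
  have SAF := SA _ SF; have [LAF _] := (SP _).1 SAF.
  have [LBAF _] := (SP _).1 (SB _ SAF).
  have s0 : sqnorm mu G (A F) = 0%E.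
    rewrite (ae_eq_sqnorm mG (L2_cmeasurable LAF) (cmeasurable_cst G (0 : R[i])) AF0).
    by rewrite /sqnorm; under eq_integral do rewrite normc0 expr0n/=; rewrite integral0.
  have := BM _ SAF; rewrite !l2normE s0 sqrte0 mule0 => le0.
  have t0 : sqnorm mu G (B (A F)) = 0%E.
    apply/eqP; rewrite eq_le sqnorm_ge0 andbT -(@lee_sqrt R _ 0)// sqrte0.
    exact: le0.
  have := sqnorm_eq0 mG (L2_cmeasurable LBAF) t0.
  by apply: ae_impl2 (AB _ SF).1 => z e1 + Gz => /(_ Gz); rewrite (e1 Gz) sum0.
- by move=> H SH _; exists (B H); [exact: SB|exact: (AB _ SH).2].
exists 0%N, e0; split; first by case.
move=> H SH; exists (B H); first exact: SB.
exists c0; apply: ae_impl (AB _ SH).2 => z e1 Gz.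
by rewrite sum0 addr0 (e1 Gz).
Qed.

Lemma U_sum (I : Type) (s : seq I) (c : I -> R[i]) (e : I -> R -> R[i]) z :
  (forall i, L2 leb setT (e i)) -> G z ->
  U (fun w => \sum_(i <- s) c i * e i w) z = \sum_(i <- s) c i * U (e i) z.
Proof.
move=> Le Gz; elim: s => [|i s ih].
  have L0 := L2_0 leb measurableT.
  under [in LHS]eq_fun do rewrite big_nil.
  rewrite big_nil; have := U_lin (-1) L0 L0 Gz.
  under [in LHS]eq_fun do rewrite mulr0 addr0.
  by rewrite mulN1r addNr.
under [in LHS]eq_fun do rewrite big_cons.
by rewrite big_cons U_lin// ?ih//; exact: L2_sum.
Qed.

Hypothesis openfreq : open freq.

(* Split disjoint sets on which [g] tends to 0 into [n + 1] classes and let [k j]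
   charge the j-th class only: a combination of the [k j] equal to [g * t] would
   force [t] out of L_2. *)
Lemma infinite_codim A g : (forall F, S F -> S (A F)) -> bounded_symbol g ->
  multiplies A g ->
  (forall e : R, 0 < e -> open [set w | freq w /\ normc (g w) < e]) ->
  (forall e : R, 0 < e -> exists2 w, freq w & normc (g w) < e) ->
  ~ finite_codim_range mu G S A.
Proof.
move=> SA bg Ag og g0 [n [e [Se H]]].
have p0 m : 0 < 2^-1 ^+ m :> R by rewrite exprn_gt0.
have [C [mC C0 CS tC]] : exists C : nat -> set mR,
    [/\ forall m, measurable (C m), forall m, (0 < leb (C m))%E,
        forall m, C m `<=` [set w | freq w /\ normc (g w) < 2^-1 ^+ m] &
        trivIset setT C].
  apply: disjoint_positive_sets => m; first exact: og.
  by have [w fw gw] := g0 _ (p0 m); exists w.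
(* The j-th class consists of the indices congruent to j modulo n + 1. *)
pose c (j : 'I_n.+1) m := (m * n.+1 + j)%N.
have cI i j m m' : c i m = c j m' -> i = j.
  move=> /(congr1 (modn^~ n.+1)); rewrite !modnMDl !modn_small// => ij.
  exact/val_inj.
have /choice[q qP] := fun j => bump (fun m => mC (c j m)) (fun m => C0 (c j m)).
pose D j : set mR := \bigcup_m C (c j m).
have mD j : measurable (D j) by exact: bigcup_measurable.
have CD i j m w : C (c j m) w -> D i w -> i = j.
  move=> Cw [m' _ Cw'].
  by apply: (cI _ _ m' m); apply: (tC _ _ I I); exists w.
pose k j w : R[i] := (Num.sqrt (q j w * \1_(D j) w))%:C.
have q0 j w : 0 <= q j w by case: (qP j).
have nk j w : normc (k j w) ^+ 2 = q j w * \1_(D j) w.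
  by rewrite normcR real_normK ?num_real// sqr_sqrtr// mulr_ge0.
have kC j m w : C (c j m) w -> k j w = (Num.sqrt (q j w))%:C.
  by move=> Cw; rewrite /k indicE mem_set ?mulr1//; exists m.
have k0 i j m w : C (c j m) w -> i != j -> k i w = 0.
  move=> Cw ij; rewrite /k indicE memNset ?mulr0 ?sqrtr0// => Dw.
  by rewrite (CD _ _ _ _ Cw Dw) eqxx in ij.
have mk j : cmeasurable (setT : set mR) (k j).
  apply: cmeasurableR; apply: (measurableT_comp (f := @Num.sqrt R)).
    by apply: continuous_measurable_fun; exact: sqrt_continuous.
  by apply: measurable_funM; [case: (qP j)|exact: measurable_indic].
have Lk j : L2 leb setT (k j).
  apply/L2P; split => //; have [mq _ sq _] := qP j; apply: le_lt_trans sq.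
  apply: ge0_le_integral => //.
  - by move=> w _; rewrite lee_fin sqr_ge0.
  - exact: emeasurable_normc_sqr.
  - exact/measurable_EFinP.
  - by move=> w _; rewrite lee_fin nk ler_piMr// indicE lern1 leq_b1.
have /choice[F FP] j : exists F, S F /\ exists a : 'I_n -> R[i],
    U (k j) = (fun x => A F x + \sum_(i < n) a i * e i x) %[ae mu in G].
  by have [F SF aP] := H _ (S_U (Lk j)); exists F.
have /choice[a aP] j : exists a : 'I_n -> R[i],
    U (k j) = (fun x => A (F j) x + \sum_(i < n) a i * e i x) %[ae mu in G].
  by case: (FP j).
(* n + 1 vectors of n coefficients are dependent: in the combination of the [k j] with coefficients
   [dl] the components along the [e i] cancel, which leaves an element g t of the range. *)
have [dl dl0 dM] := left_kernel_neq0 (\matrix_(j < n.+1, i < n) a j i).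
pose f j := kof (F j); pose h i := kof (e i).
have Lf j : L2 leb setT (f j) by case: (kofP (FP j).1).
have Lh i : L2 leb setT (h i) by case: (kofP (Se i)).
have kE j : k j = (fun w => g w * f j w + \sum_(i < n) a j i * h i w) %[ae leb in setT].
  have L1 : L2 leb setT (fun w => g w * f j w) by exact: L2_symbol.
  have L2s : L2 leb setT (fun w => \sum_(i < n) a j i * h i w).
    by apply: (L2_sum measurableT).
  apply: U_inj => //; first exact: (L2D measurableT).
  have he : \forall z \ae mu, forall i : 'I_n, G z -> e i z = U (h i) z.
    by apply: ae_forall => i; case: (kofP (Se i)).
  have Af := Ag _ _ (FP j).1 (Lf j) (kofP (FP j).1).2.
  apply: ae_impl3 (aP j) he Af => z az ez Az Gz.
  rewrite (az Gz) (Az Gz) -[RHS]/(U (fun w => g w * f j w + \sum_(i < n) a j i * h i w) z).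
  have -> : (fun w => g w * f j w + \sum_(i < n) a j i * h i w) =
      (fun w => 1 * (g w * f j w) + \sum_(i < n) a j i * h i w).
    by apply/funext => w; rewrite mul1r.
  rewrite U_lin// mul1r U_sum//; congr (_ + _).
  by apply: eq_bigr => i _; rewrite (ez i Gz).
pose t w := \sum_(j < n.+1) dl 0 j * f j w.
have Lt : L2 leb setT t by apply: (L2_sum measurableT).
have kt : \forall w \ae leb, \sum_(j < n.+1) dl 0 j * k j w = g w * t w.
  have := ae_forall kE; apply: ae_impl => w kw.
  under eq_bigr do rewrite (kw _ I) mulrDr mulr_sumr.
  rewrite big_split/= exchange_big/= [X in _ + X]big1 ?addr0.
    by rewrite mulr_sumr; apply: eq_bigr => j _; rewrite mulrCA.
  move=> i _; under eq_bigr do rewrite mulrA.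
  rewrite -mulr_suml; have /matrixP/(_ 0 i) := dM; rewrite !mxE.
  by under eq_bigr do rewrite mxE; move=> ->; rewrite mul0r.
have [j dj] : exists j, dl 0 j != 0.
  apply: contrapT => nj; move/negP: dl0; apply; apply/eqP/rowP => j; rewrite mxE.
  by apply: contrapT => /eqP djn; apply: nj; exists j.
pose N := normc (dl 0 j) ^+ 2.
have N0 : 0 < N by rewrite exprn_gt0// lt0r normc_ge0 normc_eq0 dj.
have [mq _ _ qC] := qP j.
pose V := fine (sqnorm leb setT t).
(* On the m-th set of the class j only [k j] survives, and |g| <= 2^-m there. Integrating |dl_j
   k_j|^2 = |g t|^2 over that set gives N 2^-m <= 4^-m V, so that N 2^m would stay below V for every
   m. *)
have key m : N * 2^-1 ^+ m <= (2^-1 ^+ m) ^+ 2 * V.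
  have mCm := mC (c j m).
  have le1 : (N%:E * \int[leb]_(w in C (c j m)) (q j w)%:E <=
      ((2^-1 ^+ m) ^+ 2)%:E * \int[leb]_(w in C (c j m)) (normc (t w) ^+ 2)%:E)%E.
    have mt : measurable_fun (C (c j m)) (fun w => (normc (t w) ^+ 2)%:E).
      by apply: measurable_funTS; apply: emeasurable_normc_sqr; exact: L2_cmeasurable Lt.
    have mqC : measurable_fun (C (c j m)) (fun w => (q j w)%:E).
      by apply: measurable_funTS; exact/measurable_EFinP.
    rewrite -!ge0_integralZl_EFin ?sqr_ge0 ?(ltW N0)//; last 2 first.
    - by move=> w _; rewrite lee_fin sqr_ge0.
    - by move=> w _; rewrite lee_fin.
    apply: ae_ge0_le_integral => //.
    - by move=> w _; rewrite -EFinM lee_fin mulr_ge0 ?(ltW N0).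
    - by apply: emeasurable_funM => //; exact: measurable_cst.
    - by move=> w _; rewrite mule_ge0// lee_fin sqr_ge0.
    - by apply: emeasurable_funM => //; exact: measurable_cst.
    apply: ae_impl kt => w kw Cw; rewrite -!EFinM lee_fin.
    have <- : normc (dl 0 j * k j w) ^+ 2 = N * q j w.
      rewrite normcM exprMn (kC _ _ _ Cw) normcR real_normK ?num_real//.
      by rewrite sqr_sqrtr.
    have -> : dl 0 j * k j w = g w * t w.
      rewrite -kw (bigD1 j)//= big1 ?addr0// => i ij.
      by rewrite (k0 _ _ _ _ Cw ij) mulr0.
    rewrite normcM exprMn ler_wpM2r ?sqr_ge0// ler_sqr ?nnegrE ?normc_ge0 ?exprn_ge0//.
    have [_ /ltW gw] := CS _ _ Cw; apply: le_trans gw _.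
    by apply: ler_wiXn2l => //; [rewrite invf_le1// ler1n|rewrite /c mulnS -addnA leq_addr].
  rewrite -lee_fin (EFinM N) (EFinM _ V) /V fineK ?sqnorm_fin//.
  apply: le_trans (lee_wpmul2l _ (qC m)) (le_trans le1 _).
    by rewrite lee_fin ltW.
  apply: lee_wpmul2l; first by rewrite lee_fin sqr_ge0.
  apply: ge0_subset_integral => //; last by move=> w _; rewrite lee_fin sqr_ge0.
  by apply: emeasurable_normc_sqr; exact: L2_cmeasurable Lt.
have key2 m : N * 2 ^+ m <= V.
  have := key m; rewrite expr2 -mulrA [N * _]mulrC ler_pM2l// => hm.
  have : 2 ^+ m * N <= 2 ^+ m * (2^-1 ^+ m * V) by rewrite ler_pM2l ?exprn_gt0.
  by rewrite mulrA -exprMn divff// expr1n mul1r mulrC.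
pose m := Num.Def.truncn (V / N).
have : V / N < m.+1%:R by exact: truncnS_gt.
rewrite ltr_pdivrMr// => /(le_lt_trans (key2 m.+1)).
rewrite mulrC ltr_pM2r// -natrX ltr_nat ltnNge => /negP; apply.
by apply: ltnW; exact: ltn_expl.
Qed.

Definition approached g (lambda : R[i]) :=
  forall e : R, 0 < e -> exists2 w, freq w & normc (g w - lambda) < e.

(** The implications close a cycle, which settles both spectra at once: a value that is not
    approached gives an invertible shift, an invertible operator is Fredholm, and a Fredholm shift
    excludes approached values. *)
Lemma spectrum_multiplication A g : (forall F, S F -> S (A F)) -> bounded_symbol g ->
  multiplies A g ->
  (forall lambda (e : R), 0 < e -> open [set w | freq w /\ normc (g w - lambda) < e]) ->
  spectrum mu G S A = [set lambda | approached g lambda] /\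
  ess_spectrum mu G S A = [set lambda | approached g lambda].
Proof.
move=> SA bg Ag og.
have SAl lambda F : S F -> S (Defs.shift A lambda F) by exact: S_shift.
have bgl lambda := bounded_symbolB lambda bg.
have Agl lambda := multiplies_shift lambda Ag bg.
have inv lambda : ~ approached g lambda -> invertible mu G S (Defs.shift A lambda).
  move=> na; have [e e0 eg] : exists2 e : R, 0 < e & forall w, freq w -> e <= normc (g w - lambda).
    apply: contrapT => ne; apply: na => e e0; apply: contrapT => nw; apply: ne.
    exists e => // w fw; rewrite leNgt; apply/negP => h; apply: nw; by exists w.
  exact: multiplies_invertible (bgl lambda) (SAl lambda) (Agl lambda) e0 eg.
have fred lambda : approached g lambda -> ~ fredholm mu G S (Defs.shift A lambda).
  move=> ap [_ _]; apply: (infinite_codim (SAl lambda) (bgl lambda) (Agl lambda)) => //.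
  exact: og.
split; apply/seteqP; split=> lambda /=.
- by move=> ni; apply: contrapT => na; apply: ni; exact: inv.
- by move=> ap /(invertible_fredholm (SAl lambda)); exact: fred.
- by move=> nf; apply: contrapT => /inv/(invertible_fredholm (SAl lambda)).
- exact: fred.
Qed.

End multiplication_model.

Lemma ae_ball (R : realType) (P : R -> Prop) (w0 e : R) : 0 < e ->
  (\forall w \ae @lebesgue_measure R, P w) -> exists2 w, `|w - w0| < e & P w.
Proof.
move=> e0 aP; apply: contrapT => nP.
have [N [mN N0 PN]] := aP.
have : `]w0 - e, w0 + e[%classic `<=` N.
  move=> w /=; rewrite in_itv/= => /andP[h1 h2]; apply: PN => /= Pw; apply: nP.
  by exists w => //; rewrite ltr_distl h1.
have e1 : @lebesgue_measure R `]w0 - e, w0 + e[%classic = (2 * e)%:E.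
  rewrite lebesgue_measure_itv/= lte_fin ifT; last lra.
  by rewrite -EFinD; congr EFin; ring.
move=> sub; have : (@lebesgue_measure R `](w0 - e)%R, (w0 + e)%R[%classic <= @lebesgue_measure R N)%E.
  by apply: le_measure; rewrite ?inE.
by rewrite [X in (X <= _)%E]e1 [X in (_ <= X)%E]N0 lee_fin => h; lra.
Qed.

(** * Toeplitz operators are multiplications by gamma *)

Section symbol.
Context (R : realType).
Local Notation leb := (@lebesgue_measure R).
Local Notation mR := (measurableTypeR R).
Variable m1 : {sigma_finite_measure set mR -> \bar R}.
Variable D1 : set mR.
Hypothesis mD1 : measurable D1.
Variable l : R -> R -> R[i].
Variable s : R.
Hypothesis s2pi : s ^+ 2 = (2 * pi) ^+ 2.
Variable freq : set R.
Local Notation G := (D1 `*` [set: mR]).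
Local Notation mu := (m1 \x leb)%E.
Hypothesis ml : cmeasurable G (fun z => l z.1 z.2).
Hypothesis Ll : forall r, D1 r -> L2 leb setT (l r).
Hypothesis l1 : forall w, freq w -> (\int[m1]_(r in D1) (normc (l r w) ^+ 2)%:E = 1)%E.
Hypothesis aefreq : \forall w \ae leb, freq w.
Hypothesis openfreq : open freq.
Hypothesis l_cont : forall w0, freq w0 -> forall e : R, 0 < e -> exists2 d : R, 0 < d &
  forall w, freq w -> `|w - w0| < d ->
  (\int[m1]_(r in D1) `|normc (l r w) ^+ 2 - normc (l r w0) ^+ 2|%:E <= e%:E)%E.
Variable alpha : R -> R[i].
Hypothesis malpha : cmeasurable D1 alpha.
Hypothesis Lalpha : forall k, L2 leb setT k -> L2 mu G (fun z => alpha z.1 * wt l s k z).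
Implicit Types (k h : R -> R[i]).

Let mG : measurable G. Proof. exact: measurableX. Qed.
Let b r := normc (alpha r) ^+ 2.
Let b0 r : 0 <= b r. Proof. exact: sqr_ge0. Qed.
Let mb : measurable_fun D1 b. Proof. exact: measurable_normc_sqr. Qed.
Local Notation Gam := (Gam m1 D1 l).

Let mGam : measurable_fun (setT : set mR) (Gam b).
Proof. exact: measurable_Gam. Qed.

Let mls w : measurable_fun D1 (fun r => normc (l r w) ^+ 2).
Proof. by apply: measurable_normc_sqr; exact: (cmeasurable_section2 mD1 w ml). Qed.

(* Otherwise some [k] in L_2 charges all the sets [Gam b > 4 ^ m] so much that
   [alpha * wt l s k] is not in L_2. *)
Lemma Gam_ae_bounded : exists C : R, \forall w \ae leb, (Gam b w <= C%:E)%E.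
Proof.
apply: contrapT => nC.
(* The level 4^m against the mass 2^-m provided by [bump] forces the integral above 2^m for every
   m. *)
pose E m : set mR := [set w | ((4 ^+ m)%:E < Gam b w)%E].
have mE m : measurable (E m).
  by rewrite -[E m]setTI; exact: emeasurable_fun_o_infty.
have E0 m : (0 < leb (E m))%E.
  rewrite lt0e measure_ge0 andbT; apply/eqP => Em; apply: nC; exists (4 ^+ m).
  exists (E m); split => //.
  by move=> w /= /negP; rewrite -ltNge.
have [q [mq q0 sq qE]] := bump mE E0.
pose k w : R[i] := (Num.sqrt (q w))%:C.
have nk w : normc (k w) ^+ 2 = q w.
  by rewrite normcR real_normK ?num_real// sqr_sqrtr.
have Lk : L2 leb setT k.
  apply/L2P; split.
    apply: cmeasurableR; apply: (measurableT_comp (f := @Num.sqrt R)) mq.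
    by apply: continuous_measurable_fun; exact: sqrt_continuous.
  by rewrite /sqnorm; under eq_integral do rewrite nk.
have := L2_sqnorm_lty (Lalpha Lk).
have -> : sqnorm mu G (fun z => alpha z.1 * wt l s k z) =
    (\int[leb]_w ((normc (k w) ^+ 2)%:E * Gam b w))%E.
  rewrite -(integral_wt mD1 s2pi ml Ll l1 aefreq Lk mb b0).
  by apply: eq_integral => z _; rewrite normcM exprMn.
set V := (\int[leb]_w _)%E => Voo.
have Vm m : ((2 ^+ m)%:E <= V)%E.
  apply: (@le_trans _ _ (\int[leb]_(w in E m) ((4 ^+ m)%:E * (q w)%:E))%E).
    have mqE : measurable_fun (E m) (fun w => (q w)%:E).
      by apply: measurable_funTS; exact/measurable_EFinP.
    rewrite ge0_integralZl_EFin ?exprn_ge0//; last by move=> w _; rewrite lee_fin.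
    apply: le_trans (lee_wpmul2l _ (qE m)); last by rewrite lee_fin exprn_ge0.
    rewrite -EFinM lee_fin -exprMn; have -> : 4 * 2^-1 = 2 :> R by field.
    exact: lexx.
  apply: (@le_trans _ _ (\int[leb]_(w in E m) ((normc (k w) ^+ 2)%:E * Gam b w))%E).
    apply: ge0_le_integral => //.
    - by move=> w _; rewrite -EFinM lee_fin mulr_ge0// exprn_ge0.
    - apply: measurable_funTS; apply: emeasurable_funM; first exact: measurable_cst.
      exact/measurable_EFinP.
    - apply: measurable_funTS; apply: emeasurable_funM => //.
      by apply: emeasurable_normc_sqr; exact: L2_cmeasurable Lk.
    - by move=> w /ltW Ew; rewrite nk muleC lee_wpmul2l// lee_fin.
  apply: ge0_subset_integral => //.
  - apply: emeasurable_funM => //.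
    by apply: emeasurable_normc_sqr; exact: L2_cmeasurable Lk.
  - move=> w _; rewrite mule_ge0 ?lee_fin ?sqr_ge0//; exact: Gam_ge0.
have V0 : (0 <= V)%E by apply: le_trans (Vm 0%N); rewrite lee_fin.
have fV : V \is a fin_num by rewrite ge0_fin_numE.
pose m := (Num.Def.truncn (fine V)).+1.
have : fine V < m%:R by exact: truncnS_gt.
have := Vm m; rewrite -(fineK fV) lee_fin => h1 h2.
have := le_lt_trans h1 h2; rewrite -natrX ltr_nat ltnNge => /negP; apply.
by apply: ltnW; exact: ltn_expl.
Qed.

Let bN (N : nat) r := Num.min (b r) N%:R.
Let bN0 N r : 0 <= bN N r. Proof. by rewrite le_min b0/=. Qed.
Let mbN N : measurable_fun D1 (bN N).
Proof. by apply: measurable_minr => //; exact: measurable_cst. Qed.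

Let Gam_bN_le N w : (Gam (bN N) w <= Gam b w)%E.
Proof.
apply: ge0_le_integral => //.
- by move=> r _; rewrite lee_fin mulr_ge0 ?sqr_ge0.
- by apply/measurable_EFinP; apply: measurable_funM; [exact: mbN|exact: mls].
- by apply/measurable_EFinP; apply: measurable_funM; [exact: mb|exact: mls].
- by move=> r _; rewrite lee_fin ler_wpM2r ?sqr_ge0// ge_min lexx.
Qed.

Let Gam_bN_cont N w w0 : (Gam (bN N) w0 <= Gam (bN N) w +
  N%:R%:E * \int[m1]_(r in D1) `|normc (l r w) ^+ 2 - normc (l r w0) ^+ 2|%:E)%E.
Proof.
have mdl : measurable_fun D1 (fun r => `|normc (l r w) ^+ 2 - normc (l r w0) ^+ 2|%:E).
  apply/measurable_EFinP; apply: measurableT_comp => //.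
  by apply: measurable_funB; exact: mls.
have m_bl u : measurable_fun D1 (fun r => (bN N r * normc (l r u) ^+ 2)%:E).
  by apply/measurable_EFinP; apply: measurable_funM; [exact: mbN|exact: mls].
rewrite -ge0_integralZl_EFin// -ge0_integralD//; last 2 first.
- by move=> r _; rewrite lee_fin mulr_ge0 ?sqr_ge0.
- by apply: emeasurable_funM => //; exact: measurable_cst.
apply: ge0_le_integral => //.
- by move=> r _; rewrite lee_fin mulr_ge0 ?sqr_ge0.
- apply: emeasurable_funD => //.
  by apply: emeasurable_funM => //; exact: measurable_cst.
move=> r _; rewrite -EFinM -EFinD lee_fin.
set x := normc _ ^+ 2; set y := normc _ ^+ 2.
have h1 : bN N r * (x - y) <= bN N r * `|y - x|.
  by apply: ler_wpM2l => //; rewrite distrC ler_norm.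
have h2 : bN N r * `|y - x| <= N%:R * `|y - x|.
  by apply: ler_wpM2r => //; rewrite ge_min lexx orbT.
rewrite -lerBlDl; apply: le_trans h2; apply: le_trans h1; by rewrite mulrBr.
Qed.

(* The integrals truncated at [b <= N] are continuous in the frequency, so they
   inherit the almost everywhere bound at every point. *)
Lemma Gam_bounded : exists2 C : R, 0 <= C & forall w, freq w -> (Gam b w <= C%:E)%E.
Proof.
have [C aC] := Gam_ae_bounded.
have C0 : 0 <= C.
  have [w _ wC] := ae_ball 0 (@ltr01 R) aC.
  by rewrite -lee_fin; apply: le_trans wC; exact: Gam_ge0.
exists C => // w0 fw0.
have bound N : (Gam (bN N) w0 <= C%:E)%E.
  apply/lee_addgt0Pr => e e0.
  (* N + 1 instead of N, so that N = 0 is covered; N times this bound is still at most e. *)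
  have eN : 0 < e / N.+1%:R by rewrite divr_gt0.
  have [d d0 dP] := l_cont fw0 eN.
  have aP : \forall w \ae leb, freq w /\ (Gam b w <= C%:E)%E.
    by apply: ae_impl2 aefreq aC.
  have [w wd [fw wC]] := ae_ball w0 d0 aP.
  apply: le_trans (Gam_bN_cont N w w0) _; apply: leeD.
    exact: le_trans (Gam_bN_le N w) wC.
  apply: le_trans (lee_wpmul2l _ (dP w fw wd)) _; first by rewrite lee_fin.
  rewrite -EFinM lee_fin mulrCA ler_piMr ?(ltW e0)//.
  by rewrite ler_pdivrMr// mul1r ler_nat.
have mbl N : measurable_fun D1 (fun r => (bN N r * normc (l r w0) ^+ 2)%:E).
  by apply/measurable_EFinP; apply: measurable_funM; [exact: mbN|exact: mls].
have cv : (fun N => Gam (bN N) w0) @ \oo --> Gam b w0.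
  have -> : Gam b w0 = (\int[m1]_(r in D1) limn (fun N => (bN N r * normc (l r w0) ^+ 2)%:E))%E.
    apply: eq_integral => r _; apply/esym/cvg_lim => //.
    apply: cvg_near_cst; near=> N; congr (_ * _)%:E; apply/min_idPl.
    apply: (@le_trans _ _ (Num.Def.truncn (b r)).+1%:R); first by apply: ltW; exact: truncnS_gt.
    by rewrite ler_nat; near: N; exact: nbhs_infty_ge.
  apply: cvg_monotone_convergence => //.
  - by move=> N r _; rewrite lee_fin mulr_ge0 ?sqr_ge0.
  - move=> r _ N M NM; rewrite lee_fin ler_wpM2r ?sqr_ge0// /bN.
    by rewrite le_min ge_min lexx/= ge_min ler_nat NM orbT.
rewrite -(cvg_lim _ cv)//; apply: lime_le; first by apply/cvg_ex; exists (Gam b w0).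
by apply: nearW => N; exact: bound.
Unshelve. all: by end_near. Qed.

Lemma integrable_l2 w : freq w -> m1.-integrable D1 (fun r => (normc (l r w) ^+ 2)%:E).
Proof.
move=> fw; apply/integrableP; split; first by apply/measurable_EFinP; exact: mls.
under eq_integral do rewrite gee0_abs ?lee_fin ?sqr_ge0//.
by rewrite l1// ltry.
Qed.

Lemma integrable_bl2 w : freq w -> m1.-integrable D1 (fun r => (b r * normc (l r w) ^+ 2)%:E).
Proof.
move=> fw; have [C C0 CP] := Gam_bounded; apply/integrableP; split.
  by apply/measurable_EFinP; apply: measurable_funM => //; exact: mls.
apply: le_lt_trans (ltry C); apply: le_trans (CP w fw).
rewrite le_eqVlt; apply/orP; left; apply/eqP; apply: eq_integral => r _.
by rewrite gee0_abs// lee_fin mulr_ge0 ?sqr_ge0.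
Qed.

Definition gam w : R[i] := cintegral m1 D1 (fun r => alpha r * (normc (l r w) ^+ 2)%:C).

Let malpha_l2 w : cmeasurable D1 (fun r => alpha r * (normc (l r w) ^+ 2)%:C).
Proof. by apply: cmeasurableM => //; apply: cmeasurableR; exact: mls. Qed.

Let le_1D_sqr (x : R) : x <= 1 + x ^+ 2.
Proof. by have := sqr_ge0 (x - 1); nra. Qed.

(** |alpha| <= 1 + |alpha|^2 dominates the integrand by two integrable functions, although alpha may
    be unbounded. *)
Lemma gam_integrable w : freq w ->
  cintegrable m1 D1 (fun r => alpha r * (normc (l r w) ^+ 2)%:C).
Proof.
move=> fw; apply: (@cintegrable_le _ _ _ _ _ mD1 _
  (fun r => normc (l r w) ^+ 2 + b r * normc (l r w) ^+ 2)) => //.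
  exact: (integrableD mD1 (integrable_l2 fw) (integrable_bl2 fw)).
move=> r _; rewrite normcM normcR ger0_norm ?sqr_ge0//.
by rewrite -[X in _ <= X + _]mul1r -mulrDl; apply: ler_wpM2r; [exact: sqr_ge0|exact: le_1D_sqr].
Qed.

Lemma gam_bounded : exists M : R, forall w, freq w -> normc (gam w) <= M.
Proof.
have [C C0 CP] := Gam_bounded; exists (2 * (1 + C)) => w fw.
rewrite -lee_fin; apply: le_trans (EFin_normc_cintegral_le mD1 (gam_integrable fw)) _.
rewrite EFinM; apply: lee_wpmul2l => //.
apply: (@le_trans _ _ (\int[m1]_(r in D1) ((normc (l r w) ^+ 2)%:E +
    (b r * normc (l r w) ^+ 2)%:E))%E).
  apply: ge0_le_integral => //.
  - by move=> r _; rewrite lee_fin normc_ge0.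
  - by apply/measurable_EFinP; exact: measurable_normc.
  - apply: emeasurable_funD; first by apply/measurable_EFinP; exact: mls.
    by apply/measurable_EFinP; apply: measurable_funM => //; exact: mls.
  - move=> r _; rewrite -EFinD lee_fin normcM normcR ger0_norm ?sqr_ge0//.
    rewrite -[X in _ <= X + _]mul1r -mulrDl; apply: ler_wpM2r; first exact: sqr_ge0.
    exact: le_1D_sqr.
rewrite ge0_integralD//.
- by rewrite l1// EFinD leeD2l// CP.
- by move=> r _; rewrite lee_fin sqr_ge0.
- by apply/measurable_EFinP; exact: mls.
- by move=> r _; rewrite lee_fin mulr_ge0 ?sqr_ge0.
- by apply/measurable_EFinP; apply: measurable_funM => //; exact: mls.
Qed.

(** For unbounded alpha the L_1 continuity of |l|^2 does not suffice. The bound |alpha| <= N +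
    |alpha|^2 / N splits the integral into a part that is small by this continuity and a part of
    order C / N. *)
Lemma gam_cont w0 (e : R) : freq w0 -> 0 < e -> exists2 d : R, 0 < d &
  forall w, freq w -> `|w - w0| < d -> normc (gam w - gam w0) < e.
Proof.
move=> fw0 e0; have [C C0 CP] := Gam_bounded.
(* Chosen so that, with the factor 2 of [EFin_normc_cintegral_le], the two parts contribute at most
   2 (e / 8) and 2 (e / 4). *)
pose N := 8 * (C + 1) / e.
have N0 : 0 < N by rewrite divr_gt0// mulr_gt0// ltr_wpDl.
have e'0 : 0 < e / (8 * N) by rewrite divr_gt0// mulr_gt0.
have [d d0 dP] := l_cont fw0 e'0.
exists d => // w fw wd.
have mdl : measurable_fun D1 (fun r => `|normc (l r w) ^+ 2 - normc (l r w0) ^+ 2|%:E).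
  apply/measurable_EFinP; apply: measurableT_comp => //.
  by apply: measurable_funB; exact: mls.
have mbl u : measurable_fun D1 (fun r => (b r * normc (l r u) ^+ 2)%:E).
  by apply/measurable_EFinP; apply: measurable_funM; [exact: mb|exact: mls].
have cB := cintegrableB mD1 (gam_integrable fw) (gam_integrable fw0).
rewrite /gam -cintegralB//; last 2 first.
- exact: gam_integrable.
- exact: gam_integrable.
rewrite -lte_fin; apply: le_lt_trans (EFin_normc_cintegral_le mD1 cB) _.
have bl0 u r : (0 <= (b r * normc (l r u) ^+ 2)%:E)%E by rewrite lee_fin mulr_ge0 ?sqr_ge0.
have i1 : (\int[m1]_(r in D1) (normc (alpha r * (normc (l r w) ^+ 2)%:C -
      alpha r * (normc (l r w0) ^+ 2)%:C))%:E <=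
    \int[m1]_(r in D1) (N%:E * `|normc (l r w) ^+ 2 - normc (l r w0) ^+ 2|%:E +
      N^-1%:E * ((b r * normc (l r w) ^+ 2)%:E + (b r * normc (l r w0) ^+ 2)%:E)))%E.
  apply: ge0_le_integral => //.
  - by move=> r _; rewrite lee_fin normc_ge0.
  - by apply/measurable_EFinP; apply: measurable_normc; case: cB.
  - apply: emeasurable_funD.
      by apply: emeasurable_funM => //; exact: measurable_cst.
    apply: emeasurable_funM; first exact: measurable_cst.
    by apply: emeasurable_funD.
  move=> r _; rewrite -[X in (_ <= X)%E]/((N * `|normc (l r w) ^+ 2 - normc (l r w0) ^+ 2| +
    N^-1 * (b r * normc (l r w) ^+ 2 + b r * normc (l r w0) ^+ 2))%:E).
  rewrite lee_fin -mulrBr -[_%:C - _%:C](rmorphB (real_complex R)).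
  rewrite normcM normcR /b; have := normc_ge0 (alpha r).
  move: (normc (alpha r)) (normc (l r w)) (normc (l r w0)) => a x y a0.
  have aN : a <= N + N^-1 * a ^+ 2.
    rewrite -(ler_pM2l N0) mulrDr mulVKf ?gt_eqF//.
    by have := sqr_ge0 (a - N); have := mulr_ge0 a0 (ltW N0); nra.
  apply: le_trans (ler_wpM2r (normr_ge0 _) aN) _.
  rewrite mulrDl lerD2l -mulrDr -mulrA; apply: ler_wpM2l; first by rewrite invr_ge0 ltW.
  apply: ler_wpM2l; first exact: sqr_ge0.
  by rewrite ler_norml; have := sqr_ge0 x; have := sqr_ge0 y => ? ?; apply/andP; split; lra.
apply: le_lt_trans (lee_wpmul2l _ i1) _ => //.
have i2 : (\int[m1]_(r in D1) (N%:E * `|normc (l r w) ^+ 2 - normc (l r w0) ^+ 2|%:E +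
      N^-1%:E * ((b r * normc (l r w) ^+ 2)%:E + (b r * normc (l r w0) ^+ 2)%:E)) =
    N%:E * \int[m1]_(r in D1) `|normc (l r w) ^+ 2 - normc (l r w0) ^+ 2|%:E +
    N^-1%:E * (Gam b w + Gam b w0))%E.
  have Ni : 0 <= N^-1 by rewrite invr_ge0 ltW.
  rewrite ge0_integralD//; last 4 first.
  - by move=> r _; rewrite mule_ge0// lee_fin ltW.
  - by apply: emeasurable_funM => //; exact: measurable_cst.
  - by move=> r _; rewrite mule_ge0// ?adde_ge0// lee_fin.
  - by apply: emeasurable_funM; [exact: measurable_cst|exact: emeasurable_funD].
  rewrite ge0_integralZl_EFin//; last exact: ltW.
  rewrite ge0_integralZl_EFin//; last 2 first.
  - by move=> r _; rewrite adde_ge0.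
  - exact: emeasurable_funD.
  by rewrite ge0_integralD.
rewrite i2.
apply: (@le_lt_trans _ _ (2%:E * (N%:E * (e / (8 * N))%:E + N^-1%:E * (C%:E + C%:E)))%E).
  apply: lee_wpmul2l => //; apply: leeD; apply: lee_wpmul2l.
  - by rewrite lee_fin ltW.
  - exact: dP.
  - by rewrite lee_fin invr_ge0 ltW.
  - by apply: leeD; exact: CP.
rewrite -[X in (X < _)%E]/((2 * (N * (e / (8 * N)) + N^-1 * (C + C)))%:E) lte_fin.
have e1 : N * (e / (8 * N)) = e / 8 by field; rewrite gt_eqF.
have e2 : N^-1 * (C + C) <= e / 4.
  rewrite ler_pdivrMl// /N.
  have -> : 8 * (C + 1) / e * (e / 4) = 2 * (C + 1) by field; rewrite gt_eqF.
  lra.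
by rewrite e1; lra.
Qed.

(** Set to 0 off [freq], where nothing bounds [gam]; as a multiplier it matters only almost
    everywhere. *)
Definition gam0 w : R[i] := gam w * (\1_freq w : R)%:C.

Lemma gam0E w : freq w -> gam0 w = gam w.
Proof. by move=> fw; rewrite /gam0 indicE mem_set// mulr1. Qed.

Lemma gam0_bounded_symbol : bounded_symbol gam0.
Proof.
split; last first.
  have [M MP] := gam_bounded; exists `|M| => w; rewrite /gam0 normcM normcR indicE.
  case: (boolP (w \in freq)) => [|_]; last by rewrite normr0 mulr0.
  by rewrite inE => fw; rewrite normr1 mulr1 (le_trans (MP _ fw))// ler_norm.
apply: cmeasurableM; last first.
  by apply: cmeasurableR; apply: measurable_indic; exact: open_measurable.
apply: (@cmeasurable_cintegral2 _ _ mR mR R m1 D1 mD1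
  (fun z => alpha z.1 * (normc (l z.1 z.2) ^+ 2)%:C)).
apply: cmeasurableM; first exact: cmeasurable_fstG.
by apply: cmeasurableR; exact: measurable_normc_sqr.
Qed.

Lemma open_gam0 (lambda : R[i]) (e : R) : 0 < e ->
  open [set w | freq w /\ normc (gam0 w - lambda) < e].
Proof.
move=> e0; rewrite openE => w [fw we].
have [d1 /= d10 d1P] := (nbhs_ballP _ _).1 (open_nbhs_nbhs (conj openfreq fw)).
have e1 : 0 < e - normc (gam0 w - lambda) by rewrite subr_gt0.
have [d2 d20 d2P] := gam_cont fw e1.
apply/nbhs_ballP; exists (Num.min d1 d2) => /=; first by rewrite lt_min d10.
move=> u; rewrite /ball/= lt_min => /andP[u1 u2].
have fu : freq u by exact: d1P.
split => //; rewrite gam0E//; rewrite gam0E// in e1 d2P.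
rewrite distrC in u2; have := d2P u fu u2.
have := normc_triangle (gam u - gam w) (gam w - lambda).
by rewrite subrKA => /le_lt_trans h1 h2; apply: h1; rewrite -ltrBrDr.
Qed.

(* Plancherel in the second variable, then Fubini. *)
Lemma inner_symbol_wt k h : L2 leb setT k -> L2 leb setT h ->
  inner mu G (fun z => alpha z.1 * wt l s k z) (wt l s h) =
  inner leb setT (fun w => gam0 w * k w) h.
Proof.
move=> Lk Lh; have mk := L2_cmeasurable Lk; have mh := L2_cmeasurable Lh.
have LW := L2_wt mD1 s2pi ml Ll l1 aefreq Lh.
have cW := inner_cintegrable mG (Lalpha Lk) LW.
rewrite /inner (@cintegral_rect1 _ _ mR mR R m1 leb D1 mD1 _ cW) /=.
have [C C0 CP] := Gam_bounded.
(* Exchanging the integrals needs alpha k l and h l in L_2(G); the norm of the former equals that of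
   alpha [wt l s k], which is finite by assumption. *)
have Lakl : L2 mu G (fun z => alpha z.1 * (k z.2 * l z.1 z.2)).
  have makl : cmeasurable G (fun z => alpha z.1 * (k z.2 * l z.1 z.2)).
    apply: cmeasurableM; first exact: cmeasurable_fstG.
    by apply: cmeasurableM => //; exact: cmeasurable_sndG.
  apply/L2P; split => //.
  have e : (sqnorm mu G (fun z => alpha z.1 * (k z.2 * l z.1 z.2))%R =
      \int[leb]_w ((normc (k w) ^+ 2)%:E * Gam b w))%E.
    rewrite -(integral_Gam m1 mD1 ml Lk mb b0).
    rewrite /sqnorm (@rect_tonelli1 _ _ mR mR R m1 leb D1 mD1 (fun z => (normc (alpha z.1 * (k z.2 * l z.1 z.2)) ^+ 2)%:E)).
    - by apply: eq_integral => r _; apply: eq_integral => w _; rewrite /= [in LHS]normcM exprMn.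
    - by apply: emeasurable_normc_sqr.
    - by move=> z _; rewrite lee_fin sqr_ge0.
  rewrite e -(integral_wt mD1 s2pi ml Ll l1 aefreq Lk mb b0).
  have := L2_sqnorm_lty (Lalpha Lk); congr (_ < _)%E.
  by apply: eq_integral => z _; rewrite normcM exprMn.
have Lhl : L2 mu G (fun z => h z.2 * l z.1 z.2).
  have mhl : cmeasurable G (fun z => h z.2 * l z.1 z.2).
    by apply: cmeasurableM => //; exact: cmeasurable_sndG.
  have m1c : measurable_fun D1 (fun=> 1 : R) by exact: measurable_cst.
  apply/L2P; split => //.
  have -> : (sqnorm mu G (fun z => h z.2 * l z.1 z.2)%R = sqnorm mu G (wt l s h))%E.
    transitivity (\int[mu]_(z in G) (1 * normc (wt l s h z) ^+ 2)%:E)%E.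
      rewrite (integral_wt mD1 s2pi ml Ll l1 aefreq Lh m1c (fun=> ler01)).
      rewrite -(integral_Gam m1 mD1 ml Lh m1c (fun=> ler01)).
      rewrite /sqnorm (@rect_tonelli1 _ _ mR mR R m1 leb D1 mD1 (fun z => (normc (h z.2 * l z.1 z.2) ^+ 2)%:E)).
      - by apply: eq_integral => r _; apply: eq_integral => w _; rewrite /= mul1r.
      - by apply: emeasurable_normc_sqr.
      - by move=> z _; rewrite lee_fin sqr_ge0.
    by apply: eq_integral => z _; rewrite mul1r.
  exact: L2_sqnorm_lty.
have cH := inner_cintegrable mG Lakl Lhl.
transitivity (cintegral m1 D1 (fun r => cintegral leb setT (fun w =>
    alpha r * (k w * l r w) * conjc (h w * l r w)))).
  apply: (ae_eq_cintegral mD1).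
  - exact: (@cmeasurable_cintegral1 _ _ mR mR R leb D1 mD1 _ cW.1).
  - exact: (@cmeasurable_cintegral1 _ _ mR mR R leb D1 mD1 _ cH.1).
  apply: ae_impl2 (ae_L2_slice mD1 ml Ll l1 aefreq Lk) (ae_L2_slice mD1 ml Ll l1 aefreq Lh).
  move=> r + + Dr => /(_ Dr) Lkr /(_ Dr) Lhr.
  have ck := wt_integrable Ll Lk Dr; have ch := wt_integrable Ll Lh Dr.
  have e := inner_ft_gen s2pi ck ch Lkr Lhr.
  have LFk := L2_ft_gen s2pi ck Lkr; have LFh := L2_ft_gen s2pi ch Lhr.
  have c1 := inner_cintegrable measurableT LFk LFh.
  have c2 := inner_cintegrable measurableT Lkr Lhr.
  transitivity (alpha r * inner leb setT (ft s (fun w => k w * l r w)) (ft s (fun w => h w * l r w))).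
    rewrite /inner -(cintegralZ measurableT (alpha r) c1).
    by apply: eq_cintegral => t _; rewrite /wt /= mulrA.
  rewrite e /inner -(cintegralZ measurableT (alpha r) c2).
  by apply: eq_cintegral => t _; rewrite mulrA.
rewrite (@cfubini _ _ mR mR R m1 leb D1 mD1 _ cH) /=.
apply: (ae_eq_cintegral measurableT).
- exact: (@cmeasurable_cintegral2 _ _ mR mR R m1 D1 mD1 _ cH.1).
- apply: cmeasurableM; last exact: cmeasurableJ.
  by apply: cmeasurableM => //; case: gam0_bounded_symbol.
apply: ae_impl aefreq => w fw _; rewrite gam0E//.
rewrite -mulrA mulrC -(cintegralZ mD1 _ (gam_integrable fw)).
apply: eq_cintegral => r _; rewrite -mulcJ conjcM; ring.
Qed.

Variable S : set (R * R -> R[i]).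
Hypothesis SP : forall F, S F <-> L2 mu G F /\
  exists2 k, L2 leb setT k & F = wt l s k %[ae mu in G].

Let A F := ortho_proj mu G S (fun z => alpha z.1 * F z).

Let L2_wt' k : L2 leb setT k -> L2 mu G (wt l s k).
Proof. exact: (L2_wt mD1 s2pi ml Ll l1 aefreq). Qed.

Let S_wt k : L2 leb setT k -> S (wt l s k).
Proof.
by move=> Lk; apply/SP; split; [exact: L2_wt'|exists k => //; exact: aeW].
Qed.

Let ae_inner (F F' L : R * R -> R[i]) : L2 mu G F -> L2 mu G F' -> L2 mu G L ->
  F = F' %[ae mu in G] -> inner mu G F L = inner mu G F' L.
Proof.
move=> LF LF' LL FF'; apply: (ae_eq_cintegral mG).
- by apply: cmeasurableM; [exact: L2_cmeasurable LF|apply: cmeasurableJ; exact: L2_cmeasurable LL].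
- by apply: cmeasurableM; [exact: L2_cmeasurable LF'|apply: cmeasurableJ; exact: L2_cmeasurable LL].
- by apply: ae_impl FF' => z + Gz => ->.
Qed.

Let innerC (F L : R * R -> R[i]) : L2 mu G F -> L2 mu G L ->
  inner mu G L F = conjc (inner mu G F L).
Proof.
move=> LF LL; rewrite /inner -(cintegralJ mG (inner_cintegrable mG LF LL)).
by apply: eq_cintegral => z _; rewrite conjcM conjcK mulrC.
Qed.

(** By [inner_symbol_wt] and the isometry, alpha F and [wt l s] of gam0 k have the same inner
    products with all elements of S. So the latter is a projection of alpha F, and two projections
    differ by an element of S orthogonal to itself. *)
Lemma ortho_proj_wt F k : S F -> L2 leb setT k -> F = wt l s k %[ae mu in G] ->
  S (A F) /\ A F = wt l s (fun w => gam0 w * k w) %[ae mu in G].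
Proof.
move=> SF Lk Fk; have Lg : L2 leb setT (fun w => gam0 w * k w).
  by have [mg [M gM]] := gam0_bounded_symbol; apply: (L2Ml measurableT mg (M := M)).
pose H z := alpha z.1 * F z; pose K0 := wt l s (fun w => gam0 w * k w).
have LF : L2 mu G F by move/SP: SF => [].
have mH : cmeasurable G H.
  by apply: cmeasurableM; [exact: cmeasurable_fstG|exact: L2_cmeasurable LF].
have LK0 : L2 mu G K0 by exact: L2_wt'.
have HE : (fun z => alpha z.1 * wt l s k z) = H %[ae mu in G].
  by apply: ae_impl Fk => z + Gz => /(_ Gz) Fz; rewrite /H Fz.
have LH : L2 mu G H by exact: (ae_eq_L2 mG mH HE (Lalpha Lk)).
have HK0 L : S L -> inner mu G H L = inner mu G K0 L.
  move=> /SP[LL [h Lh Lhw]]; have LWh := L2_wt' Lh.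
  rewrite -(ae_inner (Lalpha Lk) LH LL HE).
  rewrite (innerC LL (Lalpha Lk)) (innerC LL LK0); congr conjc.
  rewrite (ae_inner LL LWh (Lalpha Lk) Lhw) (ae_inner LL LWh LK0 Lhw).
  rewrite (innerC (Lalpha Lk) LWh) (innerC LK0 LWh); congr conjc.
  rewrite inner_symbol_wt//.
  by rewrite (inner_wt mD1 s2pi ml Ll l1 aefreq Lg Lh).
have innB K L : L2 mu G K -> L2 mu G L ->
    inner mu G (fun x => H x - K x) L = inner mu G H L - inner mu G K L.
  move=> LK LL; rewrite /inner -(cintegralB mG (inner_cintegrable mG LH LL) (inner_cintegrable mG LK LL)).
  by apply: eq_cintegral => z _; rewrite mulrBl.
(* [K0] satisfies the defining condition, which excludes the default value of the choice. *)
have [SA AO] : S (A F) /\ forall L, S L -> inner mu G (fun x => H x - A F x) L = 0.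
  rewrite /A /ortho_proj -/H; case: xgetP => [K _ //|/(_ K0)]; case; split; first exact: S_wt.
  by move=> L SL; rewrite innB//; [rewrite HK0// subrr|case: ((SP L).1 SL)].
split => //; have [LA [a La Aa]] := (SP _).1 SA.
have LD : L2 mu G (fun z => A F z - K0 z) by exact: (L2B mG).
have SD : S (fun z => A F z - K0 z).
  apply/SP; split => //; exists (fun w => (-1) * (gam0 w * k w) + a w).
    by apply: (L2D measurableT) La; exact: (L2Z measurableT).
  apply: ae_impl Aa => z + Gz => /(_ Gz) Az.
  by rewrite (wt_lin s Ll (-1) Lg La Gz) Az mulN1r addrC.
have e0 : inner mu G (fun z => A F z - K0 z) (fun z => A F z - K0 z) = 0.
  have -> : inner mu G (fun z => A F z - K0 z) (fun z => A F z - K0 z) =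
      inner mu G (A F) (fun z => A F z - K0 z) - inner mu G K0 (fun z => A F z - K0 z).
    rewrite /inner -(cintegralB mG (inner_cintegrable mG LA LD) (inner_cintegrable mG LK0 LD)).
    by apply: eq_cintegral => z _; rewrite mulrBl.
  have := AO _ SD; rewrite innB// HK0// => /eqP; rewrite subr_eq0 => /eqP ->.
  by rewrite subrr.
have : sqnorm mu G (fun z => A F z - K0 z) = 0%E.
  have := innerff mG LD; rewrite e0 => /(congr1 (@complex.Re R)) /= e1.
  by rewrite -(fineK (sqnorm_fin LD)) -e1.
move=> /(sqnorm_eq0 mG (L2_cmeasurable LD)); apply: ae_impl => z + Gz => /(_ Gz) /eqP.
by rewrite subr_eq0 => /eqP.
Qed.

Lemma toeplitz_model_spectrum :
  let approach := [set lambda | forall e : R, 0 < e ->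
    exists2 w, freq w & normc (gam w - lambda) < e] in
  spectrum mu G S A = approach /\ ess_spectrum mu G S A = approach.
Proof.
have U_ae k h : L2 leb setT k -> L2 leb setT h ->
    k = h %[ae leb in setT] -> forall z, G z -> wt l s k z = wt l s h z.
  by move=> Lk Lh; exact: (wt_ae s Ll (L2_cmeasurable Lh) Lk).
have SA F : S F -> S (A F).
  by move=> SF; have [_ [k Lk Fk]] := (SP F).1 SF; case: (ortho_proj_wt SF Lk Fk).
have mA : multiplies mu G (wt l s) S A gam0.
  by move=> F k SF Lk Fk; case: (ortho_proj_wt SF Lk Fk).
have [-> ->] := spectrum_multiplication mG (fun c k h Lk Lh z Gz => wt_lin s Ll c Lk Lh Gz)
  L2_wt' (fun k Lk => sqnorm_wt mD1 s2pi ml Ll l1 aefreq Lk) U_ae SP aefreq SA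
  gam0_bounded_symbol mA open_gam0.
rewrite (_ : [set lambda | approached freq gam0 lambda] = [set lambda | forall e : R, 0 < e ->
    exists2 w, freq w & normc (gam w - lambda) < e])//.
apply/seteqP; split => lambda h e e0; have [w fw we] := h e e0; exists w => //.
  by rewrite -gam0E.
by rewrite gam0E.
Qed.

End symbol.

(** * Integration against a measure with a density *)

Section density.
Context d (T : measurableType d) (R : realType).
Variables (mu nu : {measure set T -> \bar R}) (rho : T -> R).
Hypothesis mrho : measurable_fun setT rho.
Hypothesis rho0 : forall x, 0 <= rho x.
Hypothesis nuE : forall A, measurable A -> nu A = (\int[mu]_(x in A) (rho x)%:E)%E.

Let mrhoE : measurable_fun setT (fun x => (rho x)%:E). Proof. exact/measurable_EFinP. Qed.

Import HBNNSimple.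

Let ge0_integral_density_nnsfun (f : {nnsfun T >-> R}) :
  (\int[nu]_x (f x)%:E = \int[mu]_x ((f x)%:E * (rho x)%:E))%E.
Proof.
under [LHS]eq_integral do rewrite fimfunE -fsumEFin//.
rewrite [LHS]ge0_integral_fsum//; last 2 first.
- by move=> r; exact/measurable_EFinP/measurableT_comp.
- by move=> n x _; rewrite EFinM nnfun_muleindic_ge0.
under [RHS]eq_integral.
  move=> x xD; rewrite fimfunE -fsumEFin// ge0_mule_fsuml; last first.
    by move=> r; rewrite EFinM nnfun_muleindic_ge0.
  over.
rewrite [RHS]ge0_integral_fsum//; last 2 first.
- move=> r; apply: emeasurable_funM => //.
  by apply/measurable_EFinP; exact: measurableT_comp.
- by move=> n x _; rewrite mule_ge0 ?lee_fin// -lee_fin EFinM nnfun_muleindic_ge0.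
apply: eq_fsbigr => r _; rewrite integralZl_indic_nnsfun//= integral_indic// setIT.
have [r0|r0] := ltP r 0.
  rewrite preimage_nnfun0// measure0 mule0 integral0_eq// => x _.
  by rewrite indic0 mulr0 mul0e.
transitivity (\int[mu]_x (r%:E * ((\1_(f @^-1` [set r]) x)%:E * (rho x)%:E)))%E; last first.
  by apply: eq_integral => x _; rewrite EFinM muleA.
rewrite ge0_integralZl_EFin//; last 2 first.
- by move=> x _; rewrite mule_ge0// ?lee_fin// lee_fin.
- apply: emeasurable_funM => //.
  by apply/measurable_EFinP; exact: measurable_indic.
congr (_ * _)%E; rewrite nuE// integral_mkcond; apply: eq_integral => x _.
by rewrite patchE indicE; case: ifPn => _; rewrite ?mul1e ?mul0e.
Qed.

(** For simple functions the formula is linearity together with the definition of [nu]; monotone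
    convergence passes to the limit on both sides. *)
Lemma ge0_integral_density (f : T -> \bar R) : measurable_fun setT f ->
  (forall x, 0 <= f x)%E -> (\int[nu]_x f x = \int[mu]_x (f x * (rho x)%:E))%E.
Proof.
move=> mf f0; pose f_ := nnsfun_approx measurableT mf.
have cf x : (fun n => (f_ n x)%:E) @ \oo --> f x by exact: cvg_nnsfun_approx.
have c1 : (fun n => \int[nu]_x (f_ n x)%:E)%E @ \oo --> (\int[nu]_x f x)%E.
  have -> : (\int[nu]_x f x)%E = (\int[nu]_x limn (fun n => (f_ n x)%:E))%E.
    by apply: eq_integral => x _; apply/esym/cvg_lim.
  apply: cvg_monotone_convergence => //.
  - by move=> n; exact/measurable_EFinP.
  - by move=> n x _; rewrite lee_fin.
  - by move=> x _ n m nm; rewrite lee_fin; exact/lefP/nd_nnsfun_approx.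
have c2 : (fun n => \int[mu]_x ((f_ n x)%:E * (rho x)%:E))%E @ \oo --> (\int[mu]_x (f x * (rho x)%:E))%E.
  have -> : (\int[mu]_x (f x * (rho x)%:E))%E = (\int[mu]_x limn (fun n => ((f_ n x)%:E * (rho x)%:E)%E))%E.
    apply: eq_integral => x _; apply/esym/cvg_lim => //.
    by apply: cvgeZr.
  apply: cvg_monotone_convergence => //.
  - by move=> n; apply: emeasurable_funM => //; exact/measurable_EFinP.
  - by move=> n x _; rewrite mule_ge0// ?lee_fin// lee_fin.
  - move=> x _ n m nm; apply: lee_wpmul2r; first by rewrite lee_fin.
    by rewrite lee_fin; exact/lefP/nd_nnsfun_approx.
have e : (fun n => \int[nu]_x (f_ n x)%:E)%E = (fun n => \int[mu]_x ((f_ n x)%:E * (rho x)%:E))%E.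
  by apply/funext => n; exact: ge0_integral_density_nnsfun.
by rewrite -(cvg_lim _ c1)// e (cvg_lim _ c2).
Qed.

End density.

Section affine_eps.
Context (R : realType).
Local Notation leb := (@lebesgue_measure R).
Local Notation mR := (measurableTypeR R).

(** A failure for every d would yield sequences a -> 1 and b -> 0 contradicting the sequential
    statement [affine_L1_cvg]. *)
Lemma affine_L1_eps (h : R -> R) (e : R) : leb.-integrable setT (EFin \o h) -> 0 < e ->
  exists2 d : R, 0 < d & forall a b, `|a - 1| < d -> `|b| < d ->
    (\int[leb]_x `|h (a * x + b) - h x|%:E <= e%:E)%E.
Proof.
move=> ih e0; apply: contrapT => nd.
(* The bound 1 / (n + 2) keeps the dilation factor within 1/2 of 1, hence nonzero. *)
have /choice[ab abP] n : exists ab : R * R, [/\ `|ab.1 - 1| < (n.+2%:R)^-1,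
    `|ab.2| < n.+2%:R^-1 & ~ (\int[leb]_x `|h (ab.1 * x + ab.2) - h x|%:E <= e%:E)%E].
  apply: contrapT => nab; apply: nd; exists (n.+2%:R^-1) => // a b a1 b1.
  by apply: contrapT => nle; apply: nab; exists (a, b).
pose a n := (ab n).1; pose b n := (ab n).2.
have lim0 : (fun n => n.+2%:R^-1 : R) @ \oo --> (0 : R).
  apply/cvgrPdist_lt => eps eps0.
  apply: filterS (near_infty_natSinv_lt (PosNum eps0)) => n /=.
  rewrite sub0r normrN ger0_norm ?invr_ge0//; apply: le_lt_trans.
  by rewrite lef_pV2 ?posrE// ler_nat.
have a0 n : a n != 0.
  apply/eqP => an; have [h1 _ _] := abP n; move: h1; rewrite -/(a n) an sub0r normrN normr1.
  by rewrite ltNge invf_le1// ler1n.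
have a1 : a @ \oo --> (1 : R).
  apply/cvgrPdist_lt => eps eps0; have /cvgrPdist_lt/(_ _ eps0) := lim0.
  apply: filterS => n; rewrite sub0r normrN ger0_norm ?invr_ge0// distrC; apply: lt_trans.
  by case: (abP n).
have b0 : b @ \oo --> (0 : R).
  apply/cvgrPdist_lt => eps eps0; have /cvgrPdist_lt/(_ _ eps0) := lim0.
  apply: filterS => n; rewrite !sub0r !normrN [X in X < _ -> _]ger0_norm ?invr_ge0//; apply: lt_trans.
  by case: (abP n).
have /cvgrPdist_lt/(_ _ e0) := affine_L1_cvg ih a0 a1 b0.
move=> /filter_ex[n]; rewrite sub0r normrN => hn.
have [_ _] := abP n; apply.
have ii : leb.-integrable setT (fun x => `|h (a n * x + b n) - h x|%:E).
  have i1 := integrable_affine (b n) (a0 n) ih.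
  exact: (integrable_norm (integrableB measurableT i1 ih)).
rewrite -[X in (X <= _)%E](fineK (integrable_fin_num measurableT ii)) lee_fin.
by apply: ltW; apply: le_lt_trans hn; exact: ler_norm.
Qed.

End affine_eps.

(** * The time-frequency case *)

Section time_frequency.
Context (R : realType).
Local Notation leb := (@lebesgue_measure R).
Local Notation mR := (measurableTypeR R).
Variables Psi alpha : R -> R[i].
Hypothesis LPsi : L2 leb setT Psi.
Hypothesis Psi1 : sqnorm leb setT Psi = 1%E.
Hypothesis malpha : cmeasurable (setT : set mR) alpha.
Local Notation G := ([set: mR] `*` [set: mR]).
Local Notation mu := (leb \x leb)%E.
Local Notation l := (ell TimeFrequency Psi).
Local Notation s := (- (2 * pi) : R).

Lemma tf_s2 : s ^+ 2 = (2 * pi) ^+ 2. Proof. by rewrite sqrrN. Qed.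

Lemma transform_tf f z : transform TimeFrequency Psi f z = wt l s f z.
Proof.
apply: eq_cintegral => x _; rewrite /atom conjcM -expiN.
have -> : - (2 * pi * z.2 * x) = s * x * z.2 by ring.
by rewrite /ell mulrCA mulrC.
Qed.

Let ml : cmeasurable G (fun z => l z.1 z.2).
Proof.
apply: cmeasurableJ; apply: (@cmeasurable_comp _ _ _ mR R _ Psi (fun z : mR * mR => z.2 - z.1)).
  exact: L2_cmeasurable LPsi.
apply: measurable_funB; apply: measurable_funTS; [exact: measurable_snd|exact: measurable_fst].
Qed.

Let Ll r : [set: mR] r -> L2 leb setT (l r).
Proof.
move=> _; apply: L2J; have := L2_affine (- r) (oner_neq0 R) LPsi.
by under eq_fun do rewrite mul1r.
Qed.

Let mPsi2 : measurable_fun (setT : set mR) (fun t => normc (Psi t) ^+ 2).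
Proof. by apply: measurable_normc_sqr; exact: L2_cmeasurable LPsi. Qed.

Let l1 w : [set: R] w -> (\int[leb]_(r in [set: mR]) (normc (l r w) ^+ 2)%:E = 1)%E.
Proof.
move=> _; rewrite -Psi1 /sqnorm.
have := @ge0_integral_affine R (-1) w (fun t => (normc (Psi t) ^+ 2)%:E).
rewrite normrN normr1 invr1 mul1e => <-.
- by apply: eq_integral => r _; rewrite normc_conj mulN1r addrC.
- by rewrite oppr_eq0 oner_neq0.
- exact/measurable_EFinP.
- by move=> x; rewrite lee_fin sqr_ge0.
Qed.

Let aefreq : \forall w \ae leb, [set: R] w. Proof. exact: aeW. Qed.

(** The reflection r |-> w0 - r turns the increment of the squared kernel into that of |Psi|^2 under
    a translation by w - w0. *)
Let l_cont w0 : [set: R] w0 -> forall e : R, 0 < e -> exists2 d : R, 0 < d &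
  forall w, [set: R] w -> `|w - w0| < d ->
  (\int[leb]_(r in [set: mR]) `|normc (l r w) ^+ 2 - normc (l r w0) ^+ 2|%:E <= e%:E)%E.
Proof.
move=> _ e e0.
have ih : leb.-integrable setT (EFin \o (fun t => normc (Psi t) ^+ 2)) by exact: L2_integrable LPsi.
have [d d0 dP] := affine_L1_eps ih e0; exists d => // w _ wd.
apply: le_trans (dP 1 (w - w0) _ wd); last by rewrite subrr normr0.
have := @ge0_integral_affine R (-1) w0 (fun t => `|normc (Psi (1 * t + (w - w0))) ^+ 2 - normc (Psi t) ^+ 2|%:E).
rewrite normrN normr1 invr1 mul1e => <-.
- rewrite le_eqVlt; apply/orP; left; apply/eqP; apply: eq_integral => r _.
  rewrite !normc_conj mul1r mulN1r.
  have -> : - r + w0 + (w - w0) = w - r by ring.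
  by rewrite [- r + _]addrC.
- by rewrite oppr_eq0 oner_neq0.
- apply/measurable_EFinP; apply: measurableT_comp => //; apply: measurable_funB => //.
  exact: (measurableT_comp mPsi2 (@measurable_affine R 1 (w - w0) setT)).
- by move=> x; rewrite lee_fin.
Qed.

Hypothesis hT : forall F, transform_range TimeFrequency Psi F ->
  L2 (zeta TimeFrequency) (Defs.G TimeFrequency) (mul_symbol alpha F).

Let SP F : transform_range TimeFrequency Psi F <-> L2 mu G F /\
  exists2 k, L2 leb setT k & F = wt l s k %[ae mu in G].
Proof.
split => -[LF [f Lf Ff]]; split => //; exists f => //.
  by apply: ae_impl Ff => z + Gz => /(_ Gz) ->; exact: transform_tf.
by apply: ae_impl Ff => z + Gz => /(_ Gz) ->; rewrite transform_tf.
Qed.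

Let Lalpha k : L2 leb setT k -> L2 mu G (fun z => alpha z.1 * wt l s k z).
Proof.
move=> Lk; apply: (hT (F := wt l s k)); apply/SP; split; last by exists k => //; exact: aeW.
exact: (L2_wt measurableT tf_s2 ml Ll l1 aefreq).
Qed.

Lemma tf_spectrum :
  let approach := [set lambda | forall e : R, 0 < e ->
    exists2 w, frequencies TimeFrequency w & normc (gamma TimeFrequency Psi alpha w - lambda) < e] in
  toeplitz_spectrum TimeFrequency Psi alpha = approach /\
  toeplitz_ess_spectrum TimeFrequency Psi alpha = approach.
Proof.
exact: (toeplitz_model_spectrum measurableT tf_s2 ml Ll l1 aefreq openT l_cont malpha Lalpha SP).
Qed.

Lemma tf_gamma_bounded : exists M : R, forall w, frequencies TimeFrequency w ->
  normc (gamma TimeFrequency Psi alpha w) <= M.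
Proof. exact: (gam_bounded measurableT tf_s2 ml Ll l1 aefreq l_cont malpha Lalpha). Qed.

Lemma tf_gamma_cont w0 (e : R) : frequencies TimeFrequency w0 -> 0 < e ->
  exists2 d : R, 0 < d & forall w, frequencies TimeFrequency w -> `|w - w0| < d ->
    normc (gamma TimeFrequency Psi alpha w - gamma TimeFrequency Psi alpha w0) < e.
Proof. exact: (gam_cont measurableT tf_s2 ml Ll l1 aefreq l_cont malpha Lalpha). Qed.

End time_frequency.

Local Opaque fourier.

(** * The wavelet case *)

Section affine_measure_theory.
Context (R : realType).
Local Notation leb := (@lebesgue_measure R).
Local Notation mR := (measurableTypeR R).
Local Notation pos := (`]0%R, +oo[%classic : set mR).

Let rho (u : mR) : R := if 0 < u then u ^- 2 else 0.

Let rho0 u : 0 <= rho u.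
Proof. by rewrite /rho; case: ifP => // _; rewrite invr_ge0 sqr_ge0. Qed.

Let mpos : measurable pos. Proof. exact: measurable_itv. Qed.

Let in_pos u : (u \in pos) = (0 < u).
Proof. by apply/idP/idP; rewrite inE/= in_itv/= andbT. Qed.

Let mrho : measurable_fun (setT : set mR) rho.
Proof.
have -> : rho = (fun u => u ^- 2) \_ pos by apply/funext => u; rewrite patchE in_pos.
apply: (measurable_restrictT (fun u : mR => u ^- 2) mpos).1.
apply: open_continuous_measurable_fun; first exact: interval_open.
move=> u; rewrite inE /= in_itv /= andbT => u0.
apply: cvgV; last exact: exprn_continuous.
by rewrite expf_neq0// gt_eqF.
Qed.

Let mrhoE : measurable_fun (setT : set mR) (fun u => (rho u)%:E).
Proof. exact/measurable_EFinP. Qed.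

Let affine_measureE (A : set mR) : measurable A ->
  affine_measure A = (\int[leb]_(u in A) (rho u)%:E)%E.
Proof.
move=> mA; rewrite /affine_measure [LHS]integral_mkcondr; apply: eq_integral => u _.
by rewrite patchE in_pos /rho; case: ifP.
Qed.

Lemma integral_affine_measure (f : mR -> \bar R) : measurable_fun pos f ->
  (forall u, pos u -> 0 <= f u)%E ->
  (\int[@affine_measure R]_(u in pos) f u = \int[leb]_(u in pos) (f u * (u ^- 2)%:E))%E.
Proof.
move=> mf f0; rewrite integral_mkcond.
rewrite (@ge0_integral_density _ mR R leb (@affine_measure R) rho mrho rho0 affine_measureE).
- rewrite [RHS]integral_mkcond; apply: eq_integral => u _; rewrite !patchE in_pos /rho.
  by case: ifP => // _; rewrite mul0e.
- exact: (measurable_restrictT f mpos).1.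
- by move=> u; apply: erestrict_ge0.
Qed.

Lemma ae_affine_measure (P : R -> Prop) : (\forall x \ae leb, P x) ->
  \forall x \ae @affine_measure R, P x.
Proof.
move=> [N [mN N0 PN]]; exists N; split => //.
rewrite affine_measureE//; apply: null_set_integral => //.
exact: measurable_funTS mrhoE.
Qed.

(** The half-line of nonpositive numbers is null for the affine measure and is added to exhaust R;
    on [1 / (n + 1), n + 1] the density is at most (n + 1)^2. *)
Let cover n : set mR := `]-oo, 0%R] `|` `[n.+1%:R^-1, n.+1%:R].

Let affine_measure_sigma_finite : sigma_finite setT (@affine_measure R).
Proof.
exists cover.
  apply/esym/seteqP; split => // x _.
  have [x0|x0] := leP x 0; first by exists 0%N => //; left; rewrite /= in_itv.
  pose n := maxn (Num.Def.truncn x) (Num.Def.truncn x^-1).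
  exists n => //; right; rewrite /= in_itv/=; apply/andP; split.
    rewrite -[x]invrK lef_pV2 ?posrE ?invr_gt0//.
    by apply/ltW/(lt_le_trans (truncnS_gt _)); rewrite ler_nat ltnS leq_maxr.
  by apply/ltW/(lt_le_trans (truncnS_gt _)); rewrite ler_nat ltnS leq_maxl.
move=> n; have mc : measurable (cover n) by apply: measurableU; exact: measurable_itv.
split => //; rewrite /affine_measure.
pose J : set mR := `[n.+1%:R^-1, n.+1%:R]%classic; pose M : R := n.+1%:R ^+ 2.
apply: (@le_lt_trans _ _ (\int[leb]_(u in J) M%:E)%E).
  have -> : cover n `&` pos = J.
    apply/seteqP; split=> u; rewrite /cover /J /= !in_itv/= andbT.
      by case=> -[u0|//] u1; rewrite ltNge u0 in u1.
    by move=> h; split; [right|case/andP: h => h _; apply: lt_le_trans h; rewrite invr_gt0].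
  apply: ge0_le_integral => //.
  - exact: measurable_itv.
  - by move=> u _; rewrite lee_fin invr_ge0 sqr_ge0.
  - have := measurable_funTS (D := J) mrho.
    move/measurable_EFinP; apply: eq_measurable_fun => u; rewrite inE /J /= in_itv/= => /andP[h _].
    by rewrite /rho (lt_le_trans _ h) ?invr_gt0.
  - move=> u; rewrite /J /= in_itv/= => /andP[h _]; rewrite lee_fin -exprVn.
    have u0 : 0 < u by apply: lt_le_trans h; rewrite invr_gt0.
    by rewrite ler_sqr ?nnegrE ?invr_ge0 ?(ltW u0)// -[leRHS]invrK lef_pV2 ?posrE ?invr_gt0.
rewrite integral_cst; last exact: measurable_itv.
rewrite lte_mul_pinfty//; first by rewrite lee_fin sqr_ge0.
exact: leb_itvcc_lty.
Qed.

HB.instance Definition _ := @Measure_isSigmaFinite.Build _ mR R (@affine_measure R)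
  affine_measure_sigma_finite.

End affine_measure_theory.
Section wavelet.
Context (R : realType).
Local Notation leb := (@lebesgue_measure R).
Local Notation mR := (measurableTypeR R).
Local Notation pos := (`]0%R, +oo[%classic : set mR).
Local Notation aff := (@affine_measure R).
Variables Psi alpha : R -> R[i].
Hypothesis LPsi : L2 leb setT Psi.
Hypothesis Psi1 : \forall xi \ae leb,
  (\int[leb]_(t in `]0%R, +oo[) (normc (fourier Psi (t * xi)) ^+ 2 / t)%:E = 1)%E.
Hypothesis malpha : cmeasurable pos alpha.
Local Notation F := (fourier Psi).
Local Notation G := (pos `*` [set: mR]).
Local Notation mu := (aff \x leb)%E.
Local Notation l := (ell Wavelet Psi).
Local Notation s := (2 * pi : R).
Local Notation freq := (frequencies Wavelet : set R).

Let mpos : measurable pos. Proof. exact: measurable_itv. Qed.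

Let measurable_invsqr : measurable_fun pos (fun u : mR => u ^- 2).
Proof.
apply: open_continuous_measurable_fun; first exact: interval_open.
move=> u; rewrite inE /= in_itv /= andbT => u0.
apply: cvgV; last exact: exprn_continuous.
by rewrite expf_neq0// gt_eqF.
Qed.

Let in_pos u : (u \in pos) = (0 < u).
Proof. by apply/idP/idP; rewrite inE/= in_itv/= andbT. Qed.

Let posE u : pos u = (0 < u) :> Prop. Proof. by rewrite /= in_itv/= andbT. Qed.

Let mF : cmeasurable (setT : set mR) F.
Proof. exact: L2_cmeasurable (L2_fourier LPsi). Qed.

Let freqP w : freq w <-> w != 0.
Proof. by split => [/eqP|/eqP]. Qed.

(** The admissibility integrand at frequency w, extended by 0 to t <= 0; for t > 0 it is |l(t, w)|^2
    t^-2, the squared kernel times the density of the affine measure. *)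
Let H w t : R := if 0 < t then normc (F (t * w)) ^+ 2 / t else 0.

Let H_ge0 w t : 0 <= H w t.
Proof. by rewrite /H; case: ifP => // t0; rewrite divr_ge0 ?sqr_ge0 ?(ltW t0). Qed.

Let mFw w : measurable_fun (setT : set mR) (fun t => normc (F (t * w)) ^+ 2).
Proof.
have := measurable_normc_sqr (cmeasurable_affine w 0 mF).
by apply: eq_measurable_fun => t _; rewrite addr0 mulrC.
Qed.

Let mH w : measurable_fun (setT : set mR) (H w).
Proof.
have -> : H w = (fun t => normc (F (t * w)) ^+ 2 / t) \_ pos.
  by apply/funext => t; rewrite patchE in_pos.
apply: (measurable_restrictT (fun t : mR => normc (F (t * w)) ^+ 2 / t) mpos).1.
apply: measurable_funM; first exact: measurable_funTS.
apply: open_continuous_measurable_fun; first exact: interval_open.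
by move=> u; rewrite inE /= in_itv /= andbT => u0; apply: inv_continuous; rewrite gt_eqF.
Qed.

Let integral_H w :
  (\int[leb]_(t in `]0%R, +oo[) (normc (F (t * w)) ^+ 2 / t)%:E = \int[leb]_t (H w t)%:E)%E.
Proof.
rewrite integral_mkcond; apply: eq_integral => t _.
by rewrite patchE in_pos /H; case: ifP.
Qed.

(** The measure dt / t is invariant under dilations. *)
Let H_scale c w : 0 < c -> (\int[leb]_t (H (c * w) t)%:E = \int[leb]_t (H w t)%:E)%E.
Proof.
move=> c0; have cn0 : c != 0 by rewrite gt_eqF.
have := @ge0_integral_affine R c 0 (fun t => (c * H w t)%:E) cn0.
have -> : (\int[leb]_x (c * H w (c * x + 0))%:E = \int[leb]_t (H (c * w) t)%:E)%E.
  apply: eq_integral => t _; congr EFin; rewrite addr0 /H pmulr_rgt0//; case: ifPn => [t0|_].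
    have -> : c * t * w = t * (c * w) by ring.
    by set X := normc _ ^+ 2; field; rewrite cn0 gt_eqF.
  by rewrite mulr0.
move=> ->.
- under eq_integral do rewrite EFinM.
  rewrite ge0_integralZl_EFin ?(ltW c0)//.
  + by rewrite muleA -EFinM ger0_norm ?(ltW c0)// mulVf// mul1e.
  + by move=> t _; rewrite lee_fin.
  + exact/measurable_EFinP.
- by apply/measurable_EFinP; apply: measurable_funM; [exact: measurable_cst|exact: mH].
- by move=> t; rewrite lee_fin mulr_ge0 ?(ltW c0).
Qed.

(** Admissibility is given at almost every frequency; dilation invariance carries it from one
    frequency of each sign to all nonzero ones. *)
Let integral_H1 w : freq w -> (\int[leb]_t (H w t)%:E = 1)%E.
Proof.
move=> /freqP w0.
have [xi xiw xi1] : exists2 xi, 0 < w / xi &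
    (\int[leb]_(t in `]0%R, +oo[) (normc (F (t * xi)) ^+ 2 / t)%:E = 1)%E.
  (* A point at distance less than 1 from 1, or from -1, has the sign of that number, so w / xi is a
     positive dilation factor. *)
  have [w_gt0|w_lt0|we] := ltgtP 0 w.
  - have [xi xid xi1] := ae_ball 1 ltr01 Psi1; exists xi => //.
    by rewrite divr_gt0//; move: xid; rewrite ltr_norml => /andP[]; lra.
  - have [xi xid xi1] := ae_ball (-1) ltr01 Psi1; exists xi => //.
    rewrite nmulr_rgt0// invr_lt0; move: xid; rewrite ltr_norml => /andP[]; lra.
  - by rewrite -we eqxx in w0.
have xi0 : xi != 0 by apply/eqP => xi0; rewrite xi0 invr0 mulr0 ltxx in xiw.
by rewrite -xi1 integral_H -(H_scale xi xiw) divfK.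
Qed.

Let normc_l r w : 0 < r -> normc (l r w) ^+ 2 = r * normc (F (r * w)) ^+ 2.
Proof.
move=> r0; rewrite /ell normcM normc_conj normcR exprMn real_normK ?num_real//.
by rewrite sqr_sqrtr// ltW.
Qed.

Let ml : cmeasurable G (fun z => l z.1 z.2).
Proof.
apply: cmeasurableM.
  apply: cmeasurableR; apply: (measurableT_comp (f := @Num.sqrt R)).
    by apply: continuous_measurable_fun; exact: sqrt_continuous.
  by apply: measurable_funTS; exact: measurable_fst.
apply: cmeasurableJ; apply: (@cmeasurable_comp _ _ _ mR R _ F (fun z : mR * mR => z.1 * z.2)) => //.
apply: measurable_funM; apply: measurable_funTS; [exact: measurable_fst|exact: measurable_snd].
Qed.

Let Ll r : pos r -> L2 leb setT (l r).
Proof.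
rewrite posE => r0; apply: (L2Z measurableT); apply: L2J.
have := L2_affine 0 (lt0r_neq0 r0) (L2_fourier LPsi).
by under eq_fun do rewrite addr0.
Qed.

Let l1 w : freq w -> (\int[aff]_(r in pos) (normc (l r w) ^+ 2)%:E = 1)%E.
Proof.
move=> fw; rewrite -(integral_H1 fw) -integral_H integral_affine_measure.
- apply: eq_integral => r; rewrite inE posE => r0; rewrite -EFinM normc_l//.
  by congr EFin; field; rewrite gt_eqF.
- apply: emeasurable_normc_sqr; exact: (cmeasurable_section2 mpos w ml).
- by move=> u _; rewrite lee_fin sqr_ge0.
Qed.

Let aefreq : \forall w \ae leb, freq w.
Proof. by apply: ae_impl (ae_neq 0) => w w0; apply/freqP. Qed.

Let openfreq : open freq.
Proof. by apply: closed_openC; apply: accessible_closed_set1; apply: hausdorff_accessible; exact: Rhausdorff. Qed.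

(** Put a = w / w0 and let H belong to the frequency w0. With the density r^-2 the increment becomes
    a H(a r) - H(r): the part a (H(a r) - H(r)) is small by L_1 continuity of dilations, and (a - 1)
    H(r) is small because H has integral 1. *)
Let l_cont w0 : freq w0 -> forall e : R, 0 < e -> exists2 d : R, 0 < d &
  forall w, freq w -> `|w - w0| < d ->
  (\int[aff]_(r in pos) `|normc (l r w) ^+ 2 - normc (l r w0) ^+ 2|%:E <= e%:E)%E.
Proof.
move=> fw0 e e0; have w00 : w0 != 0 by apply/freqP.
have iH : leb.-integrable setT (EFin \o H w0).
  apply/integrableP; split; first exact/measurable_EFinP.
  rewrite (_ : (\int[leb]_x _)%E = 1%E) ?ltry// -(integral_H1 fw0).
  by apply: eq_integral => t _; rewrite gee0_abs// lee_fin.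
have e40 : 0 < e / 4 by rewrite divr_gt0.
have [d1 d10 d1P] := affine_L1_eps iH e40.
(* [d1] serves the dilation, 1 / 2 keeps a positive and at most 2, and e / 4 bounds |a - 1|; the
   total is 2 (e / 4) + e / 4. *)
pose m := Num.min d1 (Num.min (1 / 2) (e / 4)).
have m0 : 0 < m by rewrite !lt_min d10 e40 andbT/=; lra.
exists (`|w0| * m); first by rewrite mulr_gt0// normr_gt0.
move=> w fw; rewrite mulrC -ltr_pdivrMr ?normr_gt0// -normf_div mulrBl divff//.
rewrite !lt_min; set a := w / w0 => /and3P[a1 a2 a3].
have a0 : 0 < a by move: a2; rewrite ltr_norml => /andP[]; lra.
have ale2 : a <= 2 by move: a2; rewrite ltr_norml => /andP[]; lra.
have wE : w = a * w0 by rewrite /a divfK.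
have mD : measurable_fun (setT : set mR) (fun r => `|H w0 (a * r + 0) - H w0 r|%:E).
  apply/measurable_EFinP; apply: measurableT_comp => //; apply: measurable_funB => //.
  exact: (measurableT_comp (mH w0) (@measurable_affine R a 0 setT)).
rewrite integral_affine_measure; last 2 first.
- apply/measurable_EFinP; apply: measurableT_comp => //.
  by apply: measurable_funB; apply: measurable_normc_sqr; exact: (cmeasurable_section2 mpos _ ml).
- by move=> u _; rewrite lee_fin.
apply: (@le_trans _ _ (\int[leb]_(r in pos) (2%:E * `|H w0 (a * r + 0) - H w0 r|%:E +
    (e / 4)%:E * (H w0 r)%:E))%E).
  apply: ge0_le_integral => //.
  - by move=> r _; rewrite -EFinM lee_fin mulr_ge0// invr_ge0 sqr_ge0.
  - apply/measurable_EFinP; apply: measurable_funM.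
      apply: measurableT_comp => //; apply: measurable_funB; apply: measurable_normc_sqr;
        exact: (cmeasurable_section2 mpos _ ml).
    exact: measurable_invsqr.
  - apply: measurable_funTS; apply: emeasurable_funD.
      by apply: emeasurable_funM => //; exact: measurable_cst.
    by apply: emeasurable_funM; [exact: measurable_cst|exact/measurable_EFinP].
  move=> r; rewrite posE => r0; rewrite -EFinM -[X in (_ <= X)%E]/((2 * `|H w0 (a * r + 0) - H w0 r| +
    e / 4 * H w0 r)%:E) lee_fin !normc_l//.
  have e1 : r * normc (F (r * w)) ^+ 2 / r ^+ 2 = a * H w0 (a * r + 0).
    rewrite /H addr0 pmulr_rgt0// r0 wE (_ : r * (a * w0) = a * r * w0); last by ring.
    by set X := normc _ ^+ 2; field; rewrite !gt_eqF.
  have e2 : r * normc (F (r * w0)) ^+ 2 / r ^+ 2 = H w0 r.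
    by rewrite /H r0; set X := normc _ ^+ 2; field; rewrite gt_eqF.
  have r20 : 0 <= r ^- 2 by rewrite invr_ge0 sqr_ge0.
  rewrite -[X in _ * X <= _](ger0_norm r20) -normrM mulrBl e1 e2.
  have -> : a * H w0 (a * r + 0) - H w0 r = a * (H w0 (a * r + 0) - H w0 r) + (a - 1) * H w0 r by ring.
  apply: le_trans (ler_normD _ _) _.
  rewrite [`|a * _|]normrM [`|(a - 1) * _|]normrM; apply: lerD.
    by apply: ler_wpM2r => //; rewrite ger0_norm ?(ltW a0).
  by rewrite [`|H _ _|]ger0_norm//; apply: ler_wpM2r => //; exact: ltW.
apply: (@le_trans _ _ (\int[leb]_r (2%:E * `|H w0 (a * r + 0) - H w0 r|%:E +
    (e / 4)%:E * (H w0 r)%:E))%E).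
  apply: ge0_subset_integral => //.
    apply: emeasurable_funD.
      by apply: emeasurable_funM => //; exact: measurable_cst.
    by apply: emeasurable_funM; [exact: measurable_cst|exact/measurable_EFinP].
  by move=> r _; rewrite adde_ge0// mule_ge0// lee_fin ?(ltW e40).
rewrite ge0_integralD//; last 3 first.
- by apply: emeasurable_funM => //; exact: measurable_cst.
- by move=> r _; rewrite -EFinM lee_fin mulr_ge0// ltW.
- by apply: emeasurable_funM; [exact: measurable_cst|exact/measurable_EFinP].
rewrite ge0_integralZl_EFin// ge0_integralZl_EFin ?(ltW e40)//; last 2 first.
- by move=> r _; rewrite lee_fin.
- exact/measurable_EFinP.
rewrite integral_H1// mule1.
have h := d1P a 0 a1; rewrite normr0 in h.
apply: le_trans (leeD (lee_wpmul2l _ (h d10)) (lexx _)) _ => //.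
rewrite -EFinM -EFinD lee_fin; lra.
Qed.
(** Parseval, then the transform of a dilated translate, whose factor u turns the normalisation
    u^(-1/2) of the atom into the u^(1/2) of [ell]. *)
Lemma transform_wavelet f z : L2 leb setT f -> G z ->
  transform Wavelet Psi f z = wt l s (fourier f) z.
Proof.
move=> Lf [z1 _]; move: z1; rewrite posE; move: z => [u v] /= u0.
have un0 : u != 0 by rewrite gt_eqF.
pose g x := Psi ((x - v) / u).
have Lg : L2 leb setT g.
  have := L2_affine (- (v / u)) (invr_neq0 un0) LPsi.
  rewrite /g; congr (L2 _ _ _); apply/funext => x.
  by rewrite mulrBl [x / u]mulrC.
have cg := inner_cintegrable measurableT Lf Lg.
pose c : R[i] := ((Num.sqrt u)^-1)%:C.
have LFf := L2_fourier Lf; have LFg := L2_fourier Lg.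
pose E w : R[i] := u%:C * expi (- (2 * pi) * v * w) * F (u * w).
have mE : cmeasurable (setT : set mR) E.
  apply: cmeasurableM; last first.
    by have := cmeasurable_affine u 0 mF; under eq_fun do rewrite addr0.
  apply: cmeasurableZ; apply: cmeasurable_expi.
  by apply: measurable_funM => //; exact: measurable_cst.
have FE : fourier g = E %[ae leb in setT] by exact: fourier_dilate_translate.
have LE : L2 leb setT E by exact: (ae_eq_L2 measurableT mE FE LFg).
have cE := inner_cintegrable measurableT LFf LE.
transitivity (c * inner leb setT f g).
  rewrite /inner -(cintegralZ measurableT c cg); apply: eq_cintegral => x _.
  rewrite /atom /= conjcM.
  have -> : conjc (((Num.sqrt u)^-1)%:C) = c by rewrite /c /conjc /= oppr0.
  by rewrite mulrCA.
rewrite -fourier_parseval//.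
transitivity (c * inner leb setT (fourier f) E).
  congr (_ * _); apply: (ae_eq_cintegral measurableT).
  - by apply: cmeasurableM; [exact: L2_cmeasurable LFf|apply: cmeasurableJ; exact: L2_cmeasurable LFg].
  - by case: cE.
  - by apply: ae_impl FE => w + _ => /(_ I) ->.
rewrite /inner -(cintegralZ measurableT c cE); apply: eq_cintegral => w _.
rewrite /E !conjcM -expiN.
have -> : - (- (2 * pi) * v * w) = 2 * pi * w * v by ring.
have -> : conjc u%:C = u%:C :> R[i] by rewrite /conjc /= oppr0.
have -> : ell Wavelet Psi u w = (Num.sqrt u)%:C * conjc (F (u * w)) by [].
have <- : c * u%:C = (Num.sqrt u)%:C.
  rewrite /c -(rmorphM (real_complex R)); congr (_%:C).
  by rewrite -[X in _ * X](sqr_sqrtr (ltW u0)) expr2 mulKf// gt_eqF// sqrtr_gt0.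
move: (fourier f w) (expi _) (conjc (F _)) => A B D; ring.
Qed.

Let LFex k : L2 leb setT k -> exists2 f, L2 leb setT f & fourier f = k %[ae leb in setT].
Proof. exact: fourier_surj. Qed.

Hypothesis hT : forall K, transform_range Wavelet Psi K ->
  L2 (zeta Wavelet) (Defs.G Wavelet) (mul_symbol alpha K).

(** The Fourier transform maps L_2 onto itself, so f and its transform, each ranging over L_2,
    describe the same range. *)
Let SP K : transform_range Wavelet Psi K <-> L2 mu G K /\
  exists2 k, L2 leb setT k & K = wt l s k %[ae mu in G].
Proof.
split => -[LK [f Lf Kf]]; split => //.
  exists (fourier f); first exact: L2_fourier.
  by apply: ae_impl Kf => z + Gz => /(_ Gz) ->; exact: transform_wavelet.
have [g Lg gf] := LFex Lf; exists g => //.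
apply: ae_impl Kf => z + Gz => /(_ Gz) ->; rewrite transform_wavelet//.
by rewrite (wt_ae s Ll (L2_cmeasurable Lf) (L2_fourier Lg) gf Gz).
Qed.

Let Lalpha k : L2 leb setT k -> L2 mu G (fun z => alpha z.1 * wt l s k z).
Proof.
move=> Lk; apply: (hT (K := wt l s k)); apply/SP; split; last by exists k => //; exact: aeW.
exact: (L2_wt mpos (erefl (s ^+ 2)) ml Ll l1 aefreq).
Qed.

Lemma wavelet_spectrum :
  let approach := [set lambda | forall e : R, 0 < e ->
    exists2 w, frequencies Wavelet w & normc (gamma Wavelet Psi alpha w - lambda) < e] in
  toeplitz_spectrum Wavelet Psi alpha = approach /\
  toeplitz_ess_spectrum Wavelet Psi alpha = approach.
Proof.
exact: (toeplitz_model_spectrum mpos (erefl (s ^+ 2)) ml Ll l1 aefreq openfreq l_cont malpha Lalpha SP).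
Qed.

Lemma wavelet_gamma_bounded : exists M : R, forall w, frequencies Wavelet w ->
  normc (gamma Wavelet Psi alpha w) <= M.
Proof. exact: (gam_bounded mpos (erefl (s ^+ 2)) ml Ll l1 aefreq l_cont malpha Lalpha). Qed.

Lemma wavelet_gamma_cont w0 (e : R) : frequencies Wavelet w0 -> 0 < e ->
  exists2 d : R, 0 < d & forall w, frequencies Wavelet w -> `|w - w0| < d ->
    normc (gamma Wavelet Psi alpha w - gamma Wavelet Psi alpha w0) < e.
Proof. exact: (gam_cont mpos (erefl (s ^+ 2)) ml Ll l1 aefreq l_cont malpha Lalpha). Qed.

Hypothesis real_Psi : \forall x \ae leb, cIm (Psi x) = 0.

(** Conjugate symmetry is exact for the truncated integrals, since [Psi] is real almost everywhere;
    both sides converge in L_2. *)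
Lemma fourier_real_even : (fun w => F (- w)) = (fun w => conjc (F w)) %[ae leb in setT].
Proof.
have [_ cF] := fourierP LPsi.
pose t n := ft (- (2 * pi)) (trunc n Psi).
have mt n : cmeasurable (setT : set mR) (t n).
  by apply: cmeasurable_ft; apply: cmeasurable_trunc; exact: L2_cmeasurable LPsi.
have tJ n w : t n (- w) = conjc (t n w).
  have ct := cintegrable_trunc n LPsi.
  rewrite /t /ft -(cintegralJ measurableT (ft_integrable _ _ ct)).
  apply: (ae_eq_cintegral measurableT).
  - by case: (ft_integrable (- (2 * pi)) (- w) ct).
  - by apply: cmeasurableJ; case: (ft_integrable (- (2 * pi)) w ct).
  apply: ae_impl real_Psi => x Px _; rewrite conjcM -expiN mulrN; congr (_ * _).
  rewrite /trunc; case: ifP => _; last by rewrite conjc0.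
  by move: Px; case: (Psi x) => a b /= ->; rewrite oppr0.
have mFN : cmeasurable (setT : set mR) (fun w => F (- w)).
  by have := cmeasurable_affine (-1) 0 mF; under eq_fun do rewrite addr0 mulN1r.
apply: (@L2cvg_unique _ mR R leb setT measurableT (fun n w => conjc (t n w))) => //.
- by move=> n; exact: cmeasurableJ.
- exact: cmeasurableJ.
- rewrite /L2cvg.
  rewrite (_ : (fun n => _) = (fun n => sqnorm leb setT (fun w => t n w - F w))); first exact: cF.
  apply/funext => n; have := sqnorm_affine 0 (_ : -1 != 0) (cmeasurableB (mt n) mF).
  rewrite normrN normr1 invr1 mul1e => <-; last by rewrite oppr_eq0 oner_neq0.
  by congr sqnorm; apply/funext => w; rewrite addr0 mulN1r tJ.
- exact: L2cvg_conj cF.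
Qed.

(** The symmetry of the transform is known only almost everywhere. For fixed nonzero w it is used
    along r |-> w r, hence for almost every r, and integration in r makes the identity exact at
    w. *)
Lemma wavelet_gamma_even w : frequencies Wavelet w ->
  gamma Wavelet Psi alpha (- w) = gamma Wavelet Psi alpha w.
Proof.
move=> /freqP w0.
have ml2 u : cmeasurable pos (fun r => alpha r * (normc (l r u) ^+ 2)%:C).
  apply: cmeasurableM => //; apply: cmeasurableR; apply: measurable_normc_sqr.
  exact: (cmeasurable_section2 mpos u ml).
apply: (ae_eq_cintegral mpos) => //.
apply: ae_affine_measure.
have := ae_affine 0 w0 fourier_real_even; apply: ae_impl => r + pr.
rewrite addr0 => /(_ I) e.
have -> : normc (l r (- w)) = normc (l r w); last by [].
rewrite /ell !normcM !normc_conj; congr (_ * _).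
by rewrite mulrN [r * w]mulrC e normc_conj.
Qed.

End wavelet.

(** * The theorem *)

Section approached_values.
Context (R : realType).

(** Balls of [R[i]^o] have radii in R[i]; a positive element of R[i] is real, so real radii
    suffice. *)
Lemma closureCP (A : set R[i]) (lambda : R[i]) :
  closure (A : set R[i]^o) lambda <->
  forall e : R, 0 < e -> exists2 z, A z & normc (z - lambda) < e.
Proof.
have ballE (e : R) (z : R[i]^o) : ball (lambda : R[i]^o) e%:C z = (normc (z - lambda) < e) :> Prop.
  by rewrite normcB -ltcR.
split=> [cA e e0|h B].
  have nb : nbhs (lambda : R[i]^o) (ball (lambda : R[i]^o) e%:C).
    by apply: nbhsx_ballx; rewrite ltcR.
  have [z [Az]] := cA _ nb; rewrite ballE => zl; by exists z.
move=> /nbhs_ballP[e /= e0 eB].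
have eE : e = (cRe e)%:C.
  by move: e0; case: (e) => a b; rewrite ltcE /= => /andP[/eqP -> _].
have e0' : 0 < cRe e by move: e0; rewrite eE ltcR.
have [z Az zl] := h _ e0'; exists z; split => //; apply: eB.
by rewrite eE ballE.
Qed.

Variables (freq P : set R) (g : R -> R[i]).
Hypothesis openfreq : open freq.
Hypothesis Pfreq : P `<=` freq.
Hypothesis P0 : P !=set0.
Hypothesis Pint : is_interval P.
Hypothesis gP : forall w, freq w -> exists2 w', P w' & g w' = g w.
Hypothesis g_real : forall w, freq w -> cIm (g w) = 0.
Hypothesis g_bounded : exists M : R, forall w, freq w -> normc (g w) <= M.
Hypothesis g_cont : forall w0 (e : R), freq w0 -> 0 < e -> exists2 d : R, 0 < d &
  forall w, freq w -> `|w - w0| < d -> normc (g w - g w0) < e.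

Let A := [set cRe (g w) | w in freq].

Let Re_cont w0 : freq w0 -> {for w0, continuous (fun w => cRe (g w))}.
Proof.
move=> fw0; apply/cvgrPdist_lt => e e0; have [d d0 dP] := g_cont fw0 e0.
have [d1 /= d10 d1P] := (nbhs_ballP _ _).1 (open_nbhs_nbhs (conj openfreq fw0)).
apply/nbhs_ballP; exists (Num.min d d1) => /=; first by rewrite lt_min d0.
move=> w; rewrite /ball/= lt_min => /andP[wd /d1P fw].
rewrite distrC in wd; apply: le_lt_trans (dP w fw wd).
by rewrite distrC -cReN -cReD; exact: cRe_le.
Qed.

Let A_interval x y v : A x -> A y -> x <= v <= y -> A v.
Proof.
move=> [wx fwx <-] [wy fwy <-] /andP[xv vy].
have key a b : P a -> P b -> a <= b ->
    Num.min (cRe (g a)) (cRe (g b)) <= v <= Num.max (cRe (g a)) (cRe (g b)) -> A v.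
  move=> Pa Pb ab hv.
  have Pab u : u \in `[a, b] -> P u by rewrite in_itv/=; exact: Pint.
  have [|u uab <-] := @IVT R (fun w => cRe (g w)) a b v ab _ hv.
    by apply: continuous_in_subspaceT => u; rewrite inE => /Pab/Pfreq; exact: Re_cont.
  by exists u => //; apply: Pfreq; exact: Pab.
have [a Pa ea] := gP fwx; have [b Pb eb] := gP fwy.
rewrite -ea in xv; rewrite -eb in vy.
have [ab|/ltW ba] := leP a b; [apply: (key a b)|apply: (key b a)] => //.
  by rewrite ge_min xv/= le_max vy orbT.
by rewrite ge_min xv orbT/= le_max vy.
Qed.

(** [freq] may be disconnected, but all values of [g] are attained on the interval [P], where the
    intermediate value theorem applies. *)
Lemma approached_interval :
  [set lambda | forall e : R, 0 < e -> exists2 w, freq w & normc (g w - lambda) < e] =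
  [set x%:C | x in `[inf A, sup A]].
Proof.
have [M MP] := g_bounded.
have MR w : freq w -> `|cRe (g w)| <= M by move=> /MP; apply: le_trans; exact: cRe_le.
have A0 : A !=set0 by have [w Pw] := P0; exists (cRe (g w)), w => //; exact: Pfreq.
have lA : has_lbound A.
  by exists (- M) => _ [w fw <-]; have := MR w fw; rewrite ler_norml => /andP[].
have uA : has_ubound A.
  by exists M => _ [w fw <-]; have := MR w fw; rewrite ler_norml => /andP[].
apply/seteqP; split => [lambda h|_ [x xA <-] e e0].
  have Im0 : cIm lambda = 0.
    apply/eqP; rewrite -normr_le0; apply/ler_addgt0Pr => e e0; rewrite add0r.
    have [w fw we] := h e e0; apply: le_trans (ltW we); rewrite normcB.
    by apply: le_trans (cIm_le _); rewrite cImD cImN (g_real fw) subr0.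
  have near e : 0 < e -> exists2 a, A a & `|a - cRe lambda| < e.
    move=> e0; have [w fw we] := h e e0; exists (cRe (g w)); first by exists w.
    by apply: le_lt_trans we; rewrite -cReN -cReD; exact: cRe_le.
  exists (cRe lambda); last by apply: complex_eqP => //=; rewrite Im0.
  rewrite /= in_itv/=; apply/andP; split; apply/ler_addgt0Pr => e e0; have [a Aa ae] := near e e0.
    apply: le_trans (ge_inf lA Aa) _; rewrite -lerBlDl.
    by apply: ltW; apply: le_lt_trans ae; exact: ler_norm.
  rewrite -lerBlDr; apply: le_trans (ub_le_sup uA Aa).
  by move: ae; rewrite ltr_distl => /andP[/ltW].
move: xA; rewrite /= in_itv/= => /andP[ix xs].
suff [a [w fw <-] wx] : exists2 a, A a & `|a - x| < e.
  exists w => //; have -> : g w = (cRe (g w))%:C by apply: complex_eqP; rewrite ?g_real.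
  by rewrite -(rmorphB (real_complex R)) normcR.
have [a Aa ax] := inf_adherent e0 (conj A0 lA).
have [b Ab bx] := sup_adherent e0 (conj A0 uA).
have ax' : a < x + e by apply: lt_le_trans ax _; rewrite lerD2r.
have bx' : x - e < b by apply: le_lt_trans bx; rewrite lerD2r.
(* Here a is a value close to the infimum and b one close to the supremum. Either one of them is
   within e of x, or a <= x - e and x + e <= b, so that x itself is a value. *)
have [xa|ax2] := ltP (x - e) a; first by exists a => //; rewrite ltr_distl xa.
have [bx2|xb] := ltP b (x + e); first by exists b => //; rewrite ltr_distl bx'.
exists x; last by rewrite subrr normr0.
by apply: (A_interval Aa Ab); apply/andP; split; lra.
Qed.

End approached_values.

Lemma gamma_real (R : realType) (c : setting) (Psi alpha : R -> R[i]) w :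
  (forall r, G1 c r -> cIm (alpha r) = 0) -> cIm (gamma c Psi alpha w) = 0.
Proof.
move=> ar; rewrite /gamma /cintegral /= /Rintegral integral0_eq// => r Dr.
by rewrite cImM ar// mulr0 mul0r addr0.
Qed.

Theorem theorem3p4 (R : realType) (c : setting) (Psi alpha : R -> R[i])
    (hPsi : admissible c Psi)
    (halpha : cmeasurable (G1 c : set (measurableTypeR R)) alpha)
    (hT : bounded_toeplitz c Psi alpha) :
  [/\ toeplitz_spectrum c Psi alpha = toeplitz_ess_spectrum c Psi alpha,
      toeplitz_spectrum c Psi alpha =
        closure (gamma c Psi alpha @` frequencies c : set (R[i]^o)) &
      (forall r, G1 c r -> complex.Im (alpha r) = 0) ->
        let A := [set complex.Re (gamma c Psi alpha xi) | xi in frequencies c] in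
        toeplitz_spectrum c Psi alpha = [set x%:C | x in `[inf A, sup A]]].
Proof.
have closureE : closure (gamma c Psi alpha @` frequencies c : set (R[i]^o)) =
    [set lambda | forall e : R, 0 < e ->
      exists2 w, frequencies c w & normc (gamma c Psi alpha w - lambda) < e].
  apply/seteqP; split => lambda.
    by move=> /closureCP h e e0; have [_ [w fw <-] we] := h e e0; exists w.
  by move=> h; apply/closureCP => e e0; have [w fw we] := h e e0; exists (gamma c Psi alpha w) => //; exists w.
rewrite closureE; case: hT => hL _; move: hPsi halpha hL closureE; case: c => hPsi halpha hL _.
- have [LPsi rPsi aPsi] := hPsi.
  have [sE eE] := wavelet_spectrum LPsi aPsi halpha hL.
  split; [by rewrite sE eE|by []|move=> ar A].
  (* The nonzero frequencies are disconnected; by evenness the positive half-line carries all the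
     values. *)
  rewrite sE; apply: (@approached_interval R _ `]0, +oo[%classic).
  + by apply: closed_openC; apply: accessible_closed_set1; apply: hausdorff_accessible; exact: Rhausdorff.
  + by move=> w; rewrite /= in_itv/= andbT => w0; apply/eqP; rewrite gt_eqF.
  + by exists 1; rewrite /= in_itv/= andbT.
  + exact: interval_is_interval.
  + move=> w fw; have [w0|w0|w0] := ltgtP w 0; last by case: fw.
    * exists (- w); first by rewrite /= in_itv/= andbT oppr_gt0.
      exact: (wavelet_gamma_even LPsi halpha rPsi).
    * by exists w; rewrite // /= in_itv/= andbT.
  + by move=> w _; exact: gamma_real.
  + exact: (wavelet_gamma_bounded LPsi aPsi halpha hL).
  + exact: (wavelet_gamma_cont LPsi aPsi halpha hL).
- have [LPsi nPsi] := hPsi.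
  have Psi1 : sqnorm (@lebesgue_measure R) setT Psi = 1%E by rewrite -l2norm_sqr nPsi expe2 mule1.
  have [sE eE] := tf_spectrum LPsi Psi1 halpha hL.
  split; [by rewrite sE eE|by []|move=> ar A].
  rewrite sE; apply: (@approached_interval R _ setT).
  + exact: openT.
  + by [].
  + by exists 0.
  + by [].
  + by move=> w _; exists w.
  + by move=> w _; exact: gamma_real.
  + exact: (tf_gamma_bounded LPsi Psi1 halpha hL).
  + exact: (tf_gamma_cont LPsi Psi1 halpha hL).
Qed.
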